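(* Let $X=\{x_n\}_{n=0}^\infty$ be a strictly increasing sequence with $x_0=0$ and $b:=\lim_{n\to\infty}x_n<\infty$, let $d_n:=x_n-x_{n-1}$ for $n\in\mathbb N$, and let $c>0$. Let $\alpha:=\{\alpha_n\}_1^\infty\subset\mathbb C^{p\times p}$ be a sequence of selfadjoint matrices, $\alpha_n=\alpha_n^*$, $n\in\mathbb N$. Then the Gesztesy–Šeba realization $\mathbf D_{X,\alpha}$ of the Dirac operator satisfies $n_\pm(\mathbf D_{X,\alpha})=p$ provided that $$\sum_{n=2}^\infty d_n\prod_{k=1}^{n-1}\Big(1+\frac1c\|\alpha_k\|_{\mathbb C^{p\times p}}\Big)^2<+\infty .$$
   Context: Let $\mathcal I=(0,b)$. The Dirac differential expression on $\mathbb C^{2p}$-valued functions $f=\binom{f_I}{f_{II}}$ with $f_I,f_{II}$ taking values in $\mathbb C^p$ is $$\mathbf D=-ic\frac{d}{dx}\otimes\begin{pmatrix}0&\mathbb I_p\\ \mathbb I_p&0\end{pmatrix}+\frac{c^2}{2}\begin{pmatrix}\mathbb I_p&0\\0&-\mathbb I_p\end{pmatrix},$$ where $c>0$. Let $W^{1,2}(\mathcal I\setminus X;\mathbb C^{2p})=\bigoplus_{n\ge1}W^{1,2}([x_{n-1},x_n];\mathbb C^{2p})$, and let $W^{1,2}_{\mathrm{comp}}(\mathcal I\setminus X;\mathbb C^{2p})$ be the set of its elements with compact support in $[0,b)$. The operator $\mathbf D^0_{X,\alpha}$ in $L^2(\mathcal I;\mathbb C^{2p})$ is the restriction of $\mathbf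 D$ (applied on each interval $(x_{n-1},x_n)$) to the domain of all $f\in W^{1,2}_{\mathrm{comp}}(\mathcal I\setminus X;\mathbb C^{2p})$ such that $f_I$ is locally absolutely continuous on $\mathcal I$, $f_{II}$ is locally absolutely continuous on $\mathcal I\setminus X$, $f_{II}(0+)=0$ and $f_{II}(x_n+)-f_{II}(x_n-)=-\frac{i\alpha_n}{c}f_I(x_n)$, $n\in\mathbb N$. The Gesztesy–Šeba realization $\mathbf D_{X,\alpha}$ is the closure of $\mathbf D^0_{X,\alpha}$; it is a symmetric operator. Deficiency indices: $n_\pm(T)=\dim\ker(T^*\mp iI)$. Matrix norms are operator norms. *)

(* Defs.v *)
From HB Require Import structures.
From mathcomp Require Import all_boot all_order all_algebra.
From mathcomp Require Import all_classical all_reals all_analysis.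
From mathcomp Require Import complex.

Set Implicit Arguments.
Unset Strict Implicit.
Unset Printing Implicit Defensive.

Import Order.TTheory GRing.Theory Num.Theory.
Import numFieldNormedType.Exports.

Local Open Scope classical_set_scope.
Local Open Scope ring_scope.

Section euclidean.
Variable R : realType.

Definition enorm m (v : 'cV[R[i]]_m) : R :=
  Num.sqrt (\sum_(k < m) (complex.Re (v k 0) ^+ 2 + complex.Im (v k 0) ^+ 2)).

Definition opnorm m (A : 'M[R[i]]_m) : R :=
  sup [set enorm (A *m v) | v in [set v : 'cV[R[i]]_m | enorm v <= 1]].

Definition conj_tr m (A : 'M[R[i]]_m) : 'M[R[i]]_m := map_mx conjc A^T.

End euclidean.

Section functions.
Variables (R : realType) (m : nat).
Implicit Types (f g : R -> 'cV[R[i]]_m) (D : set R).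

Definition vcvg (F : set_system R) f (v : 'cV[R[i]]_m) : Prop :=
  enorm (f y - v) @[y --> F] --> (0 : R).

(* The [u k, v k] are finitely many subintervals of [s, t] with pairwise
   disjoint interiors. *)
Definition abs_cont (s t : R) f : Prop :=
  forall eps : R, 0 < eps -> exists2 delta : R, 0 < delta &
    forall (n : nat) (u v : 'I_n -> R),
      (forall k, [/\ s <= u k, u k <= v k & v k <= t]) ->
      (forall j k, j != k -> v j <= u k \/ v k <= u j) ->
      \sum_(k < n) (v k - u k) < delta ->
      \sum_(k < n) enorm (f (v k) - f (u k)) < eps.

Definition locally_abs_cont D f : Prop :=
  forall s t : R, s <= t -> `[s, t] `<=` D -> abs_cont s t f.

Definition ae_derivative D f g : Prop :=
  {ae lebesgue_measure, forall x : R, D x -> forall k : 'I_m,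
     is_derive x 1 (fun y => complex.Re (f y k 0)) (complex.Re (g x k 0)) /\
     is_derive x 1 (fun y => complex.Im (f y k 0)) (complex.Im (g x k 0))}.

(* L^2(D; C^m).  Its elements are represented by (Borel measurable) functions,
   which are compared by [ae_eq lebesgue_measure D] instead of [=]; the values
   outside D are irrelevant. *)
Definition L2 D : set (R -> 'cV[R[i]]_m) := [set f : R -> 'cV[R[i]]_m |
  (forall k : 'I_m, measurable_fun D (fun x => complex.Re (f x k 0)) /\
                    measurable_fun D (fun x => complex.Im (f x k 0))) /\
  lebesgue_measure.-integrable D (fun x => (enorm (f x) ^+ 2)%:E)].

Definition L2norm D f : R :=
  Num.sqrt (\int[lebesgue_measure]_(x in D) (enorm (f x) ^+ 2)).

Definition L2inner D f g : R[i] :=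
  let s x := \sum_(k < m) f x k 0 * (g x k 0)^*%C in
  Complex (\int[lebesgue_measure]_(x in D) complex.Re (s x))
          (\int[lebesgue_measure]_(x in D) complex.Im (s x)).

(* f is in W^{1,2}([s, t]; C^m) and f' = g.  A locally absolutely continuous
   function on ]s, t[ with f' in L^2 extends to an absolutely continuous
   function on [s, t]; the values of f itself at s and t play no role. *)
Definition W12 (s t : R) f g : Prop :=
  [/\ L2 `]s, t[ f, L2 `]s, t[ g, locally_abs_cont `]s, t[ f
    & ae_derivative `]s, t[ f g].

End functions.

(* Unbounded operators in L^2(D; C^m), given by their graphs. *)
Section operators.
Variables (R : realType) (m : nat) (D : set R).
Local Notation H := (R -> 'cV[R[i]]_m).
Implicit Types (T : set (H * H)) (K : set H).

Definition op_closure T : set (H * H) := [set FU |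
  [/\ L2 D FU.1, L2 D FU.2 &
   exists2 s : nat -> H * H, (forall n, T (s n)) &
     L2norm D ((s n).1 \- FU.1) @[n --> \oo] --> (0 : R) /\
     L2norm D ((s n).2 \- FU.2) @[n --> \oo] --> (0 : R)]].

Definition op_adjoint T : set (H * H) := [set GW |
  [/\ L2 D GW.1, L2 D GW.2 &
   forall F U : H, T (F, U) -> L2inner D U GW.1 = L2inner D F GW.2]].

Definition op_ker_shift T (z : R[i]) : set H := [set G |
  exists2 W : H, T (G, W) &
    ae_eq lebesgue_measure D (fun x => W x - z *: G x) (cst 0)].

Definition has_dim K (n : nat) : Prop :=
  exists e : 'I_n -> H,
    [/\ forall k, K (e k),
        forall a : 'I_n -> R[i],
          ae_eq lebesgue_measure D (fun x => \sum_(k < n) a k *: e k x)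
            (cst 0) ->
          forall k, a k = 0
      & forall F : H, K F -> exists a : 'I_n -> R[i],
          ae_eq lebesgue_measure D F (fun x => \sum_(k < n) a k *: e k x)].

Definition n_plus T (n : nat) : Prop :=
  has_dim (op_ker_shift (op_adjoint T) 'i%C) n.

Definition n_minus T (n : nat) : Prop :=
  has_dim (op_ker_shift (op_adjoint T) (- 'i%C)) n.

End operators.

Section dirac.
Variables (R : realType) (p : nat).
Local Notation H := (R -> 'cV[R[i]]_(p + p)).

(* The value of the Dirac expression at a point where the function has value v
   and derivative w. *)
Definition dirac_expr (c : R) (v w : 'cV[R[i]]_(p + p)) : 'cV[R[i]]_(p + p) :=
  (- 'i%C * c%:C%C) *: (block_mx 0 1%:M 1%:M 0 *m w)
  + (c%:C%C ^+ 2 / 2) *: (block_mx 1%:M 0 0 (- 1%:M) *m v).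

Variables (c b : R) (x : nat -> R) (alpha : nat -> 'M[R[i]]_p).

(* The conditions on L^2(]0, b[) express that the direct sum of the
   W^{1,2}([x_(n-1), x_n]) is an l^2-sum. *)
Definition W12_X (f g : H) : Prop :=
  [/\ L2 `]0, b[ f, L2 `]0, b[ g & forall n, W12 (x n) (x n.+1) f g].

Definition W12_X_comp (f g : H) : Prop :=
  W12_X f g /\
  exists2 beta : R, beta < b & ae_eq lebesgue_measure `]beta, b[%classic f (cst 0).

Definition fI (f : H) : R -> 'cV[R[i]]_p := fun y => usubmx (f y).
Definition fII (f : H) : R -> 'cV[R[i]]_p := fun y => dsubmx (f y).

(* f is (the representative satisfying the pointwise conditions of) an element
   of the domain of D^0_{X,alpha}, and f' = g. *)
Definition GS_dom0 (f g : H) : Prop :=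
  [/\ W12_X_comp f g,
      locally_abs_cont `]0, b[ (fI f),
      locally_abs_cont (`]0, b[ `\` range x) (fII f),
      vcvg (0^'+) (fII f) 0
    & forall n, (1 <= n)%N -> exists vp vm : 'cV[R[i]]_p,
        [/\ vcvg ((x n)^'+) (fII f) vp, vcvg ((x n)^'-) (fII f) vm
          & vp - vm = - ('i%C / c%:C%C) *: (alpha n *m fI f (x n))]].

Definition GS_graph0 : set (H * H) := [set FU |
  [/\ L2 `]0, b[ FU.1, L2 `]0, b[ FU.2 &
   exists f g : H,
     [/\ GS_dom0 f g, ae_eq lebesgue_measure `]0, b[%classic FU.1 f
       & ae_eq lebesgue_measure `]0, b[%classic FU.2
           (fun y => dirac_expr c (f y) (g y))]]].

Definition GS_graph : set (H * H) := op_closure `]0, b[ GS_graph0.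

End dirac.

(* Main.v *)
Require Import Defs.
From HB Require Import structures.
From mathcomp Require Import all_boot all_order all_algebra.
From mathcomp Require Import all_classical all_reals all_analysis.
From mathcomp Require Import measurable_realfun complex ring lra.

Set Implicit Arguments.
Unset Strict Implicit.
Unset Printing Implicit Defensive.

Import Order.TTheory GRing.Theory Num.Theory.
Import numFieldNormedType.Exports.

Local Open Scope classical_set_scope.
Local Open Scope ring_scope.

(** Write T0 for the operator on compactly supported functions, z for i or -i,
    and sigma for the matrix that swaps the two blocks of C^(p + p).  Passing to
    the closure does not change the adjoint, so the two deficiency spaces are
    the spaces of all square-integrable G with <U, G> = <F, z G> for every
    (F, U) in the graph of T0.  As the conjugate of z is -z, such a G is a
    function orthogonal to the range of T0 + z.

    On an interval of the partition, D f = z f reads f' = A f with a constant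
    Hermitian matrix A, and z^2 = -1 gives A^2 = kappa^2.  Hence
    exp (t A) = cosh (kappa t) + sinh (kappa t) A / kappa, and A / kappa is a
    Hermitian involution, so that exp (t A) has norm at most exp (kappa t).  At
    x_n the jump condition multiplies by a unipotent matrix of norm at most
    1 + |alpha_n| / c.  The resulting fundamental matrix Y_z is therefore bounded
    on the n-th interval by a constant times the product whose square occurs in
    the hypothesis, so that all columns of Y_z are square integrable
    ([fund_L2]).  Moreover the adjoint of Y_z times sigma times Y_(-z) is
    constantly sigma ([piece_swap]).

    Each e = Y_z (a, 0), with a in C^p, lies in the deficiency space: for f in
    the domain of T0 the function w = adjoint(e) sigma f has derivative
    (i / c) adjoint(e) (D f + z f); it is continuous at x_n because e and f jump by
    the same matrix and this matrix preserves sigma; and w vanishes at 0 and near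
    b.  So D f + z f is orthogonal to e ([lagrange]).  The domain consists of
    absolutely continuous functions, which makes this rest on the Lebesgue
    fundamental theorem of calculus ([ftc_ac]).

    Conversely, let h be square integrable, zero beyond some x_N, and orthogonal
    to all these e.  Variation of constants, f = Y_(-z) v with
    v' = (i / c) sigma adjoint(Y_z) h and v(b) = 0, solves D f + z f = h with
    compact support, and the orthogonality is the boundary condition
    f_II(0) = 0; thus h is in the range of T0 + z ([fund_range]).  Given G in the
    deficiency space, subtract from it a combination of the e so that the
    remainder G' is orthogonal to a system Phi supported in (0, x_1) and
    biorthogonal to the e.  Then G' cut off at x_N, corrected by Phi, is an
    admissible h, and pairing it with G' shows that G' vanishes on (0, x_N).  As
    N is arbitrary, G is a combination of the p columns ([ker_has_dim]). *)

(** * Absolute continuity of increment functions *)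

Section variation.
Variable R : realType.
Implicit Types (s t : R) (phi psi : R -> R -> R).

(** The condition of absolute continuity, for an arbitrary function phi of the
    end points in place of the norm of an increment.  Sums, multiples and upper
    bounds of such phi then give the closure properties of absolutely continuous
    functions with values in R, C or C^m at once. *)
Definition ac_increments s t phi : Prop :=
  forall eps : R, 0 < eps -> exists2 delta : R, 0 < delta &
    forall (n : nat) (u v : 'I_n -> R),
      (forall k, [/\ s <= u k, u k <= v k & v k <= t]) ->
      (forall j k, j != k -> v j <= u k \/ v k <= u j) ->
      \sum_(k < n) (v k - u k) < delta ->
      \sum_(k < n) phi (u k) (v k) < eps.

Lemma ac_le s t phi psi :
  (forall u v, s <= u -> u <= v -> v <= t -> phi u v <= psi u v) ->
  ac_increments s t psi -> ac_increments s t phi.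
Proof.
move=> le H e e0; have [d d0 Hd] := H e e0; exists d => // n u v uv dj sm.
by apply: le_lt_trans (Hd n u v uv dj sm); apply: ler_sum => k _; case: (uv k) => ? ? ?; apply: le.
Qed.

Lemma ac_subitv s t s' t' phi : s <= s' -> t' <= t ->
  ac_increments s t phi -> ac_increments s' t' phi.
Proof.
move=> ss tt H e e0; have [d d0 Hd] := H e e0; exists d => // n u v uv dj sm.
apply: Hd => // k; case: (uv k) => ? ? ?; split => //; first exact: le_trans ss _.
exact: le_trans _ tt.
Qed.

Lemma ac_zero s t : ac_increments s t (fun _ _ => 0).
Proof. by move=> e e0; exists 1 => // n u v _ _ _; rewrite big1. Qed.

Lemma ac_add s t phi psi : ac_increments s t phi -> ac_increments s t psi ->
  ac_increments s t (fun u v => phi u v + psi u v).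
Proof.
move=> H1 H2 e e0; have e2 : 0 < e / 2 by rewrite divr_gt0.
have [d d0 Hd] := H1 _ e2; have [d' d0' Hd'] := H2 _ e2.
exists (Num.min d d'); first by rewrite lt_min d0.
move=> n u v uv dj; rewrite lt_min => /andP[s1 s2].
rewrite big_split /= [ltRHS](splitr e); apply: ltrD; [exact: Hd|exact: Hd'].
Qed.

Lemma ac_scale s t M phi : 0 <= M -> ac_increments s t phi ->
  ac_increments s t (fun u v => M * phi u v).
Proof.
move=> M0 H e e0; have M1 : 0 < M + 1 by rewrite ltr_wpDl.
have [d d0 Hd] := H _ (divr_gt0 e0 M1); exists d => // n u v uv dj sm.
rewrite -mulr_sumr; have := Hd n u v uv dj sm; set S := \sum_(k < n) _ => HS.
have [S0|S0] := leP S 0; first by apply: le_lt_trans e0; rewrite mulr_ge0_le0.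
rewrite ltr_pdivlMr // in HS; apply: le_lt_trans HS.
by rewrite mulrC ler_pM2l // lerDl.
Qed.

Lemma ac_sum s t (I : Type) (r : seq I) (phi : I -> R -> R -> R) :
  (forall i, ac_increments s t (phi i)) ->
  ac_increments s t (fun u v => \sum_(i <- r) phi i u v).
Proof.
move=> H; elim: r => [|i r IH].
  by apply: (ac_le _ (@ac_zero s t)) => u v _ _ _; rewrite big_nil.
by apply: (ac_le _ (ac_add (H i) IH)) => u v _ _ _; rewrite big_cons.
Qed.

(** An interval [u, v] is split at t without a case distinction into
    [min u t, min v t] and [max u t, max v t]; these stay disjoint because min
    and max are monotone, so the two families are admissible on the two sides. *)
Lemma ac_cat s t w phi : (forall u, phi u u = 0) ->
  (forall u v, u <= t -> t <= v -> phi u v <= phi u t + phi t v) ->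
  s <= t -> t <= w ->
  ac_increments s t phi -> ac_increments t w phi -> ac_increments s w phi.
Proof.
move=> p0 pD st tw H1 H2.
have le2 u v : u <= v ->
    phi u v <= phi (Num.min u t) (Num.min v t) + phi (Num.max u t) (Num.max v t).
  move=> uv; have := p0 t.
  have [ut|tu] := leP u t; have [vt|tv] := leP v t; last 2 first.
  - by have : u < u by [apply: le_lt_trans uv (le_lt_trans vt tu)]; rewrite ltxx.
  - lra.
  - lra.
  - by have := pD u v ut (ltW tv); lra.
move=> e e0; have e2 : 0 < e / 2 by rewrite divr_gt0.
have [d d0 Hd] := H1 _ e2; have [d' d0' Hd'] := H2 _ e2.
exists (Num.min d d'); first by rewrite lt_min d0.
move=> n u v uv dj; rewrite lt_min => /andP[s1 s2].
rewrite [ltRHS](splitr e).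
apply: (@le_lt_trans _ _ (\sum_(k < n) phi (Num.min (u k) t) (Num.min (v k) t)
    + \sum_(k < n) phi (Num.max (u k) t) (Num.max (v k) t))).
  by rewrite -big_split; apply: ler_sum => k _; apply: le2; case: (uv k).
apply: ltrD; [apply: Hd|apply: Hd'].
- move=> k; case: (uv k) => ? uvk ?; split; last by rewrite ge_min lexx orbT.
    by rewrite le_min; apply/andP.
  by rewrite le_min !ge_min uvk lexx orbT.
- by move=> j k /dj [] ?; [left|right]; rewrite le_min !ge_min lexx ?orbT ?andbT; apply/orP; left.
- apply: le_lt_trans s1; apply: ler_sum => k _; case: (uv k) => _ uvk _.
  by rewrite /Num.min; case: ifP => h1; case: ifP => h2; lra.
- move=> k; case: (uv k) => ? uvk ?; split; first by rewrite le_max lexx orbT.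
    by rewrite ge_max !le_max uvk lexx orbT.
  by rewrite ge_max; apply/andP.
- by move=> j k /dj [] ?; [left|right]; rewrite ge_max !le_max lexx ?orbT ?andbT; apply/orP; left.
- apply: le_lt_trans s2; apply: ler_sum => k _; case: (uv k) => _ uvk _.
  by rewrite /Num.max; case: ifP => h1; case: ifP => h2; lra.
Qed.

Lemma ac_single s t phi : ac_increments s t phi -> forall e, 0 < e ->
  exists2 d, 0 < d & forall u v, s <= u -> u <= v -> v <= t -> v - u < d ->
    phi u v < e.
Proof.
move=> H e e0; have [d d0 Hd] := H e e0; exists d => // u v su uv vt vud.
have := Hd 1%N (fun=> u) (fun=> v); rewrite !big_ord1; apply => //.
by move=> j k; rewrite !ord1 eqxx.
Qed.

(** Steps shorter than the delta belonging to 1 increase phi s by at most 1, so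
    the number of steps needed to reach y bounds phi s y. *)
Lemma ac_bounded s t phi : (forall u, phi u u = 0) ->
  (forall u v, s <= u -> u <= v -> phi s v <= phi s u + phi u v) ->
  ac_increments s t phi -> exists M, forall y, s <= y -> y <= t -> phi s y <= M.
Proof.
move=> p0 pD /ac_single /(_ 1 ltr01) [d d0 Hd].
have bnd (n : nat) y : s <= y -> y <= t -> y - s <= n%:R * (d / 2) -> phi s y <= n%:R.
  elim: n y => [|n IH] y sy yt.
    by rewrite mul0r subr_le0 => ys; rewrite (@le_anti _ _ y s) ?p0 ?ys.
  rewrite -natr1 mulrDl mul1r => yn.
  have [ys|ys] := leP y (s + d / 2).
    have : phi s y < 1 by apply: Hd => //; lra.
    by have := ler0n R n; lra.
  apply: le_trans (pD (y - d / 2) y _ _) _; [lra|lra|].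
  by apply: lerD; [apply: IH; lra|apply/ltW/Hd; lra].
exists (Num.truncn ((t - s) / (d / 2))).+1%:R => y sy yt; apply: bnd => //.
rewrite -ler_pdivrMr ?divr_gt0 //; apply: le_trans (ltW (truncnS_gt _)).
by rewrite ler_pM2r ?invr_gt0 ?divr_gt0 //; lra.
Qed.

End variation.

(** * Almost everywhere statements on the line *)

Section ftc_ac.
Variable R : realType.
Local Notation mu := (@lebesgue_measure R).

Lemma aeS (P Q : R -> Prop) : (forall y, P y -> Q y) ->
  {ae mu, forall y, P y} -> {ae mu, forall y, Q y}.
Proof. by move=> PQ; apply: filterS; first exact: (ae_filter_ringOfSetsType mu). Qed.

Lemma aeS2 (P Q S : R -> Prop) : (forall y, P y -> Q y -> S y) ->
  {ae mu, forall y, P y} -> {ae mu, forall y, Q y} -> {ae mu, forall y, S y}.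
Proof. by move=> PQ; apply: filterS2; first exact: (ae_filter_ringOfSetsType mu). Qed.

Lemma ae_fin (I : finType) (P : I -> R -> Prop) :
  (forall i, {ae mu, forall y, P i y}) -> {ae mu, forall y, forall i, P i y}.
Proof.
by move=> H; exact: (filter_forall (ae_filter_ringOfSetsType mu) H).
Qed.

Lemma ae_nat (P : nat -> R -> Prop) :
  (forall i, {ae mu, forall y, P i y}) -> {ae mu, forall y, forall i, P i y}.
Proof. exact: (@ae_foralln _ (measurableTypeR R) R mu P). Qed.

Lemma is_derive0_near (h : R -> R) (y eps : R) : 0 < eps -> is_derive y 1 h 0 ->
  exists2 r, 0 < r & forall z, `|z - y| < r -> `|h z - h y| <= eps * `|z - y|.
Proof.
move=> e0 H; have := @ex_derive _ _ _ _ _ _ _ H.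
move=> /cvg_ex [l hl].
have : l = 0.
  have := @derive_val _ _ _ _ _ _ _ H; rewrite /derive => <-.
  by apply/esym/cvg_lim => //; exact: Rhausdorff.
move=> l0; rewrite {}l0 in hl.
move/cvgr0Pnorm_lt: hl => /(_ _ e0).
rewrite near_withinE /= => /nbhs_ballP [r /= r0 Hr].
exists r => // z zr.
have [->|zy] := eqVneq z y; first by rewrite !subrr !normr0 mulr0.
have zy0 : z - y != 0 by rewrite subr_eq0.
have := Hr (z - y); rewrite /ball /= sub0r normrN => /(_ zr zy0).
rewrite /= scaler1 subrK normrZ normfV => /ltW.
by rewrite mulrC ler_pdivrMr ?normr_gt0.
Qed.

Lemma le_mu (A B : set R) : measurable A -> measurable B -> A `<=` B ->
  (mu A <= mu B)%E.
Proof. by move=> mA mB AB; apply: le_measure; rewrite ?inE. Qed.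

Lemma ae_exists (P : R -> Prop) (s t : R) : s < t ->
  {ae mu, forall y, s < y < t -> P y} -> exists2 y, s < y < t & P y.
Proof.
move=> st [N [mN N0 subN]]; apply: contrapT => nP.
have sN : `]s, t[ `<=` N.
  move=> y /=; rewrite in_itv /= => yst; apply: subN => /= H.
  by apply: nP; exists y => //; exact: H.
have := le_mu (measurable_itv `]s, t[) mN sN.
by rewrite [leRHS]N0 lebesgue_measure_itv /= lte_fin st -EFinB lee_fin; lra.
Qed.

(** Cover the exceptional null set by an open U of measure less than the delta of
    absolute continuity.  Around a point outside the null set h grows by at most
    e times the length, and around the others the small intervals lie in U.
    Instead of extracting a finite subcover, real induction on y carries the
    assertion S y: up to e (y - s), the increment of h over [s, y] is the sum of
    its increments over disjoint intervals whose total length is at most the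
    measure of U in ]s, y]. *)
Lemma ac_deriv0_cst (s t : R) (h : R -> R) : s <= t ->
  ac_increments s t (fun u v => `|h v - h u|) ->
  {ae mu, forall y, s < y < t -> is_derive y 1 h 0} -> h t = h s.
Proof.
move=> st ach hae.
suff key e : 0 < e -> `|h t - h s| <= e * (t - s) + e.
  apply/eqP; rewrite -subr_eq0 -normr_le0; apply/ler_addgt0Pr => e e0.
  rewrite add0r; have d0 : 0 < t - s + 1 by lra.
  have := key _ (divr_gt0 e0 d0); suff -> : e / (t - s + 1) * (t - s) + e / (t - s + 1) = e by [].
  by field; rewrite gt_eqF.
move=> e0; have [d d0 Hd] := ach _ e0.
(* The end points join the null set: no derivative is known there. *)
have [N [mN N0 subN]] : mu.-negligible
    ([set y | ~ (s < y < t -> is_derive y 1 h 0)] `|` [set s; t]).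
  apply: negligibleU; first exact: hae.
  apply/negligibleP; first by apply: measurableU; exact: measurable_set1.
  exact/countable_lebesgue_measure0/finite_set_countable.
have [|U [Uo NU muU]] := lebesgue_regularity_outer mN _ d0; first by rewrite [X in (X < _)%E]N0 ltry.
have mU : measurable U by exact: open_measurable.
have {}muU : (mu U < d%:E)%E.
  rewrite -(setDUK NU) (le_lt_trans (measureU2 mu _ _)) //; first exact: measurableD.
  by rewrite [X in (X + _)%E]N0 add0e.
pose m y := fine (mu (U `&` `]s, y])).
have mUs y : measurable (U `&` `]s, y]).
  by apply: measurableI => //; exact: measurable_itv.
have mufin y : mu (U `&` `]s, y]) \is a fin_num.
  rewrite ge0_fin_numE //; apply: le_lt_trans (lt_trans muU (ltry _)).
  exact: le_mu (mUs _) mU (@subIsetl _ _ _).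
pose S y := exists (n : nat) (u v : 'I_n -> R),
  [/\ forall k, [/\ s <= u k, u k <= v k & v k <= y],
      forall j k, j != k -> v j <= u k \/ v k <= u j,
      \sum_(k < n) (v k - u k) <= m y &
      `|h y - h s| <= e * (y - s) + \sum_(k < n) `|h (v k) - h (u k)| ].
have step a b : s <= a -> a <= b -> b <= t -> S a ->
    `|h b - h a| <= e * (b - a) \/ (`]a, b] `<=` U) -> S b.
  move=> sa ab bt [n [u [v [uv dj sm hs]]]].
  have hba : `|h b - h s| <= `|h b - h a| + `|h a - h s|.
    by have -> : h b - h s = (h b - h a) + (h a - h s) by [ring]; exact: ler_normD.
  move=> [hab|abU].
    exists n, u, v; split => //.
    - by move=> k; case: (uv k) => ? ? ?; split => //; lra.
    - apply: le_trans sm _; rewrite /m fine_le //; apply: le_mu (mUs _) (mUs _) _.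
      by apply: setIS; apply: subset_itvl; rewrite bnd_simp.
    - lra.
  exists n.+1, (fun k => if unlift ord0 k is Some j then u j else a),
    (fun k => if unlift ord0 k is Some j then v j else b); split.
  - move=> k; case: unliftP => [j _|_]; last by [].
    by case: (uv j) => ? ? ?; split => //; lra.
  - move=> j k; case: unliftP => [j' ->|->]; case: unliftP => [k' ->|->].
    + by move=> jk; apply: dj; apply: contraNneq jk => ->.
    + by move=> _; left; case: (uv j').
    + by move=> _; right; case: (uv k').
    + by rewrite eqxx.
  - rewrite big_ord_recl unlift_none; under eq_bigr do rewrite liftK.
    have -> : m b = m a + (b - a).
      have muab : mu `]a, b] = (b - a)%:E.
        rewrite lebesgue_measure_itv /= lte_fin -EFinB.
        by case: ltgtP ab => // -> _; rewrite subrr.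
      rewrite /m (_ : U `&` `]s, b] = (U `&` `]s, a]) `|` `]a, b]); last first.
        rewrite (@itv_bndbnd_setU _ _ _ (BRight a)) ?bnd_simp //.
        by rewrite setIUr; congr (_ `|` _); apply/setIidPr.
      have mD : mu ((U `&` `]s, a]) `|` `]a, b]) = (mu (U `&` `]s, a]) + mu `]a, b])%E.
        apply: measureU; [exact: mUs|exact: measurable_itv|].
        by apply/seteqP; split => z //= [[_]]; rewrite !in_itv /= => /andP[_ za] /andP[az _]; move: (lt_le_trans az za); rewrite ltxx.
      by rewrite mD muab fineD //; exact: mufin.
    by rewrite addrC lerD2r.
  - rewrite big_ord_recl unlift_none; under eq_bigr do rewrite liftK.
    suff : e * (a - s) <= e * (b - s) by lra.
    by rewrite ler_pM2l // lerD2r.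
have loc y : s <= y <= t -> exists2 r, 0 < r &
    (forall z, `|z - y| < r -> `|h z - h y| <= e * `|z - y|) \/
    (forall z, `|z - y| < r -> U z).
  move=> yst; have [yN|yN] := pselect (N y).
    have : nbhs y U by apply: open_nbhs_nbhs; split => //; exact: NU.
    move=> /nbhs_ballP [r /= r0 rU]; exists r => //; right => z zy; apply: rU.
    by rewrite /ball /= distrC.
  have := contra_not (@subN y) yN => /not_orP [/contrapT yd /not_orP [ys yt]].
  have {}yst : s < y < t.
    by case/andP: yst => sy yt'; rewrite !lt_neqAle sy yt' [s == y]eq_sym !andbT; apply/andP; split; apply/eqP.
  have [r r0 Hr] := is_derive0_near e0 (yd yst).
  by exists r => //; left.
pose A := [set y | s <= y <= t /\ S y].
have As : A s.
  split; first by rewrite lexx.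
  exists 0%N, (fun=> 0), (fun=> 0); split; try by case.
    by rewrite big_ord0 /m fine_ge0.
  by rewrite big_ord0 !subrr normr0 mulr0 addr0.
have hsA : has_sup A by split; [exists s | exists t => y [/andP[]]].
pose z := sup A.
have sz : s <= z by apply: ub_le_sup => //; case: hsA.
have zt : z <= t by apply: ge_sup => [|y [/andP[]]//]; exists s.
have [r r0 Hr] := loc z (introT andP (conj sz zt)).
have Sz : S z.
  have [a [/andP[sa at_] Sa] za] := sup_adherent r0 hsA.
  have az : a <= z by apply: ub_le_sup; [case: hsA|split => //; rewrite sa].
  apply: (step a) => //; case: Hr => Hr; [left|right].
    by have := Hr a; rewrite distrC [`|h a - _|]distrC ger0_norm ?subr_ge0 //; apply; rewrite -/z in za; lra.
  move=> w /=; rewrite in_itv /= => /andP[aw wz]; apply: Hr.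
  by rewrite distrC ger0_norm ?subr_ge0 //; rewrite -/z in za; lra.
have ztE : z = t.
  apply/eqP; rewrite eq_le zt leNgt; apply/negP => ltzt.
  pose w := Num.min t (z + r / 2).
  have zw : z < w by rewrite lt_min ltzt ltrDl divr_gt0.
  have wt : w <= t by rewrite ge_min lexx.
  have wr : w < z + r by rewrite gt_min; apply/orP; right; lra.
  suff : S w.
    move=> Sw; have : w <= z by apply: ub_le_sup; [by case: hsA|split => //; apply/andP; split => //; lra].
    by rewrite leNgt zw.
  apply: (step z) => //; [exact: ltW|]; case: Hr => Hr; [left|right].
    by have := Hr w; rewrite [`|w - _|]ger0_norm; [apply|]; rewrite ?ger0_norm; lra.
  move=> w' /=; rewrite in_itv /= => /andP[aw wz]; apply: Hr.
  by rewrite ger0_norm; lra.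
rewrite ztE in Sz; case: Sz => n [u [v [uv dj sm hs]]].
have smd : \sum_(k < n) (v k - u k) < d.
  apply: le_lt_trans sm _; rewrite -lte_fin fineK //; apply: le_lt_trans muU.
  exact: le_mu (mUs _) mU (@subIsetl _ _ _).
by have := Hd n u v uv dj smd; lra.
Qed.

(** * Integrals of real functions *)

(** Folded, so that measurability, integrability and the integral always refer to
    the same measurable structure on R. *)
Definition rmeas (D : set R) (f : R -> R) : Prop := measurable_fun D f.
Definition rinteg (D : set R) (f : R -> R) : Prop :=
  lebesgue_measure.-integrable D (fun x => (f x)%:E).
Definition rint (D : set R) (f : R -> R) : R := \int[lebesgue_measure]_(x in D) f x.

Section rint.
Variable D : set R.
Hypothesis mD : measurable D.
Let mD' : @measurable _ (measurableTypeR R) D := mD.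

Lemma rmeasP f : rmeas D f <-> @measurable_fun _ _ (measurableTypeR R) _ D (EFin \o f).
Proof.
split=> H; first exact/(@measurable_EFinP _ (measurableTypeR R)).
exact/(@measurable_EFinP _ (measurableTypeR R)).
Qed.

Lemma rintegP f : rinteg D f <->
  rmeas D f /\ (\int[mu]_(x in D) (`|f x|)%:E < +oo)%E.
Proof.
by split=> [/integrableP[/rmeasP]|[/rmeasP ? ?]]; last exact/integrableP.
Qed.

Lemma rintegD f g : rinteg D f -> rinteg D g -> rinteg D (fun x => f x + g x).
Proof. by move=> H1 H2; have := integrableD mD' H1 H2. Qed.

Lemma rintegZ r f : rinteg D f -> rinteg D (fun x => r * f x).
Proof. by move=> H; have := integrableZl mD' r H. Qed.

Lemma rinteg0 : rinteg D (fun=> 0).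
Proof. exact: (@integrable0 _ (measurableTypeR R) R mu D). Qed.

Lemma rinteg_cst r : (mu D < +oo)%E -> rinteg D (fun=> r).
Proof.
move=> Doo; apply/rintegP; split; first exact: measurable_cst.
by rewrite (@integral_cst _ (measurableTypeR R) R mu D mD') lte_mul_pinfty ?lee_fin.
Qed.

Lemma rinteg_le f g : rmeas D f -> (forall x, D x -> `|f x| <= g x) ->
  rinteg D g -> rinteg D f.
Proof.
move=> mf fg; apply: (@le_integrable _ (measurableTypeR R) R mu D mD'); first exact/rmeasP.
by move=> x Dx; rewrite lee_fin (le_trans (fg x Dx)) // ler_norm.
Qed.

Lemma rinteg_norm f : rinteg D f -> rinteg D (fun x => `|f x|).
Proof. by move=> H; have := integrable_abse H. Qed.

Lemma rinteg_meas f : rinteg D f -> rmeas D f.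
Proof. by case/rintegP. Qed.

Lemma rintD f g : rinteg D f -> rinteg D g ->
  rint D (fun x => f x + g x) = rint D f + rint D g.
Proof. exact: (@RintegralD _ (measurableTypeR R) R mu D f g mD'). Qed.

Lemma rintZ r f : rinteg D f -> rint D (fun x => r * f x) = r * rint D f.
Proof. exact: (@RintegralZl _ (measurableTypeR R) R mu D f r mD'). Qed.

Lemma rint_le f g : rinteg D f -> rinteg D g -> (forall x, D x -> f x <= g x) ->
  rint D f <= rint D g.
Proof. exact: (@le_Rintegral _ (measurableTypeR R) R mu D f g mD'). Qed.

Lemma rint_normr f : rinteg D f -> `|rint D f| <= rint D (fun x => `|f x|).
Proof. exact: (@le_normr_Rintegral _ (measurableTypeR R) R mu D f mD'). Qed.

Lemma rint_ae f g : rmeas D f -> rmeas D g ->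
  ae_eq lebesgue_measure D f g -> rint D f = rint D g.
Proof.
move=> /rmeasP mf /rmeasP mg fg; rewrite /rint /Rintegral; congr fine.
apply: (@ae_eq_integral _ (measurableTypeR R) R mu D _ _ mD' mf mg).
by apply: aeS fg => x /[apply] /= ->.
Qed.

Lemma rint_eq0 f : rinteg D f -> (forall x, D x -> 0 <= f x) -> rint D f = 0 ->
  ae_eq lebesgue_measure D f (cst 0).
Proof.
move=> If f0 I0.
have : (\int[mu]_(x in D) `|(f x)%:E| = 0)%E.
  rewrite (@eq_integral _ (measurableTypeR R) R mu D (fun x => (f x)%:E)); last first.
    by move=> x /set_mem Dx; rewrite gee0_abs // lee_fin f0.
  move: I0; rewrite /rint /Rintegral => /eqP; rewrite fine_eq0; first by move/eqP.
  exact: (@integrable_fin_num _ (measurableTypeR R) R mu D mD').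
move=> /(ae_eq_integral_abs mu mD' (measurable_int _ If)).
by apply: aeS => x /[apply] -[].
Qed.

End rint.

Lemma eq_rint (D : set R) f g : (forall x, D x -> f x = g x) -> rint D f = rint D g.
Proof. by move=> fg; apply: eq_Rintegral => x /set_mem; exact: fg. Qed.

Lemma eq_rinteg (D : set R) f g : measurable D -> (forall x, D x -> f x = g x) ->
  rinteg D f -> rinteg D g.
Proof.
move=> mD fg; apply: (@eq_integrable _ (measurableTypeR R) R mu D mD) => x /set_mem.
by move=> /fg ->.
Qed.

Lemma rinteg_sub (A B : set R) f : measurable A -> measurable B -> A `<=` B ->
  rinteg B f -> rinteg A f.
Proof. by move=> mA mB AB; apply: integrableS. Qed.

Lemma rinteg_patch (A : set R) f : measurable A -> rinteg A f -> rinteg setT (f \_ A).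
Proof.
move=> mA fA.
have := (@integrable_mkcond _ (measurableTypeR R) R mu A (EFin \o f) mA).1 fA.
by rewrite restrict_EFin.
Qed.

Lemma rint_patch (A B : set R) f : A `<=` B -> rint B (f \_ A) = rint A f.
Proof.
by move=> AB; rewrite /rint -Rintegral_mkcondr (setIidr AB).
Qed.

(** Comparison with the step function that equals B i on the i-th piece. *)
Lemma rinteg_bigcup (F : nat -> set R) (g : R -> R) (B : nat -> R) :
  (forall i, measurable (F i)) -> trivIset setT F ->
  (forall i, rmeas (F i) g) ->
  (forall i y, F i y -> 0 <= g y <= B i) ->
  (\sum_(i <oo) ((B i)%:E * mu (F i)) < +oo)%E ->
  rinteg (\bigcup_i F i) g.
Proof.
move=> mF tF mg gB sB.
have mF' i : @measurable _ (measurableTypeR R) (F i) by exact: mF.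
have mU : rmeas (\bigcup_i F i) g by apply/measurable_fun_bigcup.
have g0 y : (\bigcup_i F i) y -> 0 <= g y by move=> [i _ /gB /andP[]].
apply/rintegP; split => //; apply: le_lt_trans sB.
rewrite (@eq_integral _ (measurableTypeR R) R mu _ (fun y => (g y)%:E)); last first.
  by move=> y /set_mem /g0 gy; rewrite ger0_norm.
rewrite (@ge0_integral_bigcup _ (measurableTypeR R) R mu F) //; first last.
  by apply/rmeasP.
apply: lee_nneseries => [i _ _|i _].
  by apply: integral_ge0 => y Fy; rewrite lee_fin; case/andP: (gB i y Fy).
rewrite -(@integral_cst _ (measurableTypeR R) R mu (F i) (mF' i)).
apply: (@ge0_le_integral _ (measurableTypeR R) R mu (F i) (mF' i)) => //.
- by move=> y Fy; rewrite lee_fin; case/andP: (gB i y Fy).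
- exact/rmeasP.
- by move=> y Fy; rewrite lee_fin; case/andP: (gB i y Fy).
Qed.

(** * The fundamental theorem of calculus for absolutely continuous functions *)

Definition primitive (k : R -> R) (y : R) : R := rint `]-oo, y] k.

Section primitive.
Variable k : R -> R.
Hypothesis ik : rinteg setT k.

Lemma primitiveB u v : u <= v -> primitive k v - primitive k u = rint `]u, v] k.
Proof.
move=> uv; apply: Rintegral_itvB; rewrite ?bnd_simp //.
by apply: rinteg_sub ik => //; exact: measurable_itv.
Qed.

(** The increments over disjoint intervals add up to at most the integral of |k|
    over their union, which is small with the measure of the union. *)
Lemma primitive_ac s t : ac_increments s t (fun u v => `|primitive k v - primitive k u|).
Proof.
pose psi u v := rint `]u, v] (fun x => `|k x|).
apply: (@ac_le _ _ _ _ psi) => [u v _ uv _|].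
  rewrite primitiveB //; apply: rint_normr; first exact: measurable_itv.
  by apply: rinteg_sub ik => //; exact: measurable_itv.
move=> e e0; have [d [d0 Hd]] := integral_normr_continuous ik e0.
exists d => // n u v uv dj sm.
pose F (j : 'I_n) := [set` `]u j, v j] ].
have mF j : measurable (F j) by exact: measurable_itv.
have tF : trivIset setT F.
  apply/trivIsetP => i j _ _ ij; apply/seteqP; split => y //=.
  rewrite /F /= !in_itv /= => -[/andP[a1 a2] /andP[a3 a4]].
  by case: (dj i j ij) => h; [have := le_lt_trans (le_trans a2 h) a3|have := le_lt_trans (le_trans a4 h) a1]; rewrite ltxx.
pose D := \big[setU/set0]_(i < n) F i.
have mD : measurable D by exact: bigsetU_measurable.
have muD : (mu D < d%:E)%E.
  have -> : mu D = (\sum_(i < n) mu (F i))%E by exact: measure_bigsetU_ord.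
  apply: le_lt_trans (_ : (_ <= (\sum_(i < n) (v i - u i))%:E)%E) _; last by rewrite lte_fin.
  rewrite -sumEFin; apply: lee_sum => i _.
  rewrite lebesgue_measure_itv /= lte_fin -EFinB; case: ifPn => // _.
  by rewrite lee_fin subr_ge0; case: (uv i).
apply: le_lt_trans (Hd D mD muD).
rewrite [leRHS]/Rintegral ge0_integral_bigsetU //=; last 3 first.
- exact: index_enum_uniq.
- by apply: sub_trivIset tF.
- by apply: measurable_funTS; exact: measurable_int (rinteg_norm ik).
rewrite -sum_fine // => i _.
apply: integrable_fin_num; first exact: mF.
exact: (rinteg_sub (mF i) _ (@subsetT _ _) (rinteg_norm ik)).
Qed.

Lemma primitive_derive : {ae mu, forall y : R, is_derive y 1 (primitive k) (k y)}.
Proof.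
have lk : locally_integrable setT k.
  have := integrable_locally measurableT ik.
  by rewrite (_ : k \_ setT = k) //; apply/funext => y; rewrite patchE in_setT.
have iy y : mu.-integrable `]-oo, y] (EFin \o k).
  by apply: (rinteg_sub _ _ _ ik) => //; exact: measurable_itv.
have := FTC1Ny iy lk.
by apply: aeS => y [dk <-]; rewrite derive1E; exact: DeriveDef.
Qed.

End primitive.

(** The primitive of k is absolutely continuous and, by Lebesgue differentiation,
    has derivative k almost everywhere; its difference with h has derivative zero
    almost everywhere and is constant by [ac_deriv0_cst]. *)
Lemma ftc_ac (s t : R) (h k : R -> R) : s <= t ->
  ac_increments s t (fun u v => `|h v - h u|) ->
  rinteg `]s, t[ k ->
  {ae mu, forall y : R, s < y < t -> is_derive y 1 h (k y)} ->
  h t - h s = rint `]s, t[ k.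
Proof.
move=> st ach ik hk.
pose k' := k \_ `]s, t[.
have ik' : rinteg setT k' by apply: rinteg_patch => //; exact: measurable_itv.
have -> : rint `]s, t[ k = primitive k' t - primitive k' s.
  rewrite primitiveB // rint_patch //.
  by move=> y /=; rewrite !in_itv /= => /andP[-> /ltW ->].
suff : h t - primitive k' t = h s - primitive k' s by move=> H; lra.
apply: (@ac_deriv0_cst s t (fun y => h y - primitive k' y)) => //.
- apply: ac_le (ac_add ach (primitive_ac ik' s t)) => u v _ _ _.
  have -> : h v - primitive k' v - (h u - primitive k' u) = (h v - h u) - (primitive k' v - primitive k' u) by ring.
  exact: ler_normB.
- apply: aeS2 hk (primitive_derive ik') => y H1 H2 sty.
  have -> : 0 = k y - k' y.
    by rewrite /k' patchE ifT ?subrr // inE /= in_itv.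
  by apply: is_deriveB; exact: H1.
Qed.

End ftc_ac.

(** * Complex-valued functions of a real variable *)

Local Notation normc := Normc.normc.

Section modulus.
Variable R : realType.
Local Notation C := R[i].
Implicit Types a b : C.

Lemma cReD a b : complex.Re (a + b) = complex.Re a + complex.Re b.
Proof. by case: a; case: b. Qed.
Lemma cImD a b : complex.Im (a + b) = complex.Im a + complex.Im b.
Proof. by case: a; case: b. Qed.
Lemma cReN a : complex.Re (- a) = - complex.Re a. Proof. by case: a. Qed.
Lemma cImN a : complex.Im (- a) = - complex.Im a. Proof. by case: a. Qed.
Lemma cReM a b : complex.Re (a * b) =
  complex.Re a * complex.Re b - complex.Im a * complex.Im b.
Proof. by case: a; case: b. Qed.
Lemma cImM a b : complex.Im (a * b) =
  complex.Re a * complex.Im b + complex.Im a * complex.Re b.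
Proof. by case: a; case: b. Qed.
Lemma cReC a : complex.Re a^*%C = complex.Re a. Proof. by case: a. Qed.
Lemma cImC a : complex.Im a^*%C = - complex.Im a. Proof. by case: a. Qed.

Lemma complex_ext a b :
  complex.Re a = complex.Re b -> complex.Im a = complex.Im b -> a = b.
Proof. by case: a; case: b => /= ? ? ? ? -> ->. Qed.

Lemma normcE2 a : normc a ^+ 2 = complex.Re a ^+ 2 + complex.Im a ^+ 2.
Proof. by case: a => x y /=; rewrite sqr_sqrtr // addr_ge0 ?sqr_ge0. Qed.

Lemma normc_ge0 a : 0 <= normc a.
Proof. by case: a => x y /=; exact: sqrtr_ge0. Qed.

Lemma normcD a b : normc (a + b) <= normc a + normc b.
Proof. exact: le_normcD. Qed.

Lemma normcNE a : normc (- a) = normc a.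
Proof. exact: normcN. Qed.

Lemma normcME a b : normc (a * b) = normc a * normc b.
Proof. exact: Normc.normcM. Qed.

Lemma normcCE a : normc a^*%C = normc a.
Proof. by case: a => x y /=; rewrite sqrrN. Qed.

Lemma normc0E : normc (0 : C) = 0.
Proof. exact: Normc.normc0. Qed.

Lemma Re_le_normc a : `|complex.Re a| <= normc a.
Proof.
case: a => x y /=; rewrite -sqrtr_sqr; apply: ler_wsqrtr.
by rewrite lerDl sqr_ge0.
Qed.

Lemma Im_le_normc a : `|complex.Im a| <= normc a.
Proof.
case: a => x y /=; rewrite -sqrtr_sqr; apply: ler_wsqrtr.
by rewrite lerDr sqr_ge0.
Qed.

Lemma normc_le_ReIm a : normc a <= `|complex.Re a| + `|complex.Im a|.
Proof.
rewrite -(@ler_pXn2r _ 2) ?nnegrE ?normc_ge0 ?addr_ge0 //.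
rewrite normcE2 sqrrD !real_normK ?num_real //.
have : 0 <= `|complex.Re a| * `|complex.Im a| by rewrite mulr_ge0.
lra.
Qed.

Lemma normc_sum (I : Type) (r : seq I) (F : I -> C) :
  normc (\sum_(i <- r) F i) <= \sum_(i <- r) normc (F i).
Proof.
elim/big_ind2: _ => [|x1 x2 y1 y2 H1 H2|//]; first by rewrite normc0E.
by apply: le_trans (normcD _ _) _; apply: lerD.
Qed.

End modulus.

Section scalar.
Variable R : realType.
Local Notation C := R[i].
Local Notation Re := (@complex.Re R).
Local Notation Im := (@complex.Im R).
Implicit Types f g : R -> C.

(** Absolute continuity and measurability share these closure properties; the
    lemmas on matrix-valued functions are proved once for any such P. *)
Record star_closed (P : (R -> C) -> Prop) : Prop := StarClosed {
  star_cst : forall a : C, P (fun=> a);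
  starD : forall f g, P f -> P g -> P (fun y => f y + g y);
  starM : forall f g, P f -> P g -> P (fun y => f y * g y);
  starC : forall f, P f -> P (fun y => (f y)^*%C) }.

Lemma star_sum P (I : Type) (r : seq I) (F : I -> R -> C) : star_closed P ->
  (forall i, P (F i)) -> P (fun y => \sum_(i <- r) F i y).
Proof.
move=> aP PF; elim: r => [|i r IH].
  by rewrite (_ : (fun y => _) = (fun=> 0)); [exact: star_cst|apply/funext => y; rewrite big_nil].
rewrite (_ : (fun y => _) = (fun y => F i y + \sum_(j <- r) F j y)); first exact: starD.
by apply/funext => y; rewrite big_cons.
Qed.

(** Absolute continuity of a complex-valued function. *)
Definition cac s t f : Prop := ac_increments s t (fun u v => normc (f v - f u)).

Lemma cac_bounded s t f : cac s t f -> exists2 M, 0 <= M &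
  forall y, s <= y -> y <= t -> normc (f y) <= M.
Proof.
move=> H; have [|u v _ _|M HM] := ac_bounded _ _ H.
- by move=> u; rewrite subrr normc0E.
- have -> : f v - f s = (f u - f s) + (f v - f u) by ring.
  exact: normcD.
exists (`|M| + normc (f s)) => [|y sy yt]; first by rewrite addr_ge0 ?normc_ge0.
have -> : f y = (f y - f s) + f s by ring.
by apply: le_trans (normcD _ _) _; rewrite lerD2r (le_trans (HM y sy yt)) ?ler_norm.
Qed.

Lemma star_cac s t : star_closed (cac s t).
Proof.
split.
- by move=> a; apply: ac_le (@ac_zero _ s t) => u v _ _ _; rewrite subrr normc0E.
- move=> f g Hf Hg; apply: ac_le (ac_add Hf Hg) => u v _ _ _.
  by have -> : f v + g v - (f u + g u) = (f v - f u) + (g v - g u) by [ring]; exact: normcD.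
- move=> f g Hf Hg; have [M M0 HM] := cac_bounded Hf; have [N N0 HN] := cac_bounded Hg.
  apply: ac_le (ac_add (ac_scale N0 Hf) (ac_scale M0 Hg)) => u v su uv vt.
  have -> : f v * g v - f u * g u = g v * (f v - f u) + f u * (g v - g u) by ring.
  apply: le_trans (normcD _ _) _; rewrite !normcME.
  apply: lerD; apply: ler_wpM2r; rewrite ?normc_ge0 //; [apply: HN|apply: HM] => //.
    exact: le_trans uv.
  exact: le_trans vt.
- move=> f Hf; apply: ac_le Hf => u v _ _ _.
  by rewrite -rmorphB normcCE.
Qed.

Lemma cac_ReIm s t f :
  ac_increments s t (fun u v => `|Re (f v) - Re (f u)|) ->
  ac_increments s t (fun u v => `|Im (f v) - Im (f u)|) -> cac s t f.
Proof.
move=> H1 H2; apply: ac_le (ac_add H1 H2) => u v _ _ _.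
apply: le_trans (normc_le_ReIm _) _.
by case: (f v); case: (f u).
Qed.

Lemma cac_Re s t f : cac s t f -> ac_increments s t (fun u v => `|Re (f v) - Re (f u)|).
Proof.
by apply: ac_le => u v _ _ _; apply: le_trans (Re_le_normc _); case: (f v); case: (f u).
Qed.

Lemma cac_Im s t f : cac s t f -> ac_increments s t (fun u v => `|Im (f v) - Im (f u)|).
Proof.
by apply: ac_le => u v _ _ _; apply: le_trans (Im_le_normc _); case: (f v); case: (f u).
Qed.

Lemma cac_cat s t w f : s <= t -> t <= w -> cac s t f -> cac t w f -> cac s w f.
Proof.
apply: ac_cat => [u|u v _ _]; first by rewrite subrr normc0E.
by have -> : f v - f u = (f t - f u) + (f v - f t) by [ring]; exact: normcD.
Qed.

Lemma eq_cac s t f g : (forall y, s <= y -> y <= t -> f y = g y) ->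
  cac s t f -> cac s t g.
Proof.
move=> fg; apply: ac_le => u v su uv vt.
by rewrite !fg // ?(le_trans su uv) // (le_trans uv vt).
Qed.

(** The derivative is taken in the real and imaginary parts, which is the form
    in which a derivative almost everywhere is given for elements of W^(1,2). *)
Definition cder f y d : Prop :=
  is_derive y (1 : R) (fun z => Re (f z)) (Re d) /\
  is_derive y (1 : R) (fun z => Im (f z)) (Im d).

Lemma is_derive_ext (f g : R -> R) (y d e : R) : f =1 g -> d = e ->
  is_derive y 1 f d -> is_derive y 1 g e.
Proof. by move=> /funext -> ->. Qed.

Lemma cder_cst y a : cder (fun=> a) y 0.
Proof. by split; exact: is_derive_cst. Qed.

Lemma cderD f g y d e : cder f y d -> cder g y e ->
  cder (fun z => f z + g z) y (d + e).
Proof.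
move=> [H1 H2] [H3 H4]; split.
- by apply: is_derive_ext (is_deriveD H1 H3) => [z|]; rewrite /= cReD.
- by apply: is_derive_ext (is_deriveD H2 H4) => [z|]; rewrite /= cImD.
Qed.

Lemma cderM f g y d e : cder f y d -> cder g y e ->
  cder (fun z => f z * g z) y (d * g y + f y * e).
Proof.
move=> [H1 H2] [H3 H4]; split.
- apply: is_derive_ext (is_deriveB (is_deriveM H1 H3) (is_deriveM H2 H4)) => [z|].
    by rewrite /= cReM.
  by rewrite cReD !cReM /GRing.scale /=; ring.
- apply: is_derive_ext (is_deriveD (is_deriveM H1 H4) (is_deriveM H2 H3)) => [z|].
    by rewrite /= cImM.
  by rewrite cImD !cImM /GRing.scale /=; ring.
Qed.

Lemma cderC f y d : cder f y d -> cder (fun z => (f z)^*%C) y d^*%C.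
Proof.
move=> [H1 H2]; split.
- by apply: is_derive_ext H1 => [z|]; rewrite cReC.
- by apply: is_derive_ext (is_deriveN H2) => [z|]; rewrite /= cImC.
Qed.

Lemma cder_sum (I : Type) (r : seq I) (F : I -> R -> C) y (d : I -> C) :
  (forall i, cder (F i) y (d i)) ->
  cder (fun z => \sum_(i <- r) F i z) y (\sum_(i <- r) d i).
Proof.
move=> H; elim: r => [|i r IH].
  rewrite big_nil (_ : (fun z => _) = (fun=> 0)); first exact: cder_cst.
  by apply/funext => z; rewrite big_nil.
rewrite big_cons (_ : (fun z => _) = (fun z => F i z + \sum_(j <- r) F j z)); first exact: cderD.
by apply/funext => z; rewrite big_cons.
Qed.

Definition ccvg (F : set_system R) f (l : C) : Prop :=
  Re (f y) @[y --> F] --> Re l /\ Im (f y) @[y --> F] --> Im l.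

Section ccvg.
Context {F : set_system R} {FF : ProperFilter F}.

Lemma ccvg_cst a : ccvg F (fun=> a) a.
Proof. by split; exact: cvg_cst. Qed.

Lemma ccvgD f g a b : ccvg F f a -> ccvg F g b -> ccvg F (fun y => f y + g y) (a + b).
Proof.
move=> [H1 H2] [H3 H4]; split; rewrite ?cReD ?cImD.
- by under eq_fun do rewrite cReD; exact: cvgD.
- by under eq_fun do rewrite cImD; exact: cvgD.
Qed.

Lemma ccvgM f g a b : ccvg F f a -> ccvg F g b -> ccvg F (fun y => f y * g y) (a * b).
Proof.
move=> [H1 H2] [H3 H4]; split; rewrite ?cReM ?cImM.
- by under eq_fun do rewrite cReM; apply: cvgB; exact: cvgM.
- by under eq_fun do rewrite cImM; apply: cvgD; exact: cvgM.
Qed.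

Lemma ccvgC f a : ccvg F f a -> ccvg F (fun y => (f y)^*%C) a^*%C.
Proof.
move=> [H1 H2]; split; rewrite ?cReC ?cImC.
- by under eq_fun do rewrite cReC.
- by under eq_fun do rewrite cImC; exact: cvgN.
Qed.

Lemma ccvg_sum (I : Type) (r : seq I) (f : I -> R -> C) (a : I -> C) :
  (forall i, ccvg F (f i) (a i)) ->
  ccvg F (fun y => \sum_(i <- r) f i y) (\sum_(i <- r) a i).
Proof.
move=> H; elim: r => [|i r IH].
  rewrite big_nil (_ : (fun z => _) = (fun=> 0)); first exact: ccvg_cst.
  by apply/funext => z; rewrite big_nil.
rewrite big_cons (_ : (fun z => _) = (fun z => f i z + \sum_(j <- r) f j z)); first exact: ccvgD.
by apply/funext => z; rewrite big_cons.
Qed.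

Lemma ccvg_unique f a b : ccvg F f a -> ccvg F f b -> a = b.
Proof.
move=> [H1 H2] [H3 H4]; apply: complex_ext.
- by apply: cvg_unique H1 H3; exact: Rhausdorff.
- by apply: cvg_unique H2 H4; exact: Rhausdorff.
Qed.

Lemma ccvg_near f g a : (\forall y \near F, f y = g y) -> ccvg F f a -> ccvg F g a.
Proof.
move=> fg [H1 H2]; split.
- apply: cvg_trans H1; apply: near_eq_cvg; apply: filterS fg => y ->; exact: erefl.
- apply: cvg_trans H2; apply: near_eq_cvg; apply: filterS fg => y ->; exact: erefl.
Qed.

End ccvg.

Lemma ccvg_normc (F : set_system R) {FF : Filter F} f a :
  normc (f y - a) @[y --> F] --> (0 : R) -> ccvg F f a.
Proof.
move=> H; split; apply: (cvg_sub0 _ (cvg_cst _)); apply/norm_cvg0P.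
- apply: squeeze_cvgr (cvg_cst 0) H; apply: nearW => y; rewrite normr_ge0 /=.
  by have := Re_le_normc (f y - a); rewrite cReD cReN.
- apply: squeeze_cvgr (cvg_cst 0) H; apply: nearW => y; rewrite normr_ge0 /=.
  by have := Im_le_normc (f y - a); rewrite cImD cImN.
Qed.

End scalar.

(** * Complex-valued integrals and square-integrable functions *)

Section cint.
Variable R : realType.
Local Notation C := R[i].
Local Notation Re := (@complex.Re R).
Local Notation Im := (@complex.Im R).
Local Notation mu := (@lebesgue_measure R).
Implicit Types f g : R -> C.

Definition cmeas (D : set R) f : Prop :=
  rmeas D (fun x => Re (f x)) /\ rmeas D (fun x => Im (f x)).
Definition cinteg (D : set R) f : Prop :=
  rinteg D (fun x => Re (f x)) /\ rinteg D (fun x => Im (f x)).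
Definition cint (D : set R) f : C :=
  Complex (rint D (fun x => Re (f x))) (rint D (fun x => Im (f x))).
Definition cL2 (D : set R) f : Prop :=
  cmeas D f /\ rinteg D (fun x => normc (f x) ^+ 2).

Section domain.
Variable D : set R.
Hypothesis mD : measurable D.

Lemma eq_cmeas f g : (forall x, D x -> f x = g x) -> cmeas D f -> cmeas D g.
Proof.
move=> fg [H1 H2]; split.
- by apply: (eq_measurable_fun _ _ H1) => x /set_mem /fg ->.
- by apply: (eq_measurable_fun _ _ H2) => x /set_mem /fg ->.
Qed.

Lemma star_cmeas : star_closed (cmeas D).
Proof.
split.
- by move=> a; split; exact: measurable_cst.
- move=> f g [H1 H2] [H3 H4]; split; rewrite /rmeas.
  + by under eq_fun do rewrite cReD; exact: measurable_funD.
  + by under eq_fun do rewrite cImD; exact: measurable_funD.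
- move=> f g [H1 H2] [H3 H4]; split; rewrite /rmeas.
  + by under eq_fun do rewrite cReM; apply: measurable_funB; exact: measurable_funM.
  + by under eq_fun do rewrite cImM; apply: measurable_funD; exact: measurable_funM.
- move=> f [H1 H2]; split; rewrite /rmeas.
  + by under eq_fun do rewrite cReC.
  + by under eq_fun do rewrite cImC; exact: measurableT_comp.
Qed.

Lemma cmeas_sqr f : cmeas D f -> rmeas D (fun x => normc (f x) ^+ 2).
Proof.
move=> [H1 H2]; rewrite /rmeas; under eq_fun do rewrite normcE2.
by apply: measurable_funD; exact: measurable_funX.
Qed.

Lemma cinteg_le f (g : R -> R) : cmeas D f -> rinteg D g ->
  (forall x, D x -> normc (f x) <= g x) -> cinteg D f.
Proof.
move=> [H1 H2] ig fg; split.
- by apply: rinteg_le ig => // x Dx; exact: le_trans (Re_le_normc _) (fg x Dx).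
- by apply: rinteg_le ig => // x Dx; exact: le_trans (Im_le_normc _) (fg x Dx).
Qed.

Lemma cinteg_meas f : cinteg D f -> cmeas D f.
Proof. by move=> [/rinteg_meas H1 /rinteg_meas H2]; split; auto. Qed.

Lemma eq_cinteg f g : (forall x, D x -> f x = g x) -> cinteg D f -> cinteg D g.
Proof.
by move=> fg [H1 H2]; split; [apply: eq_rinteg H1|apply: eq_rinteg H2] => // x /fg ->.
Qed.

Lemma eq_cint f g : (forall x, D x -> f x = g x) -> cint D f = cint D g.
Proof. by move=> fg; congr Complex; apply: eq_rint => x /fg ->. Qed.

Lemma cint0 : cint D (fun=> 0) = 0.
Proof.
have H : rint D (fun=> 0) = 0 :> R.
  rewrite -[RHS](mul0r (rint D (fun=> 0))) -(rintZ mD 0 (rinteg0 D)).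
  by apply: eq_rint => x _; rewrite mul0r.
by rewrite /cint /= H.
Qed.

Lemma cintegD f g : cinteg D f -> cinteg D g -> cinteg D (fun x => f x + g x).
Proof.
move=> [H1 H2] [H3 H4]; split.
- by apply: eq_rinteg (rintegD mD H1 H3) => // x _; rewrite cReD.
- by apply: eq_rinteg (rintegD mD H2 H4) => // x _; rewrite cImD.
Qed.

Lemma cintD f g : cinteg D f -> cinteg D g ->
  cint D (fun x => f x + g x) = cint D f + cint D g.
Proof.
move=> [H1 H2] [H3 H4]; rewrite /cint.
rewrite (@eq_rint _ _ _ (fun x => Re (f x) + Re (g x))); last by move=> x _; rewrite cReD.
rewrite (@eq_rint _ _ (fun x => Im (f x + g x)) (fun x => Im (f x) + Im (g x))); last by move=> x _; rewrite cImD.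
by rewrite !rintD.
Qed.

Lemma cintegZ a f : cinteg D f -> cinteg D (fun x => a * f x).
Proof.
move=> [H1 H2]; split.
- apply: eq_rinteg (rintegD mD (rintegZ mD (Re a) H1) (rintegZ mD (- Im a) H2)) => // x _.
  by rewrite cReM mulNr.
- apply: eq_rinteg (rintegD mD (rintegZ mD (Re a) H2) (rintegZ mD (Im a) H1)) => // x _.
  by rewrite cImM.
Qed.

Lemma cintZ a f : cinteg D f -> cint D (fun x => a * f x) = a * cint D f.
Proof.
move=> [H1 H2]; rewrite /cint.
rewrite (@eq_rint _ _ _ (fun x => Re a * Re (f x) + - Im a * Im (f x))); last by move=> x _; rewrite cReM mulNr.
rewrite (@eq_rint _ _ (fun x => Im (a * f x)) (fun x => Re a * Im (f x) + Im a * Re (f x))); last by move=> x _; rewrite cImM.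
rewrite !(rintD mD, rintZ mD); try by [apply: rintegZ|].
by apply: complex_ext; rewrite ?cReM ?cImM /= ?mulNr.
Qed.

Lemma cinteg_sum (I : Type) (r : seq I) (F : I -> R -> C) :
  (forall i, cinteg D (F i)) -> cinteg D (fun x => \sum_(i <- r) F i x).
Proof.
move=> H; elim: r => [|i r IH].
  apply: (@eq_cinteg (fun=> 0)) => [x _|]; first by rewrite big_nil.
  by split; exact: rinteg0.
by apply: eq_cinteg (cintegD (H i) IH) => x _; rewrite big_cons.
Qed.

Lemma cint_sum (I : Type) (r : seq I) (F : I -> R -> C) :
  (forall i, cinteg D (F i)) ->
  cint D (fun x => \sum_(i <- r) F i x) = \sum_(i <- r) cint D (F i).
Proof.
move=> H; elim: r => [|i r IH].
  by rewrite big_nil -[RHS]cint0; apply: eq_cint => x _; rewrite big_nil.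
rewrite big_cons -IH -cintD //; last exact: cinteg_sum.
by apply: eq_cint => x _; rewrite big_cons.
Qed.

Lemma cintC f : cinteg D f -> cint D (fun x => (f x)^*%C) = (cint D f)^*%C.
Proof.
move=> [H1 H2]; apply: complex_ext; rewrite ?cReC ?cImC /=.
  by apply: eq_rint => x _; rewrite cReC.
by rewrite -mulN1r -rintZ //; apply: eq_rint => x _; rewrite cImC mulN1r.
Qed.

Lemma cint_ae f g : cmeas D f -> cmeas D g -> ae_eq lebesgue_measure D f g ->
  cint D f = cint D g.
Proof.
move=> [H1 H2] [H3 H4] fg; congr Complex; apply: rint_ae => //.
  by apply: aeS fg => x /[apply] ->.
by apply: aeS fg => x /[apply] ->.
Qed.

Lemma cL2D f g : cL2 D f -> cL2 D g -> cL2 D (fun x => f x + g x).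
Proof.
move=> [mf If] [mg Ig]; have mfg := starD star_cmeas mf mg; split => //.
apply: rinteg_le (rintegD mD (rintegZ mD 2 If) (rintegZ mD 2 Ig)) => //.
  exact: cmeas_sqr.
move=> x _; rewrite ger0_norm ?sqr_ge0 //.
apply: (@le_trans _ _ ((normc (f x) + normc (g x)) ^+ 2)).
  by rewrite ler_pXn2r ?nnegrE ?addr_ge0 ?normc_ge0 // normcD.
have := sqr_ge0 (normc (f x) - normc (g x)); nra.
Qed.

Lemma cL2_mulb f g (M : R) : cL2 D f -> cmeas D g ->
  (forall x, D x -> normc (g x) <= M) -> cL2 D (fun x => f x * g x).
Proof.
move=> [mf If] mg gM; have mfg := starM star_cmeas mf mg; split => //.
apply: rinteg_le (rintegZ mD (M ^+ 2) If) => //; first exact: cmeas_sqr.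
move=> x Dx; rewrite ger0_norm ?sqr_ge0 // normcME exprMn mulrC.
apply: ler_wpM2r; first exact: sqr_ge0.
have M0 : 0 <= M by apply: le_trans (gM x Dx); exact: normc_ge0.
by rewrite ler_pXn2r ?nnegrE ?normc_ge0 // gM.
Qed.

Lemma eq_cL2 f g : (forall x, D x -> f x = g x) -> cL2 D f -> cL2 D g.
Proof.
move=> fg [mf If]; split; first exact: eq_cmeas mf.
by apply: eq_rinteg If => // x /fg ->.
Qed.

Lemma cL2Z a f : cL2 D f -> cL2 D (fun x => a * f x).
Proof.
move=> Hf; apply: (@eq_cL2 (fun x => f x * a)); first by move=> x _; rewrite mulrC.
exact: cL2_mulb Hf (star_cst star_cmeas a) (fun x _ => lexx _).
Qed.

Lemma cL2_0 : cL2 D (fun=> 0).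
Proof.
split; first exact: (star_cst star_cmeas).
by apply: eq_rinteg (rinteg0 D) => // x _; rewrite normc0E expr0n.
Qed.

Lemma cL2_cst a : (mu D < +oo)%E -> cL2 D (fun=> a).
Proof. by move=> Doo; split; [exact: (star_cst star_cmeas)|exact: rinteg_cst]. Qed.

Lemma cL2_sum (I : Type) (r : seq I) (F : I -> R -> C) :
  (forall i, cL2 D (F i)) -> cL2 D (fun x => \sum_(i <- r) F i x).
Proof.
move=> H; elim: r => [|i r IH].
  by apply: (@eq_cL2 (fun=> 0)) => [x _|]; [rewrite big_nil|exact: cL2_0].
by apply: eq_cL2 (cL2D (H i) IH) => x _; rewrite big_cons.
Qed.

Lemma cL2C f : cL2 D f -> cL2 D (fun x => (f x)^*%C).
Proof.
move=> [mf If]; split; first exact: (starC star_cmeas).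
by apply: eq_rinteg If => // x _; rewrite normcCE.
Qed.

(** |f g| is at most |f|^2 + |g|^2. *)
Lemma cL2_cintegM f g : cL2 D f -> cL2 D g -> cinteg D (fun x => f x * g x).
Proof.
move=> [mf If] [mg Ig]; apply: (@cinteg_le _ (fun x => normc (f x) ^+ 2 + normc (g x) ^+ 2)).
- exact: (starM star_cmeas).
- exact: rintegD.
move=> x _; rewrite normcME.
by have := sqr_ge0 (normc (f x) - normc (g x)); have := sqr_ge0 (normc (f x) + normc (g x)); nra.
Qed.

End domain.

Lemma cmeas_sub (A B : set R) f : measurable A -> measurable B -> A `<=` B ->
  cmeas B f -> cmeas A f.
Proof. by move=> mA mB AB [H1 H2]; split; apply: measurable_funS AB _. Qed.

Lemma cinteg_sub (A B : set R) f : measurable A -> measurable B -> A `<=` B ->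
  cinteg B f -> cinteg A f.
Proof. by move=> mA mB AB [H1 H2]; split; apply: rinteg_sub AB _. Qed.

Lemma cL2_sub (A B : set R) f : measurable A -> measurable B -> A `<=` B ->
  cL2 B f -> cL2 A f.
Proof.
by move=> mA mB AB [H1 H2]; split; [apply: cmeas_sub AB _|apply: rinteg_sub AB _].
Qed.

(** Extension by zero; a function integrable on an interval thereby gets a
    primitive on the whole line. *)
Definition ext0 (A : set R) f : R -> C := fun x => if x \in A then f x else 0.

Lemma cinteg_ext0 (A : set R) f : measurable A -> cinteg A f -> cinteg setT (ext0 A f).
Proof.
move=> mA [H1 H2]; split.
- by apply: eq_rinteg (rinteg_patch mA H1) => // x _; rewrite /ext0 !patchE; case: ifP.
- by apply: eq_rinteg (rinteg_patch mA H2) => // x _; rewrite /ext0 !patchE; case: ifP.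
Qed.

Lemma cint_ext0 (A B : set R) f : A `<=` B -> cint B (ext0 A f) = cint A f.
Proof.
move=> AB; congr Complex; rewrite -(rint_patch _ AB).
  by apply: eq_rint => x _; rewrite /ext0 !patchE; case: ifP.
by apply: eq_rint => x _; rewrite /ext0 !patchE; case: ifP.
Qed.

Definition cprim f y : C := cint `]-oo, y] f.

Section cprim.
Variable f : R -> C.
Hypothesis intf : cinteg setT f.

Lemma cprimB u v : u <= v -> cprim f v - cprim f u = cint `]u, v] f.
Proof.
case: intf => H1 H2 uv.
by apply: complex_ext; rewrite ?cReD ?cImD ?cReN ?cImN /=; exact: primitiveB.
Qed.

Lemma cprim_ac s t : cac s t (cprim f).
Proof. by case: intf => H1 H2; apply: cac_ReIm; exact: primitive_ac. Qed.

Lemma cprim_der : {ae mu, forall y : R, cder (cprim f) y (f y)}.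
Proof.
by case: intf => H1 H2; apply: aeS2 (primitive_derive H1) (primitive_derive H2) => y ? ?; split.
Qed.

End cprim.

Lemma cftc_ac (s t : R) f g : s <= t -> cac s t f -> cinteg `]s, t[ g ->
  {ae mu, forall y : R, s < y < t -> cder f y (g y)} ->
  f t - f s = cint `]s, t[ g.
Proof.
move=> st acf [H1 H2] fg.
apply: complex_ext; rewrite ?cReD ?cImD ?cReN ?cImN /=.
- apply: (ftc_ac (h := fun y => Re (f y))) => //; first exact: cac_Re.
  by apply: aeS fg => y /[apply] -[].
- apply: (ftc_ac (h := fun y => Im (f y))) => //; first exact: cac_Im.
  by apply: aeS fg => y /[apply] -[].
Qed.

Lemma cac_ccvg_in f (s t a : R) : s < a -> a < t -> cac s t f ->
  ccvg (nbhs a) f (f a).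
Proof.
move=> sa at_ acf; apply: ccvg_normc; apply/cvgr0Pnorm_lt => e e0.
have [d d0 Hd] := ac_single acf e0.
have m0 : 0 < Num.min d (Num.min (a - s) (t - a)) by rewrite !lt_min d0 !subr_gt0 sa.
apply/nbhs_ballP; exists (Num.min d (Num.min (a - s) (t - a))) => //= y; rewrite /ball /= !lt_min.
move=> /and3P[yd ys yt]; rewrite ger0_norm ?normc_ge0 //.
have [ya|ay] := leP y a.
  rewrite -normcNE opprB; rewrite ger0_norm ?subr_ge0 // in yd ys yt.
  by apply: Hd => //; lra.
by rewrite ler0_norm ?subr_le0 ?ltW // opprB in yd ys yt; apply: Hd => //; lra.
Qed.

Lemma cac_ccvg f (a : R) : (forall s t, cac s t f) -> ccvg (nbhs a) f (f a).
Proof. by move=> acf; apply: (@cac_ccvg_in f (a - 1) (a + 1)) => //; lra. Qed.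

Lemma cac_cmeas (D : set R) f : measurable D -> (forall s t, cac s t f) -> cmeas D f.
Proof.
move=> mD acf; split; apply: measurable_funTS; apply: continuous_measurable_fun => y.
  by case: (cac_ccvg y acf).
by case: (cac_ccvg y acf).
Qed.

(** On an open interval, local absolute continuity and an integrable derivative
    identify f with a globally defined primitive; in particular f has limits at
    both end points. *)
Lemma ac_eq_cprim s t f k : (forall u v, s < u -> u <= v -> v < t -> cac u v f) ->
  cinteg setT k -> {ae mu, forall y : R, s < y < t -> cder f y (k y)} ->
  exists a : C, forall y, s < y < t -> f y = a + cprim k y.
Proof.
move=> acf ik fk.
have step u v : s < u -> u <= v -> v < t -> f v - f u = cprim k v - cprim k u.
  move=> su uv vt; rewrite (@cftc_ac u v f k) //; [|exact: acf|apply: cinteg_sub ik => //; exact: measurable_itv|].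
  - rewrite (@cftc_ac u v (cprim k) k) //; first exact: cprim_ac.
      by apply: cinteg_sub ik => //; exact: measurable_itv.
    by apply: aeS (cprim_der ik).
  - by apply: aeS fk => y H /andP[uy yv]; apply: H; lra.
exists (f ((s + t) / 2) - cprim k ((s + t) / 2)) => y /andP[sy yt].
have [ym|my] := leP y ((s + t) / 2).
  have := @step y ((s + t) / 2) sy ym; rewrite ltr_pdivrMr // => /(_ _) H.
  have {}H := H ltac:(lra).
  by move/eqP: H; rewrite subr_eq => /eqP ->; ring.
have := @step ((s + t) / 2) y; rewrite ltr_pdivlMr // => /(_ _ _ _) H.
have {}H := H ltac:(lra) (ltW my) yt.
by move/eqP: H; rewrite subr_eq => /eqP ->; ring.
Qed.

End cint.

(** * Matrix-valued functions and the euclidean norm *)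

Section matrices.
Variable R : realType.
Local Notation C := R[i].

Definition ctr m n (A : 'M[C]_(m, n)) : 'M[C]_(n, m) := map_mx conjc A^T.

Lemma ctrM m n k (A : 'M[C]_(m, n)) (B : 'M[C]_(n, k)) : ctr (A *m B) = ctr B *m ctr A.
Proof. by rewrite /ctr trmx_mul map_mxM. Qed.

Lemma ctrK m n (A : 'M[C]_(m, n)) : ctr (ctr A) = A.
Proof. by apply/matrixP => i j; rewrite !mxE conjcK. Qed.

Lemma ctrD m n (A B : 'M[C]_(m, n)) : ctr (A + B) = ctr A + ctr B.
Proof. by rewrite /ctr linearD map_mxD. Qed.

Lemma ctrZ m n a (A : 'M[C]_(m, n)) : ctr (a *: A) = conjc a *: ctr A.
Proof. by rewrite /ctr linearZ map_mxZ. Qed.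

Lemma ctr1 m : ctr (1%:M : 'M[C]_m) = 1%:M.
Proof. by rewrite /ctr trmx1 map_mx1. Qed.

Lemma ctr0 m n : ctr (0 : 'M[C]_(m, n)) = 0.
Proof. by rewrite /ctr trmx0 map_mx0. Qed.

Lemma ctr_block m1 m2 n1 n2 (A : 'M[C]_(m1, n1)) (B : 'M[C]_(m1, n2)) A' B' :
  ctr (block_mx A B A' B' : 'M[C]_(m1 + m2, n1 + n2)) =
  block_mx (ctr A) (ctr A') (ctr B) (ctr B').
Proof. by rewrite /ctr tr_block_mx map_block_mx. Qed.

Definition entrywise (P : (R -> C) -> Prop) m n (M : R -> 'M[C]_(m, n)) : Prop :=
  forall i j, P (fun y => M y i j).

Section closure.
Variable P : (R -> C) -> Prop.
Hypothesis aP : star_closed P.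

Lemma entrywise_cst m n (A : 'M[C]_(m, n)) : entrywise P (fun=> A).
Proof. by move=> i j; exact: star_cst. Qed.

Lemma entrywise_add m n (A B : R -> 'M[C]_(m, n)) : entrywise P A -> entrywise P B ->
  entrywise P (fun y => A y + B y).
Proof. by move=> H1 H2 i j; under eq_fun do rewrite mxE; exact: starD. Qed.

Lemma entrywise_mul m n k (A : R -> 'M[C]_(m, n)) (B : R -> 'M[C]_(n, k)) :
  entrywise P A -> entrywise P B -> entrywise P (fun y => A y *m B y).
Proof.
move=> H1 H2 i j; under eq_fun do rewrite mxE.
by apply: star_sum => // l; exact: starM.
Qed.

Lemma entrywise_scale m n (a : R -> C) (B : R -> 'M[C]_(m, n)) :
  P a -> entrywise P B -> entrywise P (fun y => a y *: B y).
Proof. by move=> H1 H2 i j; under eq_fun do rewrite mxE; exact: starM. Qed.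

Lemma entrywise_ctr m n (A : R -> 'M[C]_(m, n)) :
  entrywise P A -> entrywise P (fun y => ctr (A y)).
Proof. by move=> H1 i j; under eq_fun do rewrite !mxE; exact: starC. Qed.

End closure.

Definition mder m n (A : R -> 'M[C]_(m, n)) (y : R) (D : 'M[C]_(m, n)) : Prop :=
  forall i j, cder (fun z => A z i j) y (D i j).

Lemma mder_cst m n (A : 'M[C]_(m, n)) y : mder (fun=> A) y 0.
Proof. by move=> i j; rewrite mxE; exact: cder_cst. Qed.

Lemma mderD m n (A B : R -> 'M[C]_(m, n)) y D E : mder A y D -> mder B y E ->
  mder (fun z => A z + B z) y (D + E).
Proof.
by move=> H1 H2 i j; under [X in cder X]eq_fun do rewrite mxE; rewrite mxE; exact: cderD.
Qed.

Lemma mderM m n k (A : R -> 'M[C]_(m, n)) (B : R -> 'M[C]_(n, k)) y D E :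
  mder A y D -> mder B y E -> mder (fun z => A z *m B z) y (D *m B y + A y *m E).
Proof.
move=> H1 H2 i j; under [X in cder X]eq_fun do rewrite mxE.
by rewrite !mxE -big_split /=; apply: cder_sum => l; exact: cderM.
Qed.

Lemma mder_scale m n (a : R -> C) (B : R -> 'M[C]_(m, n)) y d E :
  cder a y d -> mder B y E -> mder (fun z => a z *: B z) y (d *: B y + a y *: E).
Proof.
by move=> H1 H2 i j; under [X in cder X]eq_fun do rewrite mxE; rewrite !mxE; exact: cderM.
Qed.

Lemma mder_ctr m n (A : R -> 'M[C]_(m, n)) y D : mder A y D ->
  mder (fun z => ctr (A z)) y (ctr D).
Proof.
by move=> H i j; under [X in cder X]eq_fun do rewrite !mxE; rewrite !mxE; exact: cderC.
Qed.

Definition mcvg (F : set_system R) m n (A : R -> 'M[C]_(m, n))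
    (L : 'M[C]_(m, n)) : Prop :=
  forall i j, ccvg F (fun z => A z i j) (L i j).

Section mcvg.
Context {F : set_system R} {FF : ProperFilter F}.

Lemma mcvg_cst m n (A : 'M[C]_(m, n)) : mcvg F (fun=> A) A.
Proof. by move=> i j; exact: ccvg_cst. Qed.

Lemma mcvgM m n k (A : R -> 'M[C]_(m, n)) (B : R -> 'M[C]_(n, k)) D E :
  mcvg F A D -> mcvg F B E -> mcvg F (fun z => A z *m B z) (D *m E).
Proof.
move=> H1 H2 i j; under [X in ccvg _ X]eq_fun do rewrite mxE.
by rewrite !mxE; apply: ccvg_sum => l; exact: ccvgM.
Qed.

Lemma mcvg_ctr m n (A : R -> 'M[C]_(m, n)) D : mcvg F A D ->
  mcvg F (fun z => ctr (A z)) (ctr D).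
Proof.
by move=> H i j; under [X in ccvg _ X]eq_fun do rewrite !mxE; rewrite !mxE; exact: ccvgC.
Qed.

Lemma mcvg_unique m n (A : R -> 'M[C]_(m, n)) D E : mcvg F A D -> mcvg F A E -> D = E.
Proof. by move=> H1 H2; apply/matrixP => i j; exact: ccvg_unique (H1 i j) (H2 i j). Qed.

Lemma mcvg_near m n (A B : R -> 'M[C]_(m, n)) D :
  (\forall y \near F, A y = B y) -> mcvg F A D -> mcvg F B D.
Proof. by move=> AB H i j; apply: ccvg_near (H i j); apply: filterS AB => y ->. Qed.

Lemma mcvg_usub m1 m2 n (A : R -> 'M[C]_(m1 + m2, n)) D :
  mcvg F A D -> mcvg F (fun z => usubmx (A z)) (usubmx D).
Proof. by move=> H i j; under [X in ccvg _ X]eq_fun do rewrite mxE; rewrite mxE. Qed.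

Lemma mcvg_dsub m1 m2 n (A : R -> 'M[C]_(m1 + m2, n)) D :
  mcvg F A D -> mcvg F (fun z => dsubmx (A z)) (dsubmx D).
Proof. by move=> H i j; under [X in ccvg _ X]eq_fun do rewrite mxE; rewrite mxE. Qed.

End mcvg.

Lemma mcvg_nbhs m n (A : R -> 'M[C]_(m, n)) (a : R) :
  (forall s t, entrywise (cac s t) A) -> mcvg (nbhs a) A (A a).
Proof. by move=> H i j; apply: cac_ccvg => s t; exact: H. Qed.

Lemma mcvg_within (P : set R) m n (A : R -> 'M[C]_(m, n)) (a : R) D :
  mcvg (nbhs a) A D -> mcvg (within P (nbhs a)) A D.
Proof. by move=> H i j; case: (H i j) => H1 H2; split; exact: cvg_within_filter. Qed.

Section enorm.
Variable m : nat.
Implicit Types u v : 'cV[C]_m.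

Lemma enorm_sqr v : enorm v ^+ 2 = \sum_k normc (v k 0) ^+ 2.
Proof.
rewrite /enorm sqr_sqrtr; last by apply: sumr_ge0 => k _; rewrite addr_ge0 ?sqr_ge0.
by apply: eq_bigr => k _; rewrite normcE2.
Qed.

Lemma enorm_ge0 v : 0 <= enorm v. Proof. exact: sqrtr_ge0. Qed.

Lemma enorm_le_sqr v (M : R) : 0 <= M -> (enorm v <= M) = (enorm v ^+ 2 <= M ^+ 2).
Proof. by move=> M0; rewrite ler_pXn2r ?nnegrE ?enorm_ge0. Qed.

Lemma normc_le_enorm v k : normc (v k 0) <= enorm v.
Proof.
rewrite -(@ler_pXn2r _ 2) ?nnegrE ?normc_ge0 ?enorm_ge0 // enorm_sqr (bigD1 k) //=.
by rewrite lerDl sumr_ge0 // => j _; exact: sqr_ge0.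
Qed.

Lemma enormZ a v : enorm (a *: v) = normc a * enorm v.
Proof.
apply/eqP; rewrite -(@eqrXn2 _ 2) ?enorm_ge0 ?mulr_ge0 ?normc_ge0 ?enorm_ge0 //.
rewrite exprMn !enorm_sqr mulr_sumr; apply/eqP/eq_bigr => k _.
by rewrite mxE normcME exprMn.
Qed.

Lemma enorm0 : enorm (0 : 'cV[C]_m) = 0.
Proof. by rewrite -(scale0r 0) enormZ normc0E mul0r. Qed.

Lemma enorm_eq0 v : enorm v = 0 -> v = 0.
Proof.
move=> v0; apply/matrixP => k j; rewrite ord1 mxE; apply: Normc.eq0_normc.
by apply/eqP; rewrite eq_le normc_ge0 -v0 normc_le_enorm.
Qed.

(** The arithmetic-geometric mean inequality with a weight t that depends on u
    and v replaces the Cauchy-Schwarz inequality. *)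
Lemma enormD u v : enorm (u + v) <= enorm u + enorm v.
Proof.
have [u0|u0] := eqVneq (enorm u) 0; first by rewrite (enorm_eq0 u0) !add0r lerDr enorm_ge0.
have [v0|v0] := eqVneq (enorm v) 0; first by rewrite (enorm_eq0 v0) !addr0 lerDl enorm_ge0.
have {}u0 : 0 < enorm u by rewrite lt_def u0 enorm_ge0.
have {}v0 : 0 < enorm v by rewrite lt_def v0 enorm_ge0.
rewrite enorm_le_sqr; last by rewrite addr_ge0 ?enorm_ge0.
(* The minimizer of t |u|^2 + |v|^2 / t. *)
pose t := enorm v / enorm u.
have t0 : 0 < t by rewrite divr_gt0.
have -> : (enorm u + enorm v) ^+ 2 = (1 + t) * enorm u ^+ 2 + (1 + t^-1) * enorm v ^+ 2.
  by rewrite /t; field; rewrite !gt_eqF.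
rewrite !enorm_sqr !mulr_sumr -big_split /=; apply: ler_sum => k _; rewrite mxE.
apply: (@le_trans _ _ ((normc (u k 0) + normc (v k 0)) ^+ 2)).
  by rewrite ler_pXn2r ?nnegrE ?addr_ge0 ?normc_ge0 // normcD.
set a := normc _; set b := normc _.
suff : 2 * a * b <= t * a ^+ 2 + t^-1 * b ^+ 2 by nra.
rewrite -subr_ge0.
have -> : t * a ^+ 2 + t^-1 * b ^+ 2 - 2 * a * b = t^-1 * (t * a - b) ^+ 2.
  by field; rewrite gt_eqF.
by rewrite mulr_ge0 ?sqr_ge0 // invr_ge0 ltW.
Qed.

Lemma enorm_sum (I : Type) (r : seq I) (F : I -> 'cV[C]_m) :
  enorm (\sum_(i <- r) F i) <= \sum_(i <- r) enorm (F i).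
Proof.
elim/big_ind2: _ => [|x1 x2 y1 y2 H1 H2|//]; first by rewrite enorm0.
by apply: le_trans (enormD _ _) _; apply: lerD.
Qed.

Lemma enormE v : (enorm v ^+ 2)%:C%C = (ctr v *m v) 0 0.
Proof.
rewrite enorm_sqr mxE rmorph_sum /=; apply: eq_bigr => k _; rewrite !mxE.
by case: (v k 0) => a b; apply: complex_ext; rewrite /= ?sqr_sqrtr ?addr_ge0 ?sqr_ge0 //; ring.
Qed.

Lemma enorm_isometry (S : 'M[C]_m) v : ctr S *m S = 1%:M -> enorm (S *m v) = enorm v.
Proof.
move=> SS; apply/eqP; rewrite -(@eqrXn2 _ 2) ?enorm_ge0 //; apply/eqP.
apply: complexI; rewrite !enormE ctrM -mulmxA [ctr S *m _]mulmxA SS.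
by rewrite mul1mx.
Qed.

Lemma enorm_le_sum v : enorm v <= \sum_k normc (v k 0).
Proof.
rewrite [v in leLHS](_ : v = \sum_k v k 0 *: (\col_i (i == k)%:R)); last first.
  apply/matrixP => i j; rewrite ord1 summxE (bigD1 i) //= big1 => [|k ki].
    by rewrite !mxE eqxx mulr1 addr0.
  by rewrite !mxE eq_sym (negbTE ki) mulr0.
apply: le_trans (enorm_sum _ _) _; apply: ler_sum => k _; rewrite enormZ.
rewrite -[leRHS]mulr1; apply: ler_wpM2l; first exact: normc_ge0.
rewrite enorm_le_sqr // enorm_sqr (bigD1 k) //= big1 => [|j jk]; rewrite mxE.
  by rewrite eqxx Normc.normc1 addr0.
by rewrite (negbTE jk) normc0E expr0n.
Qed.

(** Makes the set whose supremum is the operator norm bounded. *)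
Lemma enorm_mul_bounded (A : 'M[C]_m) v : enorm v <= 1 ->
  enorm (A *m v) <= \sum_i \sum_j normc (A i j).
Proof.
move=> v1; apply: le_trans (enorm_le_sum _) _; apply: ler_sum => i _; rewrite mxE.
apply: le_trans (normc_sum _ _) _; apply: ler_sum => j _; rewrite normcME.
by rewrite ler_piMr ?normc_ge0 // (le_trans (normc_le_enorm _ _) v1).
Qed.

Lemma opnorm_ge0 (A : 'M[C]_m) : 0 <= opnorm A.
Proof.
apply: (@le_trans _ _ (enorm (A *m 0))); first exact: enorm_ge0.
apply: ub_le_sup; last by exists 0 => //=; rewrite enorm0 ler01.
by exists (\sum_i \sum_j normc (A i j)) => _ [v /= v1 <-]; exact: enorm_mul_bounded.
Qed.

Lemma enorm_opnorm (A : 'M[C]_m) v : enorm (A *m v) <= opnorm A * enorm v.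
Proof.
have [v0|v0] := eqVneq (enorm v) 0; first by rewrite (enorm_eq0 v0) mulmx0 enorm0 mulr0.
have {}v0 : 0 < enorm v by rewrite lt_def v0 enorm_ge0.
have nr (r : R) : 0 <= r -> normc r%:C%C = r.
  by move=> r0; rewrite /= expr0n addr0 sqrtr_sqr ger0_norm.
rewrite -ler_pdivrMr //.
have -> : enorm (A *m v) / enorm v = enorm (A *m ((enorm v)^-1%:C%C *: v)).
  by rewrite -scalemxAr enormZ nr ?invr_ge0 ?enorm_ge0 // mulrC.
apply: ub_le_sup; last first.
  by exists ((enorm v)^-1%:C%C *: v) => //=; rewrite enormZ nr ?invr_ge0 ?enorm_ge0 // mulVf ?gt_eqF.
by exists (\sum_i \sum_j normc (A i j)) => _ [w /= w1 <-]; exact: enorm_mul_bounded.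
Qed.

End enorm.

Section square_integrable.
Variable D : set R.
Hypothesis mD : measurable D.

Lemma mcL2_mul m n k (A : 'M[C]_(m, n)) (B : R -> 'M[C]_(n, k)) :
  entrywise (cL2 D) B -> entrywise (cL2 D) (fun y => A *m B y).
Proof.
move=> H i j; under eq_fun do rewrite mxE.
by apply: cL2_sum => // l; apply: cL2Z => //; exact: H.
Qed.

Lemma mcL2_mulr m n k (A : R -> 'M[C]_(m, n)) (B : 'M[C]_(n, k)) :
  entrywise (cL2 D) A -> entrywise (cL2 D) (fun y => A y *m B).
Proof.
move=> H i j; under eq_fun do rewrite mxE.
apply: cL2_sum => // l; under eq_fun do rewrite mulrC.
by apply: cL2Z => //; exact: H.
Qed.

Lemma mcL2Z m n a (A : R -> 'M[C]_(m, n)) :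
  entrywise (cL2 D) A -> entrywise (cL2 D) (fun y => a *: A y).
Proof. by move=> H i j; under eq_fun do rewrite mxE; apply: cL2Z => //; exact: H. Qed.

Lemma mcL2D m n (A B : R -> 'M[C]_(m, n)) :
  entrywise (cL2 D) A -> entrywise (cL2 D) B -> entrywise (cL2 D) (fun y => A y + B y).
Proof.
by move=> H1 H2 i j; under eq_fun do rewrite mxE; exact: (cL2D mD (H1 i j) (H2 i j)).
Qed.

Lemma cinteg_pair m n k (A : R -> 'M[C]_(n, m)) (B : R -> 'M[C]_(n, k)) :
  entrywise (cL2 D) A -> entrywise (cL2 D) B ->
  entrywise (cinteg D) (fun y => ctr (A y) *m B y).
Proof.
move=> H1 H2 i j; under eq_fun do rewrite mxE.
apply: cinteg_sum => // l; under eq_fun do rewrite !mxE.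
by apply: cL2_cintegM => //; apply: cL2C => //; exact: H1.
Qed.

End square_integrable.

Section translation.
Variable m : nat.
Implicit Types f g : R -> 'cV[C]_m.

Lemma abs_contP s t f : abs_cont s t f <-> entrywise (cac s t) f.
Proof.
split=> [H i j|H].
  rewrite ord1; apply: (ac_le _ (H : ac_increments s t (fun u v => enorm (f v - f u)))) => u v _ _ _.
  by have := normc_le_enorm (f v - f u) i; rewrite !mxE.
have H' i : ac_increments s t (fun u v => normc (f v i 0 - f u i 0)) := H i 0.
change (ac_increments s t (fun u v => enorm (f v - f u))).
apply: (ac_le _ (ac_sum (index_enum _) H')) => u v _ _ _.
by apply: le_trans (enorm_le_sum _) _; apply: ler_sum => k _; rewrite !mxE.
Qed.

Lemma vcvgP (F : set_system R) {FF : ProperFilter F} f v : vcvg F f v <-> mcvg F f v.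
Proof.
split=> [H i j|H].
  rewrite ord1; apply: ccvg_normc; apply: squeeze_cvgr (cvg_cst 0) H.
  apply: nearW => y; apply/andP; split; first exact: normc_ge0.
  by have := normc_le_enorm (f y - v) i; rewrite !mxE.
pose S := fun y => \sum_k (`|complex.Re (f y k 0) - complex.Re (v k 0)| + `|complex.Im (f y k 0) - complex.Im (v k 0)|).
have S0 : S y @[y --> F] --> (0 : R).
  rewrite (_ : 0 = \sum_(k < m) (0 + 0 : R)); last by rewrite big1 // => k _; rewrite addr0.
  apply: cvg_big => [|k _]; first exact: add_continuous.
  case: (H k 0) => H1 H2.
  apply: cvgD; rewrite -(@normr0 _ R); apply: cvg_norm.
    by rewrite -(subrr (complex.Re (v k 0))); apply: cvgB => //; exact: cvg_cst.
  by rewrite -(subrr (complex.Im (v k 0))); apply: cvgB => //; exact: cvg_cst.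
apply: squeeze_cvgr (cvg_cst 0) S0; apply: nearW => y; rewrite enorm_ge0 /=.
apply: le_trans (enorm_le_sum _) _; apply: ler_sum => k _; rewrite !mxE.
by apply: le_trans (normc_le_ReIm _) _; rewrite cReD cImD cReN cImN.
Qed.

Lemma L2P (D : set R) f : measurable D -> L2 D f <-> forall k, cL2 D (fun y => f y k 0).
Proof.
move=> mD; split=> [[mf If] k|H].
  split; first exact: (mf k).
  apply: (rinteg_le mD _ _ If); first exact: (cmeas_sqr (mf k)).
  move=> x _; rewrite ger0_norm ?sqr_ge0 // ler_pXn2r ?nnegrE ?normc_ge0 ?enorm_ge0 //.
  exact: normc_le_enorm.
split; first by move=> k; case: (H k).
apply: (eq_rinteg (f := fun x => \sum_k normc (f x k 0) ^+ 2)) => //.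
  by move=> x _; rewrite enorm_sqr.
elim: (index_enum _) => [|k r IH].
  by apply: eq_rinteg (rinteg0 D) => // x _; rewrite big_nil.
by case: (H k) => _ Hk; apply: eq_rinteg (rintegD mD Hk IH) => // x _; rewrite big_cons.
Qed.

Lemma L2_entrywise (D : set R) f : measurable D -> L2 D f <-> entrywise (cL2 D) f.
Proof.
by move=> mD; split=> [/(L2P _ mD) H i j|H]; [rewrite ord1|apply/(L2P _ mD)].
Qed.

Lemma L2innerE (D : set R) f g :
  L2inner D f g = cint D (fun x => (ctr (g x) *m f x) 0 0).
Proof.
transitivity (cint D (fun x => \sum_k f x k 0 * (g x k 0)^*%C)) => //.
by apply: eq_cint => x _; rewrite mxE; apply: eq_bigr => k _; rewrite !mxE mulrC.
Qed.

End translation.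

End matrices.

(** * Hyperbolic functions *)

Section exponentials.
Variable R : realType.
Local Notation C := R[i].

Lemma ac_lipschitz s t (L : R) (phi : R -> R -> R) : 0 <= L ->
  (forall u v, s <= u -> u <= v -> v <= t -> phi u v <= L * (v - u)) ->
  ac_increments s t phi.
Proof.
move=> L0 H; apply: ac_le H _; apply: ac_scale => //.
by move=> e e0; exists e.
Qed.

Lemma cac_real s t (f : R -> R) : ac_increments s t (fun u v => `|f v - f u|) ->
  cac s t (fun y => (f y)%:C%C).
Proof.
move=> H; apply: cac_ReIm => //=.
by apply: ac_le (@ac_zero _ s t) => u v _ _ _; rewrite subrr normr0.
Qed.

Lemma cder_real (f : R -> R) (y d : R) : is_derive y 1 f d ->
  cder (fun z => (f z)%:C%C) y d%:C%C.
Proof. by move=> H; split=> //=; exact: is_derive_cst. Qed.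

Lemma expR_lip (u v : R) : u <= v -> `|expR v - expR u| <= expR v * (v - u).
Proof.
move=> uv; rewrite ger0_norm ?subr_ge0 ?ler_expR //.
have := expR_ge1Dx (u - v); have := expR_gt0 v; rewrite expRD => v0.
move=> H; have : expR v * (1 + (u - v)) <= expR v * (expR u * expR (- v)).
  by rewrite ler_pM2l.
by rewrite mulrCA -expRD subrr expR0 mulr1; lra.
Qed.

Lemma ac_exp (k a s t : R) : ac_increments s t
  (fun u v => `|expR (k * (v - a)) - expR (k * (u - a))|).
Proof.
pose M := expR (`|k| * (`|s - a| + `|t - a|)).
apply: (@ac_lipschitz _ _ (M * `|k|)) => [|u v su uv vt].
  by rewrite mulr_ge0 ?expR_ge0.
have bd w : s <= w -> w <= t -> expR (k * (w - a)) <= M.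
  move=> sw wt; rewrite ler_expR; apply: le_trans (ler_norm _) _; rewrite normrM.
  apply: ler_wpM2l => //; have [wa|aw] := leP 0 (w - a).
    by rewrite [leLHS]ger0_norm //; have := ler_norm (t - a); have := normr_ge0 (s - a); lra.
  by rewrite [leLHS]ltr0_norm //; have := ler_normr (s - a) (- (s - a)); have := normr_ge0 (t - a); have := ler_norm (- (s - a)); rewrite normrN; lra.
have kk : `|k| * (v - u) = `|k * (v - a) - k * (u - a)|.
  by rewrite -mulrBr normrM; congr (_ * _); rewrite opprB addrA subrK ger0_norm // subr_ge0.
rewrite -mulrA kk; have [H|H] := leP (k * (u - a)) (k * (v - a)).
  apply: le_trans (expR_lip H) _; rewrite [X in _ <= _ * X]ger0_norm ?subr_ge0 //.
  by apply: ler_wpM2r; rewrite ?subr_ge0 // bd // (le_trans su).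
rewrite distrC; apply: le_trans (expR_lip (ltW H)) _.
rewrite distrC [X in _ <= _ * X]ger0_norm ?subr_ge0 ?(ltW H) //.
by apply: ler_wpM2r; rewrite ?subr_ge0 ?(ltW H) // bd // (le_trans uv).
Qed.

Lemma derive_exp (k a y : R) :
  is_derive y 1 (fun z => expR (k * (z - a))) (k * expR (k * (y - a))).
Proof.
have H : is_derive y 1 (fun z : R => k * (z - a)) k.
  apply: is_derive_ext (is_deriveZ k (is_deriveB (is_derive_id y (1 : R)) (is_derive_cst a y (1:R)))) => [z|] //=.
  by rewrite subr0 /GRing.scale /= mulr1.
have H2 := @is_derive1_comp _ expR (fun z => k * (z - a)) y _ _ (is_derive_expR _) H.
by apply: is_derive_ext H2 => [z|] //=; rewrite mulrC.
Qed.

Definition coshk (k t : R) : R := (expR (k * t) + expR (- k * t)) / 2.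
Definition sinhk (k t : R) : R := (expR (k * t) - expR (- k * t)) / 2.

Lemma coshk0 k : coshk k 0 = 1. Proof. by rewrite /coshk !mulr0 expR0; field. Qed.
Lemma sinhk0 k : sinhk k 0 = 0. Proof. by rewrite /sinhk !mulr0 subrr mul0r. Qed.

Lemma coshk_gt0 k t : 0 < coshk k t.
Proof. by rewrite /coshk divr_gt0 // addr_gt0 ?expR_gt0. Qed.

Lemma sinhk_ge0 k t : 0 <= k -> 0 <= t -> 0 <= sinhk k t.
Proof.
move=> k0 t0; rewrite /sinhk divr_ge0 // subr_ge0 ler_expR.
by rewrite mulNr; have := mulr_ge0 k0 t0; lra.
Qed.

Lemma coshk_add_sinhk k t : coshk k t + sinhk k t = expR (k * t).
Proof. by rewrite /coshk /sinhk; field. Qed.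

Lemma coshk2_sub_sinhk2 k t : coshk k t ^+ 2 - sinhk k t ^+ 2 = 1.
Proof.
have -> : coshk k t ^+ 2 - sinhk k t ^+ 2 = expR (k * t) * expR (- k * t).
  by rewrite /coshk /sinhk; field.
by rewrite -expRD mulNr subrr expR0.
Qed.

Lemma dist_half_add (A A' B B' : R) :
  `|(A + A') / 2 - (B + B') / 2| <= `|A - B| + `|A' - B'|.
Proof.
have -> : (A + A') / 2 - (B + B') / 2 = ((A - B) + (A' - B')) / 2 by field.
rewrite normrM [X in _ * X]ger0_norm ?invr_ge0 // ler_pdivrMr //.
apply: le_trans (ler_normD _ _) _.
by rewrite ler_peMr ?addr_ge0 // ler1n.
Qed.

Lemma cac_coshk k a s t : cac s t (fun y => (coshk k (y - a))%:C%C).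
Proof.
apply: cac_real; apply: ac_le (ac_add (ac_exp k a s t) (ac_exp (- k) a s t)) => u v _ _ _.
exact: dist_half_add.
Qed.

Lemma cac_sinhk k a s t : cac s t (fun y => (sinhk k (y - a))%:C%C).
Proof.
apply: cac_real; apply: ac_le (ac_add (ac_exp k a s t) (ac_exp (- k) a s t)) => u v _ _ _.
apply: le_trans (dist_half_add _ _ _ _) _.
by rewrite lerD2l -opprD normrN.
Qed.

Lemma cder_coshk k a y :
  cder (fun z => (coshk k (z - a))%:C%C) y (k * sinhk k (y - a))%:C%C.
Proof.
apply: cder_real.
apply: is_derive_ext (is_deriveZ 2^-1 (is_deriveD (derive_exp k a y) (derive_exp (- k) a y))) => [z|] /=.
  by rewrite /coshk /GRing.scale /= mulrC.
by rewrite /sinhk /GRing.scale /=; field.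
Qed.

Lemma cder_sinhk k a y :
  cder (fun z => (sinhk k (z - a))%:C%C) y (k * coshk k (y - a))%:C%C.
Proof.
apply: cder_real.
apply: is_derive_ext (is_deriveZ 2^-1 (is_deriveB (derive_exp k a y) (derive_exp (- k) a y))) => [z|] /=.
  by rewrite /sinhk /GRing.scale /= mulrC.
by rewrite /coshk /GRing.scale /=; field.
Qed.

End exponentials.

(** * The Dirac system with constant coefficients *)

Section dirac_matrices.
Variables (R : realType) (p : nat).
Local Notation C := R[i].
Local Notation M2 := 'M[C]_(p + p).
Variable c : R.
Hypothesis c0 : 0 < c.
Local Notation cC := (c%:C%C : C).
Let cC0 : cC != 0. Proof. by rewrite fmorph_eq0 gt_eqF. Qed.

Definition swap_mx : M2 := block_mx 0 1%:M 1%:M 0.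
Definition mass : C := cC ^+ 2 / 2.
Definition kappa : R := Num.sqrt (1 + (c ^+ 2 / 2) ^+ 2) / c.
(** D f = z f is equivalent to f' = dirac_gen z f. *)
Definition dirac_gen (z : C) : M2 :=
  ('i%C / cC) *: block_mx 0 (z + mass)%:M (z - mass)%:M 0.

Lemma kappa_gt0 : 0 < kappa.
Proof. by rewrite divr_gt0 // sqrtr_gt0 addr_gt0 // exprn_gt0 // divr_gt0 // exprn_gt0. Qed.

Lemma massE : mass = (c ^+ 2 / 2)%:C%C.
Proof. by rewrite /mass rmorphM rmorphXn fmorphV /= rmorph_nat. Qed.

Lemma swap_mxK : swap_mx *m swap_mx = 1%:M.
Proof.
rewrite /swap_mx mulmx_block !mul0mx !mulmx0 !mul1mx !add0r !addr0.
by rewrite -scalar_mx_block.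
Qed.

Let Nic_ic : - 'i%C * cC * ('i%C / cC) = 1.
Proof. by rewrite -[RHS]opprK -sqr_i; field; rewrite ?cC0. Qed.

(** Together with [dirac_expr_inv]: D f = z f + h if and only if
    f' = dirac_gen z f + (i / c) sigma h. *)
Lemma dirac_exprE z (v h : 'cV[C]_(p + p)) :
  dirac_expr c v (dirac_gen z *m v + ('i%C / cC) *: (swap_mx *m h)) = z *: v + h.
Proof.
rewrite /dirac_expr -/swap_mx mulmxDr -scalemxAr [swap_mx *m (swap_mx *m _)]mulmxA swap_mxK mul1mx.
rewrite scalerDr scalerA.
rewrite Nic_ic scale1r mulmxA addrAC; congr (_ + _).
rewrite /dirac_gen -scalemxAr -scalemxAl scalerA.
rewrite Nic_ic scale1r /swap_mx mulmx_block !mul0mx !mul1mx !addr0 !add0r.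
rewrite scalemxAl -mulmxDl -/mass scale_block_mx !scaler0 add_block_mx !addr0.
by rewrite scalerN !scalemx1 -raddfD -raddfB /= subrK addrK -scalar_mx_block mul_scalar_mx.
Qed.

Lemma dirac_expr_inv z (v w : 'cV[C]_(p + p)) :
  w = dirac_gen z *m v + ('i%C / cC) *: (swap_mx *m (dirac_expr c v w - z *: v)).
Proof.
have vE : dirac_expr c v (dirac_gen z *m v) = z *: v.
  by have := dirac_exprE z v 0; rewrite mulmx0 scaler0 !addr0.
have -> : dirac_expr c v w - z *: v = (- 'i%C * cC) *: (swap_mx *m (w - dirac_gen z *m v)).
  rewrite -vE /dirac_expr -/swap_mx opprD addrACA subrr addr0 -scalerBr.
  by rewrite -mulmxBr.
rewrite -scalemxAr scalerA mulmxA swap_mxK mul1mx mulrC Nic_ic scale1r.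
by rewrite addrC subrK.
Qed.

Section spectral.
Variable z : C.
Hypothesis z2 : z ^+ 2 = -1.
Hypothesis zC : z^*%C = - z.

(** (i / c)^2 (z + c^2 / 2) (z - c^2 / 2) = (1 + c^4 / 4) / c^2, as z^2 = -1. *)
Lemma dirac_gen_sqr : dirac_gen z *m dirac_gen z = (kappa ^+ 2)%:C%C%:M.
Proof.
rewrite /dirac_gen -scalemxAl -scalemxAr scalerA mulmx_block !mul0mx !mulmx0 !addr0 !add0r.
rewrite -!scalar_mxM [(z - _) * _]mulrC -scalar_mx_block scale_scalar_mx; congr _%:M.
have -> : (kappa ^+ 2)%:C%C = (1 + mass ^+ 2) / cC ^+ 2 :> C.
  rewrite /kappa expr_div_n sqr_sqrtr; last by rewrite addr_ge0 ?sqr_ge0.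
  by rewrite massE !(rmorphM, rmorphXn, rmorphD, fmorphV, rmorph1).
have -> : 'i%C / cC * ('i%C / cC) * ((z + mass) * (z - mass)) =
   ('i%C ^+ 2) * (z ^+ 2 - mass ^+ 2) / cC ^+ 2 by field; rewrite cC0.
by rewrite sqr_i z2; congr (_ / _); ring.
Qed.

Lemma ctr_dirac_gen : ctr (dirac_gen z) = dirac_gen z.
Proof.
rewrite /dirac_gen ctrZ ctr_block !ctr0.
have ctrs a : ctr (a%:M : 'M[C]_p) = (a^*%C)%:M by rewrite /ctr tr_scalar_mx map_scalar_mx.
have mC : (mass)^*%C = mass by rewrite massE conjc_real.
have cD (a b : C) : (a + b)^*%C = a^*%C + b^*%C by exact: rmorphD.
have cN (a : C) : (- a)^*%C = - a^*%C by exact: rmorphN.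
have -> : ('i%C / cC)^*%C = - ('i%C / cC).
  have -> : ('i%C / cC)^*%C = 'i^*%C * (cC^*%C)^-1 by rewrite -conjc_inv; exact: rmorphM.
  rewrite conjc_real -mulNr; by congr (_ / _); apply: complex_ext => /=; rewrite ?oppr0.
rewrite !ctrs !cD cN zC mC !scale_block_mx !scaler0.
by rewrite !scale_scalar_mx; congr block_mx; congr _%:M; ring.
Qed.

Lemma swap_dirac_gen : swap_mx *m dirac_gen z = - (dirac_gen (- z) *m swap_mx).
Proof.
rewrite /dirac_gen /swap_mx -scalemxAr -scalemxAl !mulmx_block !mul0mx !mulmx0.
rewrite !mul1mx !mulmx1 !addr0 !add0r -scalerN opp_block_mx !oppr0.
by rewrite -!raddfN /= ; congr (_ *: block_mx _ _ _ _); congr _%:M; ring.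
Qed.

(** The matrix exponential of t times the generator. *)
Definition propagator (t : R) : M2 :=
  (coshk kappa t)%:C%C%:M + (sinhk kappa t)%:C%C *: (kappa^-1%:C%C *: dirac_gen z).

Let S := kappa^-1%:C%C *: dirac_gen z.

Let SS : S *m S = 1%:M.
Proof.
rewrite /S -scalemxAl -scalemxAr scalerA dirac_gen_sqr scale_scalar_mx -!rmorphM /=.
have -> : kappa^-1 * kappa^-1 * kappa ^+ 2 = 1 by field; rewrite gt_eqF ?kappa_gt0.
by rewrite rmorph1.
Qed.

Let SC : ctr S = S.
Proof. by rewrite /S ctrZ ctr_dirac_gen conjc_real. Qed.

Lemma propagator0 : propagator 0 = 1%:M.
Proof. by rewrite /propagator coshk0 sinhk0 rmorph1 rmorph0 scale0r addr0. Qed.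

Lemma ctr_propagator t : ctr (propagator t) = propagator t.
Proof.
rewrite /propagator -/S ctrD ctrZ SC conjc_real; congr (_ + _).
by rewrite /ctr tr_scalar_mx map_scalar_mx; congr _%:M; exact: conjc_real.
Qed.

Let propagatorE a : (fun y => propagator (y - a)) = (fun y =>
   (coshk kappa (y - a))%:C%C *: 1%:M + (sinhk kappa (y - a))%:C%C *: S).
Proof. by apply/funext => y; rewrite /propagator scalemx1. Qed.

Lemma cac_propagator a s t : entrywise (cac s t) (fun y => propagator (y - a)).
Proof.
have cs := star_cac s t; rewrite propagatorE.
apply: (entrywise_add cs); apply: (entrywise_scale cs); try exact: (entrywise_cst cs).
  exact: cac_coshk.
exact: cac_sinhk.
Qed.

Lemma mder_propagator a y :
  mder (fun y => propagator (y - a)) y (dirac_gen z *m propagator (y - a)).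
Proof.
have -> : dirac_gen z *m propagator (y - a) =
    (kappa * sinhk kappa (y - a))%:C%C *: 1%:M + 0 +
    ((kappa * coshk kappa (y - a))%:C%C *: S + (sinhk kappa (y - a))%:C%C *: 0).
  have gS : dirac_gen z = kappa%:C%C *: S.
    by rewrite /S scalerA -rmorphM /= mulfV ?gt_eqF ?kappa_gt0 // rmorph1 scale1r.
  rewrite /propagator -/S mulmxDr mul_mx_scalar {1}gS scalerA -rmorphM /= [coshk _ _ * _]mulrC.
  rewrite -scalemxAr {1}gS -scalemxAl SS scalerA -rmorphM /= [sinhk _ _ * _]mulrC.
  by rewrite scaler0 !addr0 addrC.
rewrite propagatorE; apply: mderD.
  have := mder_scale (cder_coshk kappa a y) (mder_cst (1%:M : M2) y).
  by rewrite scaler0.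
exact: mder_scale (cder_sinhk kappa a y) (mder_cst S y).
Qed.

(** The generator divided by kappa is a Hermitian involution, hence an isometry,
    and cosh + sinh = exp. *)
Lemma enorm_propagator t (v : 'cV[C]_(p + p)) : 0 <= t ->
  enorm (propagator t *m v) <= expR (kappa * t) * enorm v.
Proof.
move=> t0; rewrite /propagator -/S mulmxDl mul_scalar_mx -scalemxAl.
have nr (r : R) : 0 <= r -> normc r%:C%C = r.
  by move=> r0; rewrite /= expr0n addr0 sqrtr_sqr ger0_norm.
apply: le_trans (enormD _ _) _; rewrite !enormZ nr ?(ltW (coshk_gt0 _ _)) // nr ?sinhk_ge0 ?(ltW kappa_gt0) //.
by rewrite enorm_isometry ?SC // -mulrDl coshk_add_sinhk.
Qed.

End spectral.
End dirac_matrices.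

(** * Inner products, adjoints and closures *)

Section adjoints.
Variables (R : realType) (m : nat) (D : set R).
Hypothesis mD : measurable D.
Local Notation C := R[i].
Local Notation H := (R -> 'cV[C]_m).
Implicit Types f g : H.

Lemma L2B f g : L2 D f -> L2 D g -> L2 D (f \- g).
Proof.
move=> /(L2_entrywise _ mD) Hf /(L2_entrywise _ mD) Hg; apply/(L2_entrywise _ mD).
have -> : f \- g = (fun y => f y + (-1) *: g y) by apply/funext => y; rewrite scaleN1r.
by apply: mcL2D => //; exact: mcL2Z.
Qed.

Lemma L2norm_sqr f : L2norm D f ^+ 2 = rint D (fun y => enorm (f y) ^+ 2).
Proof. by rewrite sqr_sqrtr //; apply: Rintegral_ge0 => y _; exact: sqr_ge0. Qed.

Lemma cinteg_L2inner f g : L2 D f -> L2 D g ->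
  cinteg D (fun y => (ctr (g y) *m f y) 0 0).
Proof. by move=> /(L2_entrywise _ mD) Hf /(L2_entrywise _ mD) Hg; exact: (cinteg_pair mD Hg Hf). Qed.

Lemma L2innerBl f f' g : L2 D f -> L2 D f' -> L2 D g ->
  L2inner D (f \- f') g = L2inner D f g - L2inner D f' g.
Proof.
move=> Hf Hf' Hg; rewrite !L2innerE -[- cint _ _]mulN1r -cintZ //; last exact: cinteg_L2inner.
rewrite -cintD //; [|exact: cinteg_L2inner|by apply: cintegZ => //; exact: cinteg_L2inner].
by apply: eq_cint => y _; rewrite /= mulmxBr !mxE mulN1r.
Qed.

(** A form of the Cauchy-Schwarz inequality: the optimal t gives twice the
    product of the norms. *)
Lemma normc_L2inner f g (t : R) : 0 < t -> L2 D f -> L2 D g ->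
  normc (L2inner D f g) <= t * L2norm D f ^+ 2 + t^-1 * L2norm D g ^+ 2.
Proof.
move=> t0 Hf Hg; have [I1 I2] := cinteg_L2inner Hf Hg.
rewrite L2innerE; apply: le_trans (normc_le_ReIm _) _.
pose B y := t * enorm (f y) ^+ 2 + t^-1 * enorm (g y) ^+ 2.
have If : rinteg D (fun y => enorm (f y) ^+ 2) by case: Hf.
have Ig : rinteg D (fun y => enorm (g y) ^+ 2) by case: Hg.
have IB : rinteg D B by apply: rintegD => //; exact: rintegZ.
have bnd y : normc ((ctr (g y) *m f y) 0 0) <= 2^-1 * B y.
  rewrite mxE; apply: le_trans (normc_sum _ _) _.
  rewrite /B !enorm_sqr !mulr_sumr -big_split /= mulr_sumr; apply: ler_sum => k _.
  rewrite normcME !mxE normcCE.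
  set r := normc (g y k 0); set s := normc (f y k 0).
  rewrite -subr_ge0.
  have -> : 2^-1 * (t * s ^+ 2 + t^-1 * r ^+ 2) - r * s = 2^-1 * t^-1 * (t * s - r) ^+ 2.
    by field; rewrite gt_eqF.
  by rewrite mulr_ge0 ?sqr_ge0 // mulr_ge0 ?invr_ge0 // (ltW t0).
have half (F : R -> R) : rinteg D F ->
    (forall y, `|F y| <= normc ((ctr (g y) *m f y) 0 0)) -> `|rint D F| <= 2^-1 * rint D B.
  move=> IF HF; apply: le_trans (rint_normr mD IF) _; rewrite -rintZ //.
  apply: rint_le => //; [exact: rinteg_norm|exact: rintegZ|].
  by move=> y _; exact: le_trans (HF y) (bnd y).
have -> : t * L2norm D f ^+ 2 + t^-1 * L2norm D g ^+ 2 = 2^-1 * rint D B + 2^-1 * rint D B.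
  rewrite !L2norm_sqr /B rintD ?rintZ //; try exact: rintegZ.
  by field; rewrite gt_eqF.
apply: lerD; apply: half => // y; [exact: Re_le_normc|exact: Im_le_normc].
Qed.

Lemma L2inner_small g (s : nat -> H) : L2 D g -> (forall n, L2 D (s n)) ->
  L2norm D (s n) @[n --> \oo] --> (0 : R) ->
  forall eps, 0 < eps -> \forall n \near \oo, normc (L2inner D (s n) g) < eps.
Proof.
move=> Hg Hs s0 eps eps0; pose G := L2norm D g ^+ 2.
have G0 : 0 <= G by exact: sqr_ge0.
(* With this t the term with |g| of [normc_L2inner] is below eps / 2. *)
pose t := 2 * (G + 1) / eps.
have t0 : 0 < t by rewrite divr_gt0 // mulr_gt0 // ltr_wpDl.
have tG : t^-1 * G < eps / 2.
  have G1 : 0 < G + 1 by rewrite ltr_wpDl.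
  have -> : t^-1 * G = eps / 2 * (G / (G + 1)) by rewrite /t; field; rewrite !gt_eqF.
  by rewrite -[ltRHS]mulr1 ltr_pM2l ?divr_gt0 // ltr_pdivrMr // mul1r ltrDl.
have d0 : 0 < Num.min 1 (eps / 2 / t) by rewrite lt_min ltr01 divr_gt0 // divr_gt0.
move/cvgr0Pnorm_lt: s0 => /(_ _ d0); apply: filterS => n.
rewrite ger0_norm ?sqrtr_ge0 // lt_min => /andP[n1 nt].
apply: le_lt_trans (normc_L2inner t0 (Hs n) Hg) _; rewrite -/G.
suff : t * L2norm D (s n) ^+ 2 <= eps / 2 by lra.
apply: (@le_trans _ _ (t * (eps / 2 / t))); last by rewrite mulrC divfK ?gt_eqF.
rewrite ler_pM2l //; apply: le_trans (ltW nt); rewrite expr2.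
by rewrite ler_piMr ?sqrtr_ge0 // ltW.
Qed.

Variable T : set (H * H).
Hypothesis TL2 : forall FU, T FU -> L2 D FU.1 /\ L2 D FU.2.

Lemma subset_op_closure : T `<=` op_closure D T.
Proof.
move=> [F U] TFU; have [HF HU] := TL2 TFU; split=> //; exists (fun=> (F, U)) => //=.
have z0 (f : H) : L2norm D (f \- f) = 0.
  apply/eqP; rewrite sqrtr_eq0 le_eqVlt; apply/orP; left; apply/eqP.
  rewrite -[LHS]/(rint D _) (@eq_rint _ _ _ (fun=> 0)) => [|y _]; last first.
    by rewrite /= subrr enorm0 expr0n.
  by have := congr1 (@complex.Re R) (cint0 mD).
by rewrite !z0; split; exact: cvg_cst.
Qed.

(** The inner product is continuous, so the relation that defines the adjoint
    passes to limits in the graph. *)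
Lemma op_adjoint_closure : op_adjoint D T `<=` op_adjoint D (op_closure D T).
Proof.
move=> [G W] [/= HG HW adj]; split=> // F U [/= HF HU [s Ts [sF sU]]].
have Hs1 n : L2 D (s n).1 by case: (TL2 (Ts n)).
have Hs2 n : L2 D (s n).2 by case: (TL2 (Ts n)).
apply/eqP; rewrite -subr_eq0; apply/eqP/Normc.eq0_normc/eqP.
rewrite eq_le normc_ge0 andbT; apply/ler_addgt0Pr => eps eps0; rewrite add0r.
have e2 : 0 < eps / 2 by rewrite divr_gt0.
have N1 := L2inner_small HG (fun n => L2B (Hs2 n) HU) sU e2.
have N2 := L2inner_small HW (fun n => L2B (Hs1 n) HF) sF e2.
have [n [h1 h2]] : exists n, normc (L2inner D ((s n).2 \- U) G) < eps / 2 /\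
    normc (L2inner D ((s n).1 \- F) W) < eps / 2.
  by have [N _ HN] := filterI N1 N2; exists N; apply: HN => /=.
have eqn : L2inner D (s n).2 G = L2inner D (s n).1 W.
  by apply: adj; case: (s n) (Ts n).
rewrite (L2innerBl (Hs2 n) HU HG) eqn in h1; rewrite (L2innerBl (Hs1 n) HF HW) in h2.
set a := L2inner D U G in h1 *; set b := L2inner D F W in h2 *.
set d := L2inner D (s n).1 W in h1 h2.
have -> : a - b = - (d - a) + (d - b) by ring.
by apply: le_trans (normcD _ _) _; rewrite normcNE; lra.
Qed.

End adjoints.

Section gram.
Variables (R : realType) (D : set R).
Hypothesis mD : measurable D.
Local Notation C := R[i].

(** Inner products of all columns of F with all columns of G. *)
Definition gram m n k (G : R -> 'M[C]_(k, m)) (F : R -> 'M[C]_(k, n)) : 'M[C]_(m, n) :=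
  \matrix_(i, j) cint D (fun y => (ctr (G y) *m F y) i j).

Lemma L2inner_gram m (F G : R -> 'cV[C]_m) : L2inner D F G = gram G F 0 0.
Proof. by rewrite mxE L2innerE. Qed.

Lemma gram_mulr m n k l (G : R -> 'M[C]_(k, m)) (F : R -> 'M[C]_(k, n)) (A : 'M[C]_(n, l)) :
  entrywise (cL2 D) G -> entrywise (cL2 D) F -> gram G (fun y => F y *m A) = gram G F *m A.
Proof.
move=> HG HF; have I := cinteg_pair mD HG HF.
apply/matrixP => i j; rewrite !mxE.
transitivity (cint D (fun y => \sum_r A r j * (ctr (G y) *m F y) i r)).
  by apply: eq_cint => y _; rewrite mulmxA mxE; apply: eq_bigr => r _; rewrite mulrC.
rewrite cint_sum // => [|r]; last by apply: cintegZ => //; exact: I.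
by apply: eq_bigr => r _; rewrite (cintZ mD _ (I i r)) mxE mulrC.
Qed.

Lemma gram_ctr m n k (G : R -> 'M[C]_(k, m)) (F : R -> 'M[C]_(k, n)) :
  entrywise (cL2 D) G -> entrywise (cL2 D) F -> gram F G = ctr (gram G F).
Proof.
move=> HG HF; apply/matrixP => i j; rewrite !mxE -cintC //; last exact: (cinteg_pair mD HG HF).
apply: eq_cint => y _; have -> : ctr (F y) *m G y = ctr (ctr (G y) *m F y).
  by rewrite ctrM ctrK.
by rewrite !mxE.
Qed.

Lemma gramBr m n k (G : R -> 'M[C]_(k, m)) (F F' : R -> 'M[C]_(k, n)) :
  entrywise (cL2 D) G -> entrywise (cL2 D) F -> entrywise (cL2 D) F' ->
  gram G (fun y => F y - F' y) = gram G F - gram G F'.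
Proof.
move=> HG HF HF'; have I := cinteg_pair mD HG HF; have I' := cinteg_pair mD HG HF'.
apply/matrixP => i j; rewrite !mxE -[- cint _ _]mulN1r -(cintZ mD (-1) (I' i j)).
rewrite -(cintD mD (I i j) (cintegZ mD (-1) (I' i j))).
by apply: eq_cint => y _; rewrite mulmxBr !mxE mulN1r.
Qed.

Lemma mcL2B m n (A B : R -> 'M[C]_(m, n)) :
  entrywise (cL2 D) A -> entrywise (cL2 D) B -> entrywise (cL2 D) (fun y => A y - B y).
Proof.
move=> HA HB; have -> : (fun y => A y - B y) = (fun y => A y + (-1) *: B y).
  by apply/funext => y; rewrite scaleN1r.
by apply: mcL2D => //; exact: mcL2Z.
Qed.

Lemma mcL2_scaleb m n (r : R -> C) (M : R) (A : R -> 'M[C]_(m, n)) :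
  cmeas D r -> (forall y, D y -> normc (r y) <= M) ->
  entrywise (cL2 D) A -> entrywise (cL2 D) (fun y => r y *: A y).
Proof.
move=> mr rM HA i j; apply: (@eq_cL2 _ _ mD (fun y => A y i j * r y)).
  by move=> y _; rewrite mxE mulrC.
exact: cL2_mulb (HA i j) mr rM.
Qed.

End gram.

(** * The fundamental matrix with jumps *)

Section fundamental_matrix.
Variables (R : realType) (p : nat).
Local Notation C := R[i].
Local Notation M2 := 'M[C]_(p + p).
Variables (c b : R) (x : nat -> R) (alpha : nat -> 'M[C]_p).
Hypothesis c0 : 0 < c.
Hypothesis x0 : x 0%N = 0.
Hypothesis xmono : forall m n : nat, (m < n)%N -> x m < x n.
Hypothesis xlim : x n @[n --> \oo] --> b.
Hypothesis alphaC : forall n, (1 <= n)%N -> alpha n = conj_tr (alpha n).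

Local Notation cC := (c%:C%C : C).

Lemma x_le m n : (m <= n)%N -> x m <= x n.
Proof. by rewrite leq_eqVlt => /predU1P[->//|/xmono/ltW]. Qed.

Lemma x_ge0 n : 0 <= x n. Proof. by rewrite -x0 x_le. Qed.

Lemma x_lt_b n : x n < b.
Proof.
have cx : nondecreasing_seq x by move=> m k; exact: x_le.
apply: lt_le_trans (xmono (ltnSn n)) _.
have <- : limn x = b by apply/cvg_lim => //; exact: Rhausdorff.
by apply: nondecreasing_cvgn_le => //; apply/cvg_ex; exists b.
Qed.

Lemma b_gt0 : 0 < b. Proof. by rewrite -x0 x_lt_b. Qed.

Lemma x_exceeds y : y < b -> exists n, y < x n.
Proof.
move=> yb; have /cvgrPdist_lt/(_ (b - y)) := xlim.
rewrite subr_gt0 => /(_ yb) [N _ /(_ N (leqnn _))] /=.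
by rewrite gtr0_norm ?subr_gt0 ?x_lt_b // => H; exists N; lra.
Qed.

Lemma x_interval y : 0 <= y -> y < b -> exists n, x n <= y < x n.+1.
Proof.
move=> y0 yb; have ex := x_exceeds yb.
case: (ex_minnP ex) => -[|n] yn nmin; first by rewrite x0 ltNge y0 in yn.
exists n; rewrite yn andbT leNgt; apply/negP => /nmin; by rewrite ltnn.
Qed.

Lemma x_interval_unique y m n : x m <= y < x m.+1 -> x n <= y < x n.+1 -> m = n.
Proof.
move=> /andP[h1 h2] /andP[h3 h4]; case: (ltngtP m n) => // /x_le h.
  by move: (lt_le_trans h2 (le_trans h h3)); rewrite ltxx.
by move: (lt_le_trans h4 (le_trans h h1)); rewrite ltxx.
Qed.

Definition piece_index (y : R) : nat := xget 0%N [set n | x n <= y < x n.+1].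

Lemma piece_indexE n y : x n <= y < x n.+1 -> piece_index y = n.
Proof.
move=> H; apply: x_interval_unique (H).
by rewrite /piece_index; case: xgetP => [m _ //|/(_ n)].
Qed.

(** Acts on (f_I, f_II) as the transition from x_n - to x_n + prescribed by
    the domain of the operator. *)
Definition jump_mx (a : 'M[C]_p) : M2 := block_mx 1%:M 0 (- ('i%C / cC) *: a) 1%:M.

(** The value at x_n +. *)
Fixpoint node_mx (z : C) (n : nat) : M2 :=
  if n is m.+1 then
    jump_mx (alpha m.+1) *m (propagator p c z (x m.+1 - x m) *m node_mx z m)
  else 1%:M.

(** The solution on the n-th interval, continued to the whole line.  Smoothness
    and one-sided limits are obtained from this continuation. *)
Definition piece_mx z n y : M2 := propagator p c z (y - x n) *m node_mx z n.
Definition fund_mx z y : M2 := piece_mx z (piece_index y) y.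

Lemma fundE z n y : x n <= y < x n.+1 -> fund_mx z y = piece_mx z n y.
Proof. by rewrite /fund_mx => /piece_indexE ->. Qed.

Lemma piece_node z n : piece_mx z n (x n) = node_mx z n.
Proof. by rewrite /piece_mx subrr propagator0 mul1mx. Qed.

Lemma piece_jump z n :
  piece_mx z n.+1 (x n.+1) = jump_mx (alpha n.+1) *m piece_mx z n (x n.+1).
Proof. by rewrite piece_node. Qed.

Lemma usub_jump m (a : 'M[C]_p) (A : 'M[C]_(p + p, m)) :
  usubmx (jump_mx a *m A) = usubmx A.
Proof.
rewrite -[A in LHS]vsubmxK /jump_mx mul_block_col mul1mx mul0mx addr0.
by rewrite col_mxKu.
Qed.

Lemma dsub_jump m (a : 'M[C]_p) (A : 'M[C]_(p + p, m)) :
  dsubmx (jump_mx a *m A) = dsubmx A - ('i%C / cC) *: (a *m usubmx A).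
Proof.
rewrite -[A in LHS]vsubmxK /jump_mx mul_block_col !mul1mx col_mxKd.
by rewrite addrC -scalemxAl scaleNr.
Qed.

Lemma piece_cac z n s t : entrywise (cac s t) (piece_mx z n).
Proof.
by apply: (entrywise_mul (star_cac s t)); [exact: cac_propagator|exact: (entrywise_cst (star_cac s t))].
Qed.

(** The two terms with alpha_n cancel because alpha_n is selfadjoint. *)
Lemma jump_swap n : (1 <= n)%N ->
  ctr (jump_mx (alpha n)) *m swap_mx R p *m jump_mx (alpha n) = swap_mx R p.
Proof.
move=> n1; have aC : ctr (alpha n) = alpha n by rewrite [RHS]alphaC.
rewrite /jump_mx /swap_mx ctr_block !ctr1 ctr0 ctrZ aC.
rewrite !mulmx_block !(mul0mx, mulmx0, mul1mx, mulmx1, add0r, addr0).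
have -> : (- ('i%C / cC))^*%C = 'i%C / cC.
  have -> : (- ('i%C / cC))^*%C = - ('i^*%C * (cC^*%C)^-1).
    by rewrite -conjc_inv; transitivity (- ('i%C / cC)^*%C); [exact: rmorphN|congr (- _); exact: rmorphM].
  by rewrite conjc_real -mulNr; congr (_ / _); apply: complex_ext => /=; rewrite ?oppr0 ?opprK.
by rewrite scaleNr subrr.
Qed.

Section spectral.
Variable z : C.
Hypothesis z2 : z ^+ 2 = -1.
Hypothesis zC : z^*%C = - z.

Lemma mder_piece n y : mder (piece_mx z n) y (dirac_gen p c z *m piece_mx z n y).
Proof.
have := mderM (mder_propagator c0 z2 (x n) y) (mder_cst (node_mx z n) y).
by rewrite mulmx0 addr0 -(mulmxA (dirac_gen p c z)).
Qed.

Let scale_sqr k (g : M2) : (k *: g) *m (k *: g) = (k * k) *: (g *m g).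
Proof. by rewrite -scalemxAl -scalemxAr scalerA. Qed.

Let scale_anticomm k (g h s : M2) : g *m s = - (s *m h) ->
  (k *: g) *m s = - (s *m (k *: h)).
Proof. by move=> gs; rewrite -scalemxAl gs -scalemxAr scalerN. Qed.

(** sigma intertwines the generators of z and -z up to sign, so this is
    (cosh - sinh) (cosh + sinh) = 1 in disguise. *)
Lemma propagator_swap t :
  propagator p c z t *m swap_mx R p *m propagator p c (- z) t = swap_mx R p.
Proof.
have mz2 : (- z) ^+ 2 = -1 by rewrite sqrrN.
have zs : dirac_gen p c z *m swap_mx R p = - (swap_mx R p *m dirac_gen p c (- z)).
  by have := swap_dirac_gen p c (- z); rewrite opprK => ->; rewrite opprK.
have gg := dirac_gen_sqr p c0 mz2.
pose d := sinhk (kappa c) t; pose a := (coshk (kappa c) t)%:C%C : C.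
pose T := d%:C%C *: ((kappa c)^-1%:C%C *: dirac_gen p c (- z)).
have TT : T *m T = (d ^+ 2)%:C%C%:M.
  rewrite /T (scalerA d%:C%C) scale_sqr gg scale_scalar_mx; congr _%:M.
  by rewrite -!rmorphM /=; congr (_%:C%C); field; rewrite gt_eqF ?kappa_gt0.
have -> : propagator p c z t *m swap_mx R p = swap_mx R p *m (a%:M - T).
  rewrite /propagator mulmxDl mulmxBr mul_scalar_mx mul_mx_scalar; congr (_ + _).
  have := scale_anticomm (d%:C%C * (kappa c)^-1%:C%C) zs.
  by rewrite -!scalerA; apply.
rewrite -mulmxA -[propagator _ _ _ _]/(a%:M + T) -[RHS]mulmx1; congr (_ *m _).
rewrite mulmxBl !mulmxDr TT -scalar_mxM mul_scalar_mx mul_mx_scalar.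
rewrite opprD addrA addrK -raddfB /=; congr _%:M.
by rewrite /a -rmorphM -rmorphB /= -expr2 coshk2_sub_sinhk2 rmorph1.
Qed.

(** Conservation of the sesquilinear Wronskian: up to sigma, the adjoint of the
    solution matrix for z is the inverse of the one for -z. *)
Lemma piece_swap n y :
  ctr (piece_mx z n y) *m swap_mx R p *m piece_mx (- z) n y = swap_mx R p.
Proof.
have zz : (- z) ^+ 2 = -1 by rewrite sqrrN.
suff H : ctr (node_mx z n) *m swap_mx R p *m node_mx (- z) n = swap_mx R p.
  rewrite /piece_mx ctrM ctr_propagator // -[RHS]H -!mulmxA; congr (_ *m _).
  by rewrite !mulmxA propagator_swap.
elim: n => [|n IH] /=; first by rewrite ctr1 mul1mx mulmx1.
rewrite !ctrM ctr_propagator // -[RHS]IH -!mulmxA; congr (_ *m _).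
rewrite [swap_mx R p *m (jump_mx _ *m _)]mulmxA.
rewrite [ctr (jump_mx _) *m _]mulmxA mulmxA [ctr (jump_mx _) *m _]mulmxA jump_swap //.
by rewrite !mulmxA propagator_swap.
Qed.

(** * Square integrability of the fundamental matrix *)

Lemma enorm_col_mx m n (u : 'cV[C]_m) (v : 'cV[C]_n) :
  enorm (col_mx u v) ^+ 2 = enorm u ^+ 2 + enorm v ^+ 2.
Proof.
rewrite !enorm_sqr big_split_ord /=; congr (_ + _); apply: eq_bigr => k _.
  by rewrite col_mxEu.
by rewrite col_mxEd.
Qed.

(** The jump adds a vector of norm at most |alpha_n| |w_I| / c. *)
Lemma enorm_jump (a : 'M[C]_p) (w : 'cV[C]_(p + p)) :
  enorm (jump_mx a *m w) <= (1 + c^-1 * opnorm a) * enorm w.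
Proof.
have wu : enorm (usubmx w) <= enorm w.
  rewrite enorm_le_sqr ?enorm_ge0 // -[w in leRHS]vsubmxK enorm_col_mx.
  by rewrite lerDl sqr_ge0.
have -> : jump_mx a *m w = w + col_mx 0 (- ('i%C / cC) *: (a *m usubmx w)).
  rewrite -[in RHS](vsubmxK w) -[w in LHS]vsubmxK /jump_mx mul_block_col !mul1mx mul0mx.
  by rewrite add_col_mx col_mxKu !addr0 addrC -scalemxAl.
apply: le_trans (enormD _ _) _; rewrite mulrDl mul1r lerD2l.
have -> : enorm (col_mx (0 : 'cV_p) (- ('i%C / cC) *: (a *m usubmx w))) =
    c^-1 * enorm (a *m usubmx w).
  apply/eqP; rewrite -(@eqrXn2 _ 2) ?enorm_ge0 ?mulr_ge0 ?enorm_ge0 ?invr_ge0 ?ltW //.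
  rewrite enorm_col_mx enorm0 expr0n add0r enormZ; apply/eqP; congr ((_ * _) ^+ 2).
  rewrite normcNE normcME Normc.normcV /= expr0n expr1n add0r sqrtr1 mul1r.
  by rewrite addr0 sqrtr_sqr gtr0_norm.
rewrite -mulrA ler_pM2l ?invr_gt0 //.
apply: le_trans (enorm_opnorm _ _) _; apply: ler_wpM2l => //; exact: opnorm_ge0.
Qed.

Definition growth (n : nat) : R := \prod_(1 <= k < n.+1) (1 + c^-1 * opnorm (alpha k)).

Lemma growth_ge0 n : 0 <= growth n.
Proof.
apply: prodr_ge0 => k _; rewrite addr_ge0 // mulr_ge0 ?opnorm_ge0 // invr_ge0.
exact: ltW.
Qed.

Lemma enorm_node n (u : 'cV[C]_(p + p)) :
  enorm (node_mx z n *m u) <= expR (kappa c * x n) * growth n * enorm u.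
Proof.
elim: n => [|n IH] /=.
  by rewrite mul1mx x0 mulr0 expR0 /growth big_geq // !mul1r.
rewrite -!mulmxA; apply: le_trans (enorm_jump _ _) _.
have -> : expR (kappa c * x n.+1) * growth n.+1 * enorm u =
    (1 + c^-1 * opnorm (alpha n.+1)) *
    (expR (kappa c * (x n.+1 - x n)) * (expR (kappa c * x n) * growth n * enorm u)).
  have -> : expR (kappa c * x n.+1) = expR (kappa c * (x n.+1 - x n)) * expR (kappa c * x n).
    by rewrite -expRD -mulrDr subrK.
  by rewrite /growth [in LHS]big_nat_recr //= -/(growth n); ring.
apply: ler_wpM2l.
  by rewrite addr_ge0 // mulr_ge0 ?opnorm_ge0 // invr_ge0 ltW.
apply: le_trans (enorm_propagator c0 z2 zC _ _) _; first by rewrite subr_ge0 x_le.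
by rewrite ler_pM2l ?expR_gt0.
Qed.

Lemma enorm_fund n y (u : 'cV[C]_(p + p)) : x n <= y < x n.+1 ->
  enorm (fund_mx z y *m u) <= expR (kappa c * y) * growth n * enorm u.
Proof.
move=> yn; rewrite (fundE _ yn) /piece_mx -mulmxA.
apply: le_trans (enorm_propagator c0 z2 zC _ _) _; first by rewrite subr_ge0; case/andP: yn.
have -> : expR (kappa c * y) * growth n * enorm u =
    expR (kappa c * (y - x n)) * (expR (kappa c * x n) * growth n * enorm u).
  have -> : expR (kappa c * y) = expR (kappa c * (y - x n)) * expR (kappa c * x n).
    by rewrite -expRD -mulrDr subrK.
  by ring.
by rewrite ler_pM2l ?expR_gt0 // enorm_node.
Qed.

Hypothesis sum_lty : (\sum_(2 <= n <oo)
     ((x n - x n.-1) *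
      \prod_(1 <= k < n) (1 + c^-1 * opnorm (alpha k)) ^+ 2)%:E < +oo)%E.

Let cell n : set R := `[x n.-1, x n[.

Let cell_index n y : cell n y -> (0 < n)%N /\ x n.-1 <= y < x n.-1.+1.
Proof.
rewrite /cell /= in_itv /=; case: n => [|n] //= /andP[h1 h2].
by have := le_lt_trans h1 h2; rewrite ltxx.
Qed.

Let mcell n : measurable (cell n). Proof. exact: measurable_itv. Qed.

Let sub_cells : `]0, b[ `<=` \bigcup_n cell n.
Proof.
move=> y /=; rewrite in_itv /= => /andP[y0 yb].
by have [n yn] := x_interval (ltW y0) yb; exists n.+1 => //=; rewrite /cell /= in_itv.
Qed.

(** The square of an entry is at most a constant times the n-th product of the
    hypothesis on an interval of length d_n, so its integral is dominated by the
    convergent series. *)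
Lemma fund_L2 : entrywise (cL2 `]0, b[) (fund_mx z).
Proof.
have mI : measurable (`]0, b[ : set R) by exact: measurable_itv.
have mU : measurable (\bigcup_n cell n) by exact: bigcup_measurable.
have mf i j n : cmeas (cell n) (fun y => fund_mx z y i j).
  apply: (@eq_cmeas _ _ (fun y => piece_mx z n.-1 y i j)).
    by move=> y /cell_index [_ /fundE ->].
  by apply: cac_cmeas => [|s t]; [exact: mcell|exact: piece_cac].
move=> i j; apply: (cL2_sub mI mU sub_cells); split.
  by split; apply/measurable_fun_bigcup => // n; case: (mf i j n).
pose B n := (expR (kappa c * b) * growth n.-1) ^+ 2.
have B0 n : 0 <= B n by rewrite sqr_ge0.
apply: (rinteg_bigcup (B := B)) => //.
- apply/trivIsetP => m n _ _ mn; apply/seteqP; split => y //= [/cell_index[m0 hm] /cell_index[n0 hn]].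
  have := x_interval_unique hm hn; case: m m0 mn {hm} => // m _; case: n n0 {hn} => // n _ /=.
  by move=> /eqP + h; rewrite h.
- by move=> n; apply: cmeas_sqr; exact: mf.
- move=> n y yn; rewrite sqr_ge0 /=; have [n0 hy] := cell_index yn.
  have K0 : 0 <= expR (kappa c * b) * growth n.-1 by rewrite mulr_ge0 ?expR_ge0 ?growth_ge0.
  rewrite ler_pXn2r ?nnegrE ?normc_ge0 //.
  have := enorm_fund (delta_mx j 0) hy; rewrite -colE.
  have -> : enorm (delta_mx j 0 : 'cV[C]_(p + p)) = 1.
    apply/eqP; rewrite -(@eqrXn2 _ 2) ?enorm_ge0 // enorm_sqr (bigD1 j) //= big1.
      by rewrite mxE !eqxx Normc.normc1 addr0.
    by move=> k kj; rewrite mxE (negbTE kj) normc0E expr0n.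
  rewrite mulr1 => H; apply: le_trans (le_trans H _).
    by have := normc_le_enorm (col j (fund_mx z y)) i; rewrite mxE.
  apply: ler_wpM2r; first exact: growth_ge0.
  rewrite ler_expR ler_pM2l ?kappa_gt0 //.
  by case/andP: hy => _ /ltW h; apply: le_trans h (ltW (x_lt_b _)).
pose K := expR (kappa c * b) ^+ 2.
have mu_cell n : lebesgue_measure (cell n) = (x n - x n.-1)%:E.
  rewrite lebesgue_measure_itv /= lte_fin -EFinB; case: ifPn => //.
  by rewrite -leNgt => h; congr EFin; have := x_le (leq_pred n); lra.
pose S n := ((x n - x n.-1) * \prod_(1 <= k < n) (1 + c^-1 * opnorm (alpha k)) ^+ 2)%:E.
have S0 n : (0 <= S n)%E.
  rewrite lee_fin mulr_ge0 ?subr_ge0 ?x_le ?leq_pred //.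
  by apply: prodr_ge0 => k _; exact: sqr_ge0.
rewrite (@eq_eseriesr _ _ (fun n => K%:E * S n)%E); last first.
  move=> n _; rewrite mu_cell -!EFinM; congr EFin.
  rewrite /B exprMn -mulrA; congr (_ * _); rewrite mulrC.
  case: n => [|n]; first by rewrite /= subrr !mul0r.
  by rewrite /growth /= -prodrXl.
rewrite nneseriesZl //; apply: lte_mul_pinfty; rewrite ?lee_fin ?sqr_ge0 //.
rewrite (nneseries_split 0 2) //; apply: lte_add_pinfty; last by rewrite add0n.
by rewrite sumEFin ltry.
Qed.

(** * One-sided limits and the Lagrange identity *)

Lemma mcvg_nbhs_in m n (A : R -> 'M[C]_(m, n)) s t a : s < a -> a < t ->
  entrywise (cac s t) A -> mcvg (nbhs a) A (A a).
Proof. by move=> sa at_ H i j; apply: cac_ccvg_in sa at_ (H i j). Qed.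

Section one_sided_limits.
Variables f g : R -> 'cV[C]_(p + p).
Hypothesis dom : GS_dom0 c b x alpha f g.
Let mI : measurable (`]0, b[ : set R). Proof. exact: measurable_itv. Qed.

Let sub_I n : `]x n, x n.+1[ `<=` (`]0, b[ : set R).
Proof.
move=> y /=; rewrite !in_itv /= => /andP[ny yn].
by rewrite (le_lt_trans (x_ge0 n) ny) (lt_trans yn (x_lt_b _)).
Qed.

Let fL2 : entrywise (cL2 `]0, b[) f.
Proof. by case: dom => -[[/(L2_entrywise _ mI)]]. Qed.

Let gL2 : entrywise (cL2 `]0, b[) g.
Proof. by case: dom => -[[_ /(L2_entrywise _ mI)]]. Qed.

Let cL2_1 : cL2 `]0, b[ (fun=> 1 : C).
Proof. by apply: cL2_cst => //; rewrite lebesgue_measure_itv /=; case: ifP => // _; rewrite ltry. Qed.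

Let f_ac n u v : x n < u -> v < x n.+1 -> entrywise (cac u v) f.
Proof.
move=> nu vn; apply/abs_contP; case: dom => -[[_ _ /(_ n)]] [_ _ + _] _ _ _ _ _.
have [uv /(_ _ _ uv)|vu _] := leP u v.
  apply=> y /=; rewrite !in_itv /= => /andP[uy yv].
  by rewrite (lt_le_trans nu uy) (le_lt_trans yv vn).
apply/abs_contP => i j; move=> e e0; exists 1 => // -[|m] u' v' H _ _; first by rewrite big_ord0.
by have [h1 h2 h3] := H ord0; have := le_trans (le_trans h1 h2) h3; rewrite leNgt vu.
Qed.

Let f_der n : {ae lebesgue_measure, forall y : R, x n < y < x n.+1 -> mder f y (g y)}.
Proof.
case: dom => -[[_ _ /(_ n)]] [_ _ _ H] _ _ _ _ _.
by apply: aeS H => y H yn i j; rewrite ord1; apply: H; rewrite /= in_itv.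
Qed.

Let f_prim n i : exists a : C, forall y : R, x n < y < x n.+1 ->
  f y i 0 = a + cprim (ext0 `]0, b[ (fun y => g y i 0)) y.
Proof.
apply: ac_eq_cprim => [u v nu uv vn||].
- exact: f_ac nu vn i 0.
- apply: cinteg_ext0 => //; have := cL2_cintegM mI cL2_1 (gL2 i 0).
  by apply: eq_cinteg => // y _; rewrite mul1r.
- apply: aeS (f_der n) => y H yn; rewrite /ext0 ifT; first exact: H.
  by rewrite inE; apply: (sub_I (n := n)); rewrite /= in_itv.
Qed.

Let gprim_cvg i (a : R) :
  ccvg (nbhs a) (cprim (ext0 `]0, b[ (fun y => g y i 0))) (cprim (ext0 `]0, b[ (fun y => g y i 0)) a).
Proof.
apply: cac_ccvg => s t; apply: cprim_ac; apply: cinteg_ext0 => //.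
have := cL2_cintegM mI cL2_1 (gL2 i 0).
by apply: eq_cinteg => // y _; rewrite mul1r.
Qed.

Lemma dom_cvg_right n : exists L, mcvg ((x n)^'+) f L.
Proof.
have [a Ha] := choice (f_prim n).
exists (\col_i (a i + cprim (ext0 `]0, b[ (fun y => g y i 0)) (x n))) => i j.
rewrite ord1 mxE; apply: (@ccvg_near _ _ _ (fun y => a i + cprim (ext0 `]0, b[ (fun y => g y i 0)) y)).
  near=> y; rewrite Ha //; apply/andP; split; near: y; first exact: nbhs_right_gt.
  by apply: nbhs_right_lt; exact: xmono.
apply: ccvgD; first exact: ccvg_cst.
by case: (gprim_cvg i (x n)) => H1 H2; split; exact: cvg_within_filter.
Unshelve. all: by end_near. Qed.

Lemma dom_cvg_left n : exists L, mcvg ((x n.+1)^'-) f L.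
Proof.
have [a Ha] := choice (f_prim n).
exists (\col_i (a i + cprim (ext0 `]0, b[ (fun y => g y i 0)) (x n.+1))) => i j.
rewrite ord1 mxE; apply: (@ccvg_near _ _ _ (fun y => a i + cprim (ext0 `]0, b[ (fun y => g y i 0)) y)).
  near=> y; rewrite Ha //; apply/andP; split; near: y; last exact: nbhs_left_lt.
  by apply: nbhs_left_gt; exact: xmono.
apply: ccvgD; first exact: ccvg_cst.
by case: (gprim_cvg i (x n.+1)) => H1 H2; split; exact: cvg_within_filter.
Unshelve. all: by end_near. Qed.

(** f_I is continuous at x_(n+1), being locally absolutely continuous there, and
    the limits of f_II differ by the prescribed jump. *)
Lemma dom_jump n L : mcvg ((x n.+1)^'-) f L ->
  mcvg ((x n.+1)^'+) f (jump_mx (alpha n.+1) *m L).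
Proof.
move=> HL; have [K HK] := dom_cvg_right n.+1.
suff -> : jump_mx (alpha n.+1) *m L = K by [].
case: dom => _ fIac _ _ /(_ n.+1 isT) [vp [vm [/vcvgP Hp /vcvgP Hm jmp]]].
have fI_cvg : mcvg (nbhs (x n.+1)) (fI f) (fI f (x n.+1)).
  apply: (@mcvg_nbhs_in _ _ _ (x n + (x n.+1 - x n) / 2) (x n.+2 - (x n.+2 - x n.+1) / 2)).
  - by have := xmono (ltnSn n); lra.
  - by have := xmono (ltnSn n.+1); lra.
  apply/abs_contP; apply: fIac.
    by have := xmono (ltnSn n); have := xmono (ltnSn n.+1); lra.
  move=> y /=; rewrite !in_itv /= => /andP[h1 h2]; have := x_ge0 n.
  have := x_lt_b n.+2; have := xmono (ltnSn n); have := xmono (ltnSn n.+1) => *.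
  by apply/andP; split; lra.
have Lu : usubmx L = fI f (x n.+1).
  by apply: (mcvg_unique (mcvg_usub HL)); exact: mcvg_within fI_cvg.
have Ku : usubmx K = fI f (x n.+1).
  by apply: (mcvg_unique (mcvg_usub HK)); exact: mcvg_within fI_cvg.
have Ld : dsubmx L = vm by exact: (mcvg_unique (mcvg_dsub HL) Hm).
have Kd : dsubmx K = vp by exact: (mcvg_unique (mcvg_dsub HK) Hp).
rewrite -[LHS]vsubmxK -[RHS]vsubmxK usub_jump dsub_jump Lu Ku Ld Kd; congr col_mx.
by move/eqP: jmp; rewrite subr_eq => /eqP ->; rewrite addrC scaleNr.
Qed.

Section lagrange.
Variable u : 'cV[C]_p.
Let e y := fund_mx z y *m col_mx u 0.
Let et n y := piece_mx z n y *m col_mx u 0.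
Let h y := dirac_expr c (f y) (g y) + z *: f y.
Let k y := ('i%C / cC) * (ctr (e y) *m h y) 0 0.
Let kc := ext0 `]0, b[ k.
Let wt n y := ctr (et n y) *m (swap_mx R p *m f y).

Let eL2 : entrywise (cL2 `]0, b[) e.
Proof. by apply: mcL2_mulr => //; exact: fund_L2. Qed.

Let hL2 : entrywise (cL2 `]0, b[) h.
Proof.
by apply: mcL2D => //; [apply: mcL2D => //|]; apply: mcL2Z => //; exact: mcL2_mul.
Qed.

Let ik : cinteg `]0, b[ k.
Proof. by apply: cintegZ => //; exact: (cinteg_pair mI eL2 hL2). Qed.

Let ikc : cinteg setT kc. Proof. exact: cinteg_ext0. Qed.

Let et_der n y : mder (et n) y (dirac_gen p c z *m et n y).
Proof.
have := mderM (mder_piece n y) (mder_cst (col_mx u 0) y).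
by rewrite mulmx0 addr0 -(mulmxA (dirac_gen p c z)).
Qed.

Let et_ac n s t : entrywise (cac s t) (et n).
Proof.
by apply: (entrywise_mul (star_cac s t)); [exact: piece_cac|exact: (entrywise_cst (star_cac s t))].
Qed.

(** The terms with f cancel, because sigma times the generator of -z is minus
    the generator of z times sigma. *)
Let wt_der_val n y :
  ctr (dirac_gen p c z *m et n y) *m (swap_mx R p *m f y) +
  ctr (et n y) *m (0 *m f y + swap_mx R p *m g y) =
  ('i%C / cC) *: (ctr (et n y) *m h y).
Proof.
have := dirac_expr_inv c0 (- z) (f y) (g y).
rewrite scaleNr opprK -/(h y) => gE.
rewrite mul0mx add0r gE mulmxDr -scalemxAr (mulmxA (swap_mx R p) (swap_mx R p)) swap_mxK mul1mx.
rewrite (mulmxA (swap_mx R p)) swap_dirac_gen opprK mulNmx.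
rewrite ctrM ctr_dirac_gen // -!mulmxA -mulmxDr addrA subrr add0r.
by rewrite -scalemxAr.
Qed.

Let wt_der n : {ae lebesgue_measure, forall y : R, x n < y < x n.+1 ->
  cder (fun y => wt n y 0 0) y (kc y)}.
Proof.
apply: aeS (f_der n) => y H yn.
have yI : y \in `]0, b[%classic.
  by rewrite inE; apply: (sub_I (n := n)); rewrite /= in_itv.
rewrite /kc /ext0 yI.
have -> : k y = (('i%C / cC) *: (ctr (et n y) *m h y)) 0 0.
  by rewrite mxE /k /e (@fundE z n) //; case/andP: yn => /ltW -> ->.
rewrite -wt_der_val.
exact: (mderM (mder_ctr (et_der n y)) (mderM (mder_cst (swap_mx R p) y) (H yn))).
Qed.

Let wt_prim n : exists a : C, forall y : R, x n < y < x n.+1 ->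
  wt n y 0 0 = a + cprim kc y.
Proof.
apply: ac_eq_cprim => // u' v nu uv vn.
apply: (entrywise_mul (star_cac _ _)); first by apply: (entrywise_ctr (star_cac _ _)); exact: et_ac.
by apply: (entrywise_mul (star_cac _ _)); [exact: (entrywise_cst (star_cac _ _))|exact: f_ac nu vn].
Qed.

Let kprim_cvg (a : R) : ccvg (nbhs a) (cprim kc) (cprim kc a).
Proof. by apply: cac_ccvg => s t; exact: cprim_ac. Qed.

Let cprim0 y : y <= 0 -> cprim kc y = 0.
Proof.
move=> y0; rewrite /cprim (@eq_cint _ _ kc (fun=> 0)); first exact: cint0.
move=> t /=; rewrite in_itv /= => ty; rewrite /kc /ext0 memNset //= in_itv /=.
by move=> /andP[t0 _]; have := le_lt_trans (le_trans ty y0) t0; rewrite ltxx.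
Qed.

Let wt_cvg_right n L : mcvg ((x n)^'+) f L ->
  mcvg ((x n)^'+) (wt n) (ctr (et n (x n)) *m (swap_mx R p *m L)).
Proof.
move=> HL; apply: mcvgM; last by apply: mcvgM => //; exact: mcvg_cst.
by apply: mcvg_ctr; apply: mcvg_within; apply: mcvg_nbhs => s t; exact: et_ac.
Qed.

Let wt_cvg_left n L : mcvg ((x n.+1)^'-) f L ->
  mcvg ((x n.+1)^'-) (wt n) (ctr (et n (x n.+1)) *m (swap_mx R p *m L)).
Proof.
move=> HL; apply: mcvgM; last by apply: mcvgM => //; exact: mcvg_cst.
by apply: mcvg_ctr; apply: mcvg_within; apply: mcvg_nbhs => s t; exact: et_ac.
Qed.

Let wt_right n a L : (forall y : R, x n < y < x n.+1 -> wt n y 0 0 = a + cprim kc y) ->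
  mcvg ((x n)^'+) f L ->
  (ctr (et n (x n)) *m (swap_mx R p *m L)) 0 0 = a + cprim kc (x n).
Proof.
move=> Ha HL; apply: (ccvg_unique (wt_cvg_right HL 0 0)).
apply: (@ccvg_near _ _ _ (fun y => a + cprim kc y)).
  near=> y; rewrite Ha //; apply/andP; split; near: y; first exact: nbhs_right_gt.
  by apply: nbhs_right_lt; exact: xmono.
apply: ccvgD; first exact: ccvg_cst.
by case: (kprim_cvg (x n)) => H1 H2; split; exact: cvg_within_filter.
Unshelve. all: by end_near. Qed.

Let wt_left n a L : (forall y : R, x n < y < x n.+1 -> wt n y 0 0 = a + cprim kc y) ->
  mcvg ((x n.+1)^'-) f L ->
  (ctr (et n (x n.+1)) *m (swap_mx R p *m L)) 0 0 = a + cprim kc (x n.+1).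
Proof.
move=> Ha HL; apply: (ccvg_unique (wt_cvg_left HL 0 0)).
apply: (@ccvg_near _ _ _ (fun y => a + cprim kc y)).
  near=> y; rewrite Ha //; apply/andP; split; near: y; last exact: nbhs_left_lt.
  by apply: nbhs_left_gt; exact: xmono.
apply: ccvgD; first exact: ccvg_cst.
by case: (kprim_cvg (x n.+1)) => H1 H2; split; exact: cvg_within_filter.
Unshelve. all: by end_near. Qed.

(** The constants of the successive intervals all vanish: the first by the
    condition at 0, the others because w has equal one-sided limits at x_n. *)
Let wtE n y : x n < y < x n.+1 -> wt n y 0 0 = cprim kc y.
Proof.
move: y; suff [a [a0 Ha]] : exists a, a = 0 /\ forall y : R, x n < y < x n.+1 ->
    wt n y 0 0 = a + cprim kc y.
  by move=> y /Ha ->; rewrite a0 add0r.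
elim: n => [|n [a [a0 Ha]]].
  have [a Ha] := wt_prim 0; exists a; split => //.
  have [L HL] := dom_cvg_right 0; have := wt_right Ha HL.
  rewrite x0 cprim0 // addr0 => <-; rewrite /et /piece_mx x0 subrr propagator0 mul1mx /= mul1mx.
  have Ld : dsubmx L = 0.
    case: dom => _ _ _ /vcvgP H _; rewrite x0 in HL.
    exact: (mcvg_unique (mcvg_dsub HL) H).
  rewrite -[L]vsubmxK Ld /swap_mx mul_block_col !(mul0mx, mul1mx, mulmx0, addr0, add0r).
  rewrite /ctr tr_col_mx map_row_mx mul_row_col trmx0 map_mx0 mul0mx mulmx0.
  by rewrite addr0 mxE.
have [L HL] := dom_cvg_left n; have Hl := wt_left Ha HL.
have [a' Ha'] := wt_prim n.+1; exists a'; split => //.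
have := wt_right Ha' (dom_jump HL).
have -> : et n.+1 (x n.+1) = jump_mx (alpha n.+1) *m et n (x n.+1).
  by rewrite /et piece_jump mulmxA.
rewrite ctrM !mulmxA -[ctr _ *m _ *m swap_mx R p]mulmxA.
rewrite -[_ *m jump_mx _]mulmxA jump_swap // -mulmxA Hl a0 add0r.
by move=> /eqP; rewrite -subr_eq0 opprD addrA addrAC subrr sub0r oppr_eq0 => /eqP.
Qed.

(** Near b the function f, hence w, vanishes, while w is the primitive of its
    derivative starting at 0. *)
Lemma lagrange : cint `]0, b[ (fun y => (ctr (e y) *m h y) 0 0) = 0.
Proof.
have cprim_b : cprim kc b = cint `]0, b[ k.
  rewrite /cprim /kc cint_ext0 // => y /=; rewrite !in_itv /= => /andP[_ /ltW]; exact.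
have ic0 : 'i%C / cC != 0 :> C.
  have i0 : 'i%C != 0 :> C by apply/eqP => /(congr1 (@complex.Im R))/eqP; rewrite /= oner_eq0.
  by rewrite mulf_neq0 // invr_neq0 // fmorph_eq0 gt_eqF.
suff : cprim kc b = 0.
  rewrite cprim_b /k cintZ //; last exact: (cinteg_pair mI eL2 hL2).
  by move/eqP; rewrite mulf_eq0 (negbTE ic0) => /eqP.
apply: Normc.eq0_normc; apply/eqP; rewrite eq_le normc_ge0 andbT.
apply/ler_addgt0Pr => eps eps0; rewrite add0r.
have [d d0 Hd] := ac_single (cprim_ac ikc 0 b) eps0.
case: dom => -[_ [beta betab f0]] _ _ _ _.
have mb : Num.max beta (b - d) < b by rewrite gt_max betab; lra.
have [n Hn] := x_exceeds mb; rewrite gt_max in Hn; case/andP: Hn => nbeta nd.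
have [|y yn fy] := ae_exists (P := fun y => f y = 0) (xmono (ltnSn n)).
  apply: aeS f0 => y H /andP[ny yn]; apply: H => /=; rewrite in_itv /=.
  by rewrite (lt_trans nbeta ny) (lt_trans yn (x_lt_b _)).
have ky : cprim kc y = 0 by rewrite -(wtE yn) /wt fy !mulmx0 mxE.
rewrite -[cprim kc b]subr0 -ky; apply/ltW/Hd => //; case/andP: yn => ny yn.
- exact: ltW (le_lt_trans (x_ge0 n) ny).
- exact: ltW (lt_trans yn (x_lt_b _)).
- by lra.
Qed.

End lagrange.
End one_sided_limits.

Let mI : measurable (`]0, b[ : set R). Proof. exact: measurable_itv. Qed.

(** * Solutions in the kernel of the adjoint *)

Lemma fund_col_L2 (u : 'cV[C]_p) : L2 `]0, b[ (fun y => fund_mx z y *m col_mx u 0).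
Proof. by apply/(L2_entrywise _ mI); apply: mcL2_mulr => //; exact: fund_L2. Qed.

Lemma L2inner_Zr (a : C) (F G : R -> 'cV[C]_(p + p)) : L2 `]0, b[ F -> L2 `]0, b[ G ->
  L2inner `]0, b[ F (fun y => a *: G y) = a^*%C * L2inner `]0, b[ F G.
Proof.
move=> HF HG; rewrite !L2innerE -cintZ //; last exact: cinteg_L2inner.
by apply: eq_cint => y _; rewrite ctrZ -scalemxAl mxE.
Qed.

Lemma L2_scale (a : C) (G : R -> 'cV[C]_(p + p)) : L2 `]0, b[ G ->
  L2 `]0, b[ (fun y => a *: G y).
Proof. by move=> /(L2_entrywise _ mI) H; apply/(L2_entrywise _ mI); exact: mcL2Z. Qed.

Lemma L2_add (F G : R -> 'cV[C]_(p + p)) : L2 `]0, b[ F -> L2 `]0, b[ G ->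
  L2 `]0, b[ (fun y => F y + G y).
Proof.
by move=> /(L2_entrywise _ mI) H /(L2_entrywise _ mI) K; apply/(L2_entrywise _ mI); exact: mcL2D.
Qed.

Lemma GS_graph0_L2 FU : GS_graph0 c b x alpha FU -> L2 `]0, b[ FU.1 /\ L2 `]0, b[ FU.2.
Proof. by case. Qed.

Lemma fund_kernel (u : 'cV[C]_p) :
  op_ker_shift `]0, b[ (op_adjoint `]0, b[ (GS_graph c b x alpha)) z
    (fun y => fund_mx z y *m col_mx u 0).
Proof.
pose e := fun y : R => fund_mx z y *m col_mx u 0; rewrite -/e.
have He : L2 `]0, b[ e by exact: fund_col_L2.
exists (fun y => z *: e y); last by apply: aeW => y _; rewrite subrr.
apply: op_adjoint_closure => //; first exact: GS_graph0_L2.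
split=> //=; first exact: L2_scale.
move=> F U [/= HF HU [f [g [dom Ff Ug]]]].
rewrite L2inner_Zr // zC mulNr; apply/eqP; rewrite -subr_eq0 opprK; apply/eqP.
rewrite !L2innerE -cintZ //; last exact: cinteg_L2inner.
rewrite -cintD //; [|exact: cinteg_L2inner|by apply: cintegZ => //; exact: cinteg_L2inner].
rewrite -(lagrange dom u) -/e.
have [Hf Hg] : L2 `]0, b[ f /\ L2 `]0, b[ g by case: dom => -[[]].
have Hh : L2 `]0, b[ (fun y => dirac_expr c (f y) (g y) + z *: f y).
  apply: L2_add; last exact: L2_scale.
  move: Hf Hg => /(L2_entrywise _ mI) Hf /(L2_entrywise _ mI) Hg; apply/(L2_entrywise _ mI).
  by apply: mcL2D => //; apply: mcL2Z => //; exact: mcL2_mul.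
apply: cint_ae => //.
- apply: cinteg_meas => //; apply: cintegD => //; first exact: cinteg_L2inner.
  by apply: cintegZ => //; exact: cinteg_L2inner.
- by apply: cinteg_meas => //; exact: cinteg_L2inner.
- apply: aeS2 Ff Ug => y H1 H2 yI /=.
  by rewrite (H1 yI) (H2 yI) [in RHS]mulmxDr [RHS]mxE -scalemxAr [X in _ = _ + X]mxE.
Qed.

End spectral.

(** * Solving the inhomogeneous equation with compact support *)

Section range.
Variable z : C.
Hypothesis z2 : z ^+ 2 = -1.
Hypothesis zC : z^*%C = - z.
Hypothesis sum_lty : (\sum_(2 <= n <oo)
     ((x n - x n.-1) *
      \prod_(1 <= k < n) (1 + c^-1 * opnorm (alpha k)) ^+ 2)%:E < +oo)%E.
Let mz2 : (- z) ^+ 2 = -1. Proof. by rewrite sqrrN. Qed.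
Let mzC : (- z)^*%C = - - z. Proof. by transitivity (- z^*%C); [exact: rmorphN|rewrite zC]. Qed.
Let mI : measurable (`]0, b[ : set R). Proof. exact: measurable_itv. Qed.

Variables (h : R -> 'cV[C]_(p + p)) (N : nat).
Hypothesis hL2 : L2 `]0, b[ h.
Hypothesis h_supp : forall y, x N <= y -> h y = 0.
Hypothesis h_orth : forall u : 'cV[C]_p,
  cint `]0, b[ (fun y => (ctr (fund_mx z y *m col_mx u 0) *m h y) 0 0) = 0.

Let hc : entrywise (cL2 `]0, b[) h. Proof. exact/(L2_entrywise _ mI). Qed.

Let kk y := ('i%C / cC) *: (swap_mx R p *m (ctr (fund_mx z y) *m h y)).
Let kc i := ext0 `]0, b[ (fun y => kk y i 0).
(** The variation of constants, normalized to vanish at b. *)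
Let v y : 'cV[C]_(p + p) := \col_i (cprim (kc i) y - cprim (kc i) b).

Let ik i : cinteg `]0, b[ (fun y => kk y i 0).
Proof.
have H := cinteg_pair mI (fund_L2 z2 zC sum_lty) hc.
rewrite /kk; under [X in cinteg _ X]eq_fun do rewrite mxE; apply: cintegZ => //.
under [X in cinteg _ X]eq_fun do rewrite mxE; apply: cinteg_sum => // j.
by apply: cintegZ => //; exact: H.
Qed.

Let ikc i : cinteg setT (kc i). Proof. exact: cinteg_ext0. Qed.

Let v_ac s t : entrywise (cac s t) v.
Proof.
move=> i j; under eq_fun do rewrite mxE.
exact: (starD (star_cac s t) (cprim_ac (ikc i) s t) (star_cst (star_cac s t) _)).
Qed.

Let v_der n : {ae lebesgue_measure, forall y : R, x n < y < x n.+1 -> mder v y (kk y)}.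
Proof.
have H : forall i, {ae lebesgue_measure, forall y : R, x n < y < x n.+1 ->
    cder (fun y => v y i 0) y (kk y i 0)}.
  move=> i; apply: aeS (cprim_der (ikc i)) => y Hy yn.
  have -> : kk y i 0 = kc i y + 0.
    rewrite addr0 /kc /ext0 ifT // inE /= in_itv /=; case/andP: yn => ny yn.
    by rewrite (le_lt_trans (x_ge0 n) ny) (lt_trans yn (x_lt_b _)).
  under [X in cder X]eq_fun do rewrite mxE.
  by apply: cderD => //; exact: cder_cst.
by apply: aeS (ae_fin H) => y {}H yn i j; rewrite ord1; exact: H.
Qed.

Let v_b y : x N <= y -> y < b -> v y = 0.
Proof.
move=> Ny yb; apply/matrixP => i j; rewrite !mxE -[LHS]opprB cprimB ?ltW //.
suff -> : cint `]y, b] (kc i) = 0 by rewrite oppr0.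
rewrite -(cint0 (measurable_itv `]y, b])); apply: eq_cint.
move=> t /=; rewrite in_itv /= => /andP[yt _]; rewrite /kc /ext0; case: ifP => // _.
by rewrite /kk h_supp ?(le_trans Ny) ?ltW // !mulmx0 scaler0 mxE.
Qed.

(** The orthogonality of h to the columns with vanishing second block at 0. *)
Let v_0 : dsubmx (v 0) = 0.
Proof.
apply/matrixP => i j; rewrite !mxE -[LHS]opprB cprimB ?ltW ?b_gt0 //.
suff -> : cint `]0, b] (kc (rshift p i)) = 0 by rewrite oppr0.
rewrite cint_ext0; last by move=> t /=; rewrite !in_itv /= => /andP[-> /ltW].
pose G y := (ctr (fund_mx z y *m col_mx (delta_mx i 0 : 'cV[C]_p) 0) *m h y) 0 0.
have HG : cint `]0, b[ G = 0 by exact: h_orth.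
transitivity (cint `]0, b[ (fun y => ('i%C / cC) * G y)); last first.
  rewrite cintZ ?HG ?mulr0 //; apply: (cinteg_pair mI _ hc).
  by apply: mcL2_mulr => //; exact: fund_L2.
apply: eq_cint => y _; rewrite /kk mxE; congr (_ * _).
rewrite /G -[ctr (fund_mx z y) *m h y]vsubmxK /swap_mx mul_block_col !(mul0mx, mul1mx, addr0, add0r).
rewrite col_mxEd ctrM -mulmxA -[ctr (fund_mx z y) *m h y in RHS]vsubmxK /ctr tr_col_mx.
rewrite map_row_mx trmx0 map_mx0 mul_row_col mul0mx addr0 trmx_delta map_delta_mx -rowE.
by rewrite [RHS]mxE.
Qed.

Let f y : 'cV[C]_(p + p) := fund_mx (- z) y *m v y.
Let ft n y : 'cV[C]_(p + p) := piece_mx (- z) n y *m v y.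
Let g y := dirac_gen p c (- z) *m f y + ('i%C / cC) *: (swap_mx R p *m h y).

Let fE n y : x n <= y < x n.+1 -> f y = ft n y.
Proof. by move=> yn; rewrite /f (fundE _ yn). Qed.

Let ft_ac n s t : entrywise (cac s t) (ft n).
Proof. by apply: (entrywise_mul (star_cac s t)); [exact: piece_cac|exact: v_ac]. Qed.

Let fL2 : entrywise (cL2 `]0, b[) f.
Proof.
have H := fund_L2 mz2 mzC sum_lty.
move=> i j; rewrite /f; under [X in cL2 _ X]eq_fun do rewrite mxE; apply: cL2_sum => // l.
have [M _ HM] := cac_bounded (v_ac 0 b l j).
apply: (@cL2_mulb _ _ mI _ _ M); first exact: H.
  by apply: cac_cmeas => // s t; exact: v_ac.
by move=> y /=; rewrite in_itv /= => /andP[/ltW y0 /ltW yb]; exact: HM.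
Qed.

Let gL2 : entrywise (cL2 `]0, b[) g.
Proof. by apply: mcL2D => //; [|apply: mcL2Z => //]; exact: mcL2_mul. Qed.

(** By [piece_swap], sigma times the adjoint of the matrix for z, times sigma, is
    the inverse of the matrix for -z. *)
Let piece_kk n y : x n < y < x n.+1 ->
  piece_mx (- z) n y *m kk y = ('i%C / cC) *: (swap_mx R p *m h y).
Proof.
move=> /andP[ny yn]; rewrite /kk (@fundE z n) ?yn ?ltW // -scalemxAr; congr (_ *: _).
have P1 : (swap_mx R p *m ctr (piece_mx z n y) *m swap_mx R p) *m piece_mx (- z) n y = 1%:M.
  by rewrite -!mulmxA [ctr _ *m _]mulmxA piece_swap // swap_mxK.
have P2 := mulmx1C P1.
rewrite !mulmxA -[RHS](mul1mx) -P2 !mulmxA; congr (_ *m _).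
by rewrite -[RHS]mulmxA swap_mxK mulmx1.
Qed.

Let ft_der n : {ae lebesgue_measure,
  forall y : R, x n < y < x n.+1 -> mder (ft n) y (g y)}.
Proof.
apply: aeS (v_der n) => y H yn.
have := mderM (mder_piece mz2 n y) (H yn).
rewrite piece_kk // -(mulmxA (dirac_gen p c (- z))) -/(ft n y) /g (@fE n) //.
by case/andP: yn => /ltW -> ->.
Qed.

Let f_der n : {ae lebesgue_measure, forall y : R, x n < y < x n.+1 -> mder f y (g y)}.
Proof.
apply: aeS (ft_der n) => y H yn i j; have [H1 H2] := H yn i j.
have ev : \forall w \near y, ft n w = f w.
  case/andP: yn => ny yn; near=> w; rewrite (@fE n) //; apply/andP; split; near: w.
    by apply: filterS (lt_nbhsr ny) => w /ltW.
  exact: lt_nbhsl.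
by split; [apply: near_eq_is_derive H1|apply: near_eq_is_derive H2]; apply: filterS ev => w ->.
Unshelve. all: by end_near. Qed.

Let ft_jump n : ft n.+1 (x n.+1) = jump_mx (alpha n.+1) *m ft n (x n.+1).
Proof. by rewrite /ft piece_jump mulmxA. Qed.

Let fI_ac n : entrywise (cac 0 (x n)) (fI f).
Proof.
have usubE i j : (fun y => fI f y i j) = (fun y => f y (lshift p i) j).
  by apply/funext => y; rewrite /fI mxE.
move=> i j; rewrite usubE; elim: n => [|n IH].
  rewrite x0; apply: (@ac_lipschitz _ _ _ 0) => // u w u0 uw w0.
  have -> : u = 0 by apply/eqP; rewrite eq_le u0 (le_trans uw w0).
  have -> : w = 0 by apply/eqP; rewrite eq_le w0 (le_trans u0 uw).
  by rewrite !subrr normc0E mulr0.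
apply: cac_cat IH _; [exact: x_ge0|exact/ltW/xmono|].
apply: eq_cac (ft_ac n (x n) (x n.+1) (lshift p i) j) => y ny.
rewrite le_eqVlt => /predU1P[->|yn]; last by rewrite (@fE n) // ny.
rewrite (@fE n.+1) ?lexx ?xmono // ft_jump.
have := congr1 (fun A : 'cV[C]_p => A i j) (usub_jump (alpha n.+1) (ft n (x n.+1))).
by move: (jump_mx _ *m _) => A; rewrite !mxE.
Qed.

Let fII_ac s t : s <= t -> `[s, t] `<=` (`]0, b[ `\` range x) ->
  entrywise (cac s t) (fII f).
Proof.
move=> st sub.
have [[]] : (`]0, b[ `\` range x) s by apply: sub; rewrite /= in_itv /= lexx.
rewrite /= in_itv /= => /andP[s0 sb] sx.
have [n /andP[ns sn]] := x_interval (ltW s0) sb.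
have {}ns : x n < s.
  by rewrite lt_neqAle ns andbT; apply/eqP => e; apply: sx; exists n.
have tn : t < x n.+1.
  rewrite ltNge; apply/negP => nt.
  have [_ []] : (`]0, b[ `\` range x) (x n.+1) by apply: sub; rewrite /= in_itv /= (ltW sn).
  by exists n.+1.
move=> i j; have := ft_ac n s t (rshift p i) j; apply: eq_cac => y sy yt.
rewrite /fII [RHS]mxE (@fE n) //; apply/andP; split; first exact: ltW (lt_le_trans ns sy).
exact: le_lt_trans yt tn.
Qed.

Let f_cvg_right n : mcvg ((x n)^'+) f (ft n (x n)).
Proof.
apply: (@mcvg_near _ _ _ _ _ (ft n)).
  near=> y; rewrite (@fE n) //; apply/andP; split; near: y; last first.
    by apply: nbhs_right_lt; exact: xmono.
  exact: nbhs_right_ge.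
by apply: mcvg_within; apply: mcvg_nbhs => s t; exact: ft_ac.
Unshelve. all: by end_near. Qed.

Let f_cvg_left n : mcvg ((x n.+1)^'-) f (ft n (x n.+1)).
Proof.
apply: (@mcvg_near _ _ _ _ _ (ft n)).
  near=> y; rewrite (@fE n) //; apply/andP; split; near: y; last exact: nbhs_left_lt.
  by apply: nbhs_left_ge; exact: xmono.
by apply: mcvg_within; apply: mcvg_nbhs => s t; exact: ft_ac.
Unshelve. all: by end_near. Qed.

Let dom_f : GS_dom0 c b x alpha f g.
Proof.
split.
- split; last first.
    exists (x N); first exact: x_lt_b.
    apply: aeW => y /=; rewrite in_itv /= => /andP[Ny yb].
    by rewrite /f v_b ?ltW // mulmx0.
  split; [exact/(L2_entrywise _ mI)|exact/(L2_entrywise _ mI)|] => n.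
  have mn : measurable (`]x n, x n.+1[ : set R) by exact: measurable_itv.
  have sub : `]x n, x n.+1[ `<=` (`]0, b[ : set R).
    move=> y /=; rewrite !in_itv /= => /andP[ny yn].
    by rewrite (le_lt_trans (x_ge0 n) ny) (lt_trans yn (x_lt_b _)).
  split.
  + by apply/(L2_entrywise _ mn) => i j; apply: cL2_sub (fL2 i j).
  + by apply/(L2_entrywise _ mn) => i j; apply: cL2_sub (gL2 i j).
  + move=> s t st st_sub; apply/abs_contP => i j.
    apply: eq_cac (ft_ac n s t i j) => y sy yt; rewrite (@fE n) //.
    have : `]x n, x n.+1[%classic y by apply: st_sub; rewrite /= in_itv /= sy.
    by rewrite /= in_itv /= => /andP[/ltW -> ->].
  + apply: aeS (f_der n) => y H /=; rewrite in_itv /= => yn k.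
    exact: H yn k 0.
- move=> s t st sub; apply/abs_contP => i j.
  have : `]0, b[%classic s by apply: sub; rewrite /= in_itv /= lexx.
  have : `]0, b[%classic t by apply: sub; rewrite /= in_itv /= lexx andbT.
  rewrite /= !in_itv /= => /andP[_ tb] /andP[s0 _].
  have [n tn] := x_exceeds tb.
  by apply: ac_subitv (fI_ac n i j); exact: ltW.
- by move=> s t st sub; apply/abs_contP; exact: fII_ac.
- apply/vcvgP; have := mcvg_dsub (f_cvg_right 0).
  by rewrite /ft piece_node /= mul1mx x0 v_0.
- case=> // n _; exists (dsubmx (ft n.+1 (x n.+1))), (dsubmx (ft n (x n.+1))).
  split; [apply/vcvgP; exact: mcvg_dsub|apply/vcvgP; exact: mcvg_dsub|].
  rewrite /fI (@fE n.+1) ?lexx ?xmono // ft_jump usub_jump dsub_jump.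
  by rewrite addrC addKr scaleNr.
Qed.

(** The function f = Y_(-z) v satisfies D f = -z f + h and lies in the domain. *)
Lemma fund_range : exists f, GS_graph0 c b x alpha (f, fun y => - z *: f y + h y).
Proof.
exists f; have HL := dom_f; split => /=.
- exact/(L2_entrywise _ mI).
- by apply/(L2_entrywise _ mI); apply: mcL2D => //; exact: mcL2Z.
exists f, g; split => //; first by apply: aeW => y _.
by apply: aeW => y _; rewrite /g dirac_exprE.
Qed.

End range.

(** * Dimension of the deficiency spaces *)

Section deficiency.
Variable z : C.
Hypothesis z2 : z ^+ 2 = -1.
Hypothesis zC : z^*%C = - z.
Hypothesis sum_lty : (\sum_(2 <= n <oo)
     ((x n - x n.-1) *
      \prod_(1 <= k < n) (1 + c^-1 * opnorm (alpha k)) ^+ 2)%:E < +oo)%E.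
Let mI : measurable (`]0, b[ : set R). Proof. exact: measurable_itv. Qed.
Local Notation ker :=
  (op_ker_shift `]0, b[ (op_adjoint `]0, b[ (GS_graph c b x alpha)) z).

(** The solutions whose second block vanishes at 0. *)
Let E y : 'M[C]_(p + p, p) := fund_mx z y *m col_mx 1%:M 0.

Let E_mul y (a : 'cV[C]_p) : E y *m a = fund_mx z y *m col_mx a 0.
Proof. by rewrite /E -mulmxA mul_col_mx mul1mx mul0mx. Qed.

Let EL2 : entrywise (cL2 `]0, b[) E.
Proof. by apply: mcL2_mulr => //; exact: fund_L2. Qed.

Let E_top y : 0 < y < x 1%N -> usubmx (E y) = (coshk (kappa c) y)%:C%C%:M.
Proof.
move=> /andP[y0 y1]; rewrite /E (@fundE z 0%N) ?x0 ?(ltW y0) //.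
rewrite /piece_mx x0 subr0 /= mulmx1 /propagator /dirac_gen mulmxDl mul_scalar_mx -!scalemxAl.
rewrite mul_block_col !(mul0mx, mulmx0, mulmx1, addr0) !scale_col_mx add_col_mx col_mxKu.
by rewrite !scaler0 addr0 scalemx1.
Qed.

Let colsE (a : 'I_p -> C) y :
  \sum_(k < p) a k *: (fund_mx z y *m col_mx (delta_mx k 0) 0) =
  E y *m \col_k a k.
Proof.
have -> : \col_k a k = \sum_(k < p) a k *: delta_mx k 0 :> 'cV[C]_p.
  apply/matrixP => i j; rewrite !mxE summxE (bigD1 i) //= big1 => [|k ki].
    by rewrite !mxE ord1 !eqxx mulr1 addr0.
  by rewrite !mxE eq_sym (negbTE ki) mulr0.
by rewrite mulmx_sumr; apply: eq_bigr => k _; rewrite -scalemxAr E_mul.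
Qed.

(** On the first interval the upper block of E is a nonzero scalar matrix. *)
Lemma fund_free (a : 'I_p -> C) :
  ae_eq lebesgue_measure `]0, b[%classic
    (fun y => \sum_(k < p) a k *: (fund_mx z y *m col_mx (delta_mx k 0) 0) : 'cV[C]_(p + p))
    (cst 0) ->
  forall k, a k = 0.
Proof.
move=> H k.
have x01 : 0 < x 1%N by rewrite -x0 xmono.
have [|y y01 Ey] := ae_exists (P := fun y => E y *m \col_k a k = 0) x01.
  apply: aeS H => y; rewrite colsE => H /andP[y0 y1]; apply: H => /=.
  by rewrite in_itv /= y0 (lt_trans y1) // x_lt_b.
have := congr1 usubmx Ey; rewrite -mul_usub_mx E_top // mul_scalar_mx => /matrixP/(_ k 0).
rewrite !mxE => /eqP; rewrite mulf_eq0 => /orP[|/eqP //].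
by rewrite fmorph_eq0 gt_eqF // coshk_gt0.
Qed.

Let I1 : set R := `]0, x 1%N[.
Let mI1 : measurable I1. Proof. exact: measurable_itv. Qed.
Let sub_I1 : I1 `<=` (`]0, b[ : set R).
Proof.
by move=> y; rewrite /I1 /= !in_itv /= => /andP[-> y1]; rewrite (lt_trans y1) // x_lt_b.
Qed.
Let mu_itv_lty (s t : R) : (lebesgue_measure (`]s, t[ : set R) < +oo)%E.
Proof. by rewrite lebesgue_measure_itv /=; case: ifP => // _; rewrite ltry. Qed.

Let ch_integ : cinteg I1 (fun y => (coshk (kappa c) y)%:C%C).
Proof.
have chac : forall s t, cac s t (fun y => (coshk (kappa c) y)%:C%C).
  move=> s t; have := cac_coshk (kappa c) 0 s t.
  by apply: eq_cac => y _ _; rewrite subr0.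
have [M _ HM] := cac_bounded (chac 0 (x 1%N)).
apply: (@cinteg_le _ _ mI1 _ (fun=> M)); first exact: cac_cmeas.
  by apply: rinteg_cst => //; exact: mu_itv_lty.
by move=> y; rewrite /I1 /= in_itv /= => /andP[/ltW y0 /ltW y1]; exact: HM.
Qed.

Let cosh_integral : C := cint I1 (fun y => (coshk (kappa c) y)%:C%C).

Let cosh_integral_neq0 : cosh_integral != 0.
Proof.
apply/eqP => /(congr1 (@complex.Re R)) /= m0.
have [I _] := ch_integ.
have := rint_eq0 mI1 I (fun y _ => ltW (coshk_gt0 (kappa c) y)) m0.
have x01 : 0 < x 1%N by rewrite -x0 xmono.
move=> H; have [|y _ y0] := ae_exists (P := fun y => coshk (kappa c) y = 0) x01.
  by apply: aeS H => y H y01; apply: H; rewrite /I1 /= in_itv.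
by have := coshk_gt0 (kappa c) y; rewrite y0 ltxx.
Qed.

Let step (n : nat) (a : C) := ext0 (`]0, x n[ : set R) (fun=> a).

Let step_meas n a : cmeas `]0, b[ (step n a).
Proof.
have mn : measurable (`]0, x n[ : set R) by exact: measurable_itv.
apply: (cmeas_sub mI measurableT) => //; apply: cinteg_meas => //.
by apply: cinteg_ext0 => //; split; apply: rinteg_cst => //; exact: mu_itv_lty.
Qed.

Let step_le n a y : normc (step n a y) <= normc a.
Proof. by rewrite /step /ext0; case: ifP => // _; rewrite normc0E normc_ge0. Qed.

Let step_out n a y : x n <= y -> step n a y = 0.
Proof.
by move=> ny; rewrite /step /ext0 memNset //= in_itv /= => /andP[_]; rewrite ltNge ny.
Qed.

(** Supported in the first interval and normalized to be biorthogonal to E. *)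
Let Phi y : 'M[C]_(p + p, p) := step 1 cosh_integral^-1 y *: col_mx 1%:M 0.

Let PhiL2 : entrywise (cL2 `]0, b[) Phi.
Proof.
apply: (mcL2_scaleb mI (step_meas 1 cosh_integral^-1) (fun y _ => step_le 1 cosh_integral^-1 y)).
by move=> i j; apply: cL2_cst => //; exact: mu_itv_lty.
Qed.

Let gram_E_Phi : gram `]0, b[ E Phi = 1%:M.
Proof.
apply/matrixP => i j; rewrite !mxE.
transitivity (cint I1 (fun y => cosh_integral^-1 * (i == j)%:R * (coshk (kappa c) y)%:C%C)); last first.
  by rewrite cintZ // -/cosh_integral mulrAC mulVf // mul1r.
rewrite -(cint_ext0 _ sub_I1); apply: eq_cint => y yI.
rewrite /Phi -scalemxAr mxE /step /ext0; case: ifPn => [|_]; last by rewrite mul0r.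
rewrite inE => y1; have {}y1 : 0 < y < x 1%N by move: y1; rewrite /I1 /= in_itv.
rewrite -[E y]vsubmxK E_top // /ctr tr_col_mx map_row_mx mul_row_col mulmx0 addr0 mulmx1.
rewrite tr_scalar_mx map_scalar_mx mxE -mulrA; congr (_ * _).
rewrite [RHS]mulrC -[LHS]mulr_natr; congr (_ * _); exact: conjc_real.
Qed.

Let gram_Phi_E : gram `]0, b[ Phi E = 1%:M.
Proof. by rewrite (gram_ctr mI EL2 PhiL2) gram_E_Phi ctr1. Qed.

Section spanning.
Variable G : R -> 'cV[C]_(p + p).
Hypothesis kerG : ker G.

Let GL2' : L2 `]0, b[ G. Proof. by case: kerG => W [/= HG _ _] _. Qed.
Let GL2 : entrywise (cL2 `]0, b[) G. Proof. exact/(L2_entrywise _ mI). Qed.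

(** Admissible functions h are of the form (D + z) f. *)
Let ker_range (h : R -> 'cV[C]_(p + p)) n : entrywise (cL2 `]0, b[) h ->
  (forall y, x n <= y -> h y = 0) -> gram `]0, b[ E h = 0 -> gram `]0, b[ G h = 0.
Proof.
move=> hL2 hs orth; case: kerG => W [/= _ WL2 adj] WG.
have hL2' : L2 `]0, b[ h by exact/(L2_entrywise _ mI).
have [|f Tf] := fund_range z2 zC sum_lty hL2' hs.
  move=> u; transitivity ((ctr u *m gram `]0, b[ E h) 0 0); last first.
    by rewrite orth mulmx0 mxE.
  rewrite (gram_ctr mI hL2 EL2) -ctrM -(gram_mulr mI u hL2 EL2) -gram_ctr //; last first.
    by apply: mcL2_mulr.
  by rewrite mxE; apply: eq_cint => y _; rewrite E_mul.
have [/= fL2 UL2 _] := Tf.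
have := adj _ _ (subset_op_closure mI (@GS_graph0_L2) Tf).
have -> : L2inner `]0, b[ f W = (- z) * L2inner `]0, b[ f G.
  rewrite -zC -L2inner_Zr // !L2innerE; apply: cint_ae => //.
  - by apply: cinteg_meas => //; exact: cinteg_L2inner.
  - by apply: cinteg_meas => //; apply: cinteg_L2inner => //; exact: L2_scale.
  - apply: aeS WG => y H /H /= /eqP; rewrite subr_eq0 => /eqP ->; done.
have If := cinteg_L2inner mI fL2 GL2'; have Ih := cinteg_L2inner mI hL2' GL2'.
have -> : L2inner `]0, b[ (fun y => - z *: f y + h y) G =
    - z * L2inner `]0, b[ f G + L2inner `]0, b[ h G.
  rewrite !L2innerE -cintZ // -cintD //; last exact: cintegZ.
  by apply: eq_cint => y _; rewrite mulmxDr -scalemxAr [LHS]mxE [X in X + _]mxE.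
move=> /eqP; rewrite -subr_eq0 addrAC subrr add0r => /eqP hG.
by apply/matrixP => i j; rewrite !ord1 [RHS]mxE -L2inner_gram hG.
Qed.

Let a : 'cV[C]_p := gram `]0, b[ Phi G.
(** The part of G that is orthogonal to Phi. *)
Let G' y := G y - E y *m a.
Let EaL2 : entrywise (cL2 `]0, b[) (fun y => E y *m a). Proof. exact: mcL2_mulr. Qed.
Let G'L2 : entrywise (cL2 `]0, b[) G'. Proof. exact: mcL2B. Qed.

Let gram_Phi_G' : gram `]0, b[ Phi G' = 0.
Proof.
rewrite [LHS](gramBr mI PhiL2 GL2 EaL2) (gram_mulr mI a PhiL2 EL2).
by rewrite gram_Phi_E mul1mx subrr.
Qed.

(** The correction of the cut-off of G' by Phi is orthogonal to E, hence to G
    and G'; as Phi is orthogonal to G', so is the cut-off itself. *)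
Let G'_piece n : {ae lebesgue_measure, forall y : R, 0 < y < x n.+1 -> G' y = 0}.
Proof.
pose h0 y := step n.+1 1 y *: G' y.
have h0L2 : entrywise (cL2 `]0, b[) h0.
  exact: (mcL2_scaleb mI (step_meas n.+1 1) (fun y _ => step_le n.+1 1 y)).
pose d := gram `]0, b[ E h0.
pose h y := h0 y - Phi y *m d.
have PdL2 : entrywise (cL2 `]0, b[) (fun y => Phi y *m d) by exact: mcL2_mulr.
have hL2 : entrywise (cL2 `]0, b[) h by exact: mcL2B.
have hs y : x n.+1 <= y -> h y = 0.
  move=> ny; have n1 : x 1%N <= y by apply: le_trans ny; exact: x_le.
  by rewrite /h /h0 /Phi !step_out // !scale0r mul0mx subrr.
have Eh : gram `]0, b[ E h = 0.
  rewrite [LHS](gramBr mI EL2 h0L2 PdL2) (gram_mulr mI d EL2 PhiL2).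
  by rewrite gram_E_Phi mul1mx subrr.
have Gh := ker_range hL2 hs Eh.
have hE : gram `]0, b[ h E = 0 by rewrite (gram_ctr mI EL2 hL2) Eh ctr0.
have hG : gram `]0, b[ h G = 0 by rewrite (gram_ctr mI GL2 hL2) Gh ctr0.
have hG' : gram `]0, b[ h G' = 0.
  rewrite [LHS](gramBr mI hL2 GL2 EaL2) (gram_mulr mI a hL2 EL2).
  by rewrite hE hG mul0mx subrr.
have G'h : gram `]0, b[ G' h = 0 by rewrite (gram_ctr mI hL2 G'L2) hG' ctr0.
have G'Phi : gram `]0, b[ G' Phi = 0 by rewrite (gram_ctr mI PhiL2 G'L2) gram_Phi_G' ctr0.
have G'h0 : gram `]0, b[ G' h0 = 0.
  have := gramBr mI G'L2 h0L2 PdL2.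
  by rewrite (gram_mulr mI d G'L2 PhiL2) G'Phi mul0mx subr0 => <-; exact: G'h.
have mn : measurable (`]0, x n.+1[ : set R) by exact: measurable_itv.
have sub : (`]0, x n.+1[ : set R) `<=` `]0, b[.
  by move=> y; rewrite /= !in_itv /= => /andP[-> yn]; rewrite (lt_trans yn) // x_lt_b.
have IG : rinteg `]0, x n.+1[ (fun y => enorm (G' y) ^+ 2).
  apply: (rinteg_sub mn mI sub).
  by case/(L2_entrywise _ mI): G'L2.
have I0 : rint `]0, x n.+1[ (fun y => enorm (G' y) ^+ 2) = 0.
  have := congr1 (fun A : 'M[C]_1 => complex.Re (A 0 0)) G'h0; rewrite !mxE.
  rewrite (@eq_cint _ _ _ (ext0 `]0, x n.+1[ (fun y => (enorm (G' y) ^+ 2)%:C%C))).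
    by rewrite (cint_ext0 _ sub).
  move=> y _; rewrite /h0 -scalemxAr mxE /step /ext0 enormE.
  by case: ifP => _; rewrite ?mul1r ?mul0r.
have := rint_eq0 mn IG (fun y _ => sqr_ge0 _) I0.
apply: aeS => y H yn; apply: enorm_eq0; apply/eqP; rewrite -sqrf_eq0; apply/eqP.
by apply: H; rewrite /= in_itv.
Qed.

Lemma ker_span : exists d : 'I_p -> C, ae_eq lebesgue_measure `]0, b[%classic G
  (fun y => \sum_(k < p) d k *: (fund_mx z y *m col_mx (delta_mx k 0) 0)).
Proof.
exists (fun k => a k 0); apply: aeS (ae_nat G'_piece) => y H /=.
rewrite in_itv /= => /andP[y0 yb]; rewrite colsE.
have [n yn] := x_exceeds yb.
have := H n; rewrite y0 (lt_trans yn (xmono (ltnSn n))) => /(_ isT) /eqP.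
rewrite subr_eq0 => /eqP ->; congr (_ *m _); by apply/matrixP => i j; rewrite [RHS]mxE ord1.
Qed.

End spanning.

Lemma ker_has_dim : has_dim `]0, b[ ker p.
Proof.
exists (fun k y => fund_mx z y *m col_mx (delta_mx k 0) 0); split.
- by move=> k; exact: fund_kernel.
- exact: fund_free.
- exact: ker_span.
Qed.

End deficiency.

End fundamental_matrix.

Theorem theorem5p2 (R : realType) (p : nat) (c b : R) (x : nat -> R)
    (alpha : nat -> 'M[R[i]]_p) :
  (0 < p)%N ->
  0 < c ->
  x 0%N = 0 ->
  (forall m n : nat, (m < n)%N -> x m < x n) ->
  x n @[n --> \oo] --> b ->
  (forall n, (1 <= n)%N -> alpha n = conj_tr (alpha n)) ->
  (\sum_(2 <= n <oo)
     ((x n - x n.-1) *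
      \prod_(1 <= k < n) (1 + c^-1 * opnorm (alpha k)) ^+ 2)%:E < +oo)%E ->
  n_plus `]0, b[ (GS_graph c b x alpha) p /\
  n_minus `]0, b[ (GS_graph c b x alpha) p.
Proof.
move=> _ c0 x0 xmono xlim alphaC sum_lty.
have iC : ('i%C : R[i])^*%C = - 'i%C by apply: complex_ext; rewrite /= ?oppr0.
split; apply: (ker_has_dim c0 x0 xmono xlim alphaC) => //.
- exact: sqr_i.
- by rewrite sqrrN sqr_i.
- by transitivity (- ('i%C : R[i])^*%C); [exact: rmorphN|rewrite iC].
Qed.
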